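(* Let $\mathcal{G}$ be the class of all groups, or the class of all abelian groups, or any other subgroup-closed class of groups that contains $\mathbb{Z}_3$. For a finite graph $\Gamma$, the following are equivalent: (i) The Circle Test is valid for $\Gamma$ with respect to $\mathcal{G}$ (i.e. for all gain graphs $(\Gamma,g,G)$ with $G\in\mathcal{G}$). (ii) None of $C_3(3,3,2)$, $2C_4$, $K_4''$, or $W_4$ is (isomorphic to) a minor of $\Gamma$. (iii) Each block of $\Gamma$ is isomorphic to a graph obtained by (zero or more) extrusions from one of $K_1^\circ$, $mK_2$ with $m\ge 1$, $C_3(m,2,2)$ with $m\ge 2$, or $K_4(m,m')$ with $m,m'\ge 1$.
   Context: Graphs may have loops and multiple edges. A gain graph $(\Gamma,g,G)$ is a graph $\Gamma=(V,E)$, a group $G$ (the gain group), and a homomorphism $g:F(E)\to G$ from the free group on $E$. Each edge $e$ has an arbitrary fixed orientation and $e^{-1}$ denotes the same edge in the opposite direction, so $g(e^{-1})=g(e)^{-1}$; the gain of a walk is the product, in order, of the gains of its (directed) edges. A circle is the edge set of a simple closed walk (nontrivial, no repeated vertex or edge except that initial and final vertices coincide; loops and pairs of parallel links are circles). A circle is balanced if the corresponding simple closed walk has gain $1$ (independent of starting point and direction). The gain graph is balanced if every circle is balanced. $Z_1(\Gamma;\mathbb{Z}_2)$ is the group of binary cycles (edge sets of even degree at every vertex, under symmetric difference). The Circle Test is valid for $(\Gamma,g,G)$ if the existence of a basis of $Z_1(\Gamma;\mathbb{Z}_2)$ consisting of balanced circles implies that $(\Gamma,g,G)$ is balanced. Classes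 of groups are closed under isomorphism; subgroup-closed means closed under taking subgroups. A minor is a graph obtained by contracting edges and taking subgraphs. Graphs: $W_n$ is the wheel with $n$ spokes. $mK_2$ is two vertices joined by $m$ parallel edges. $C_l(m_1,\dots,m_l)$ is the circle graph of length $l$ with its $i$th edge replaced by $m_i$ parallel copies, and $2C_4=C_4(2,2,2,2)$. $K_4(m,m')$ is $K_4$ with two opposite (nonadjacent) edges replaced by $m$ and $m'$ parallel copies, respectively. $K_4''$ is $K_4$ with two adjacent edges doubled. $K_1^\circ$ is a vertex with a loop. A graph is inseparable if any two edges lie in a common circle; a block is a maximal inseparable subgraph (isolated vertices are immaterial and are disregarded: blocks here are the usual blocks having at least one edge). Extruding a vertex from a vertex $v$ means: choose a neighbor $w\neq v$ of $v$ and at least one of the $vw$ edges; add a new vertex $v'$ and a new edge $e_v$ joining $v$ to $v'$; and let all the selected $vw$ edges become $v'w$ edges. No other edges are affected. *)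

(* Defs.v *)
From HB Require Import structures.
From mathcomp Require Import all_boot all_order all_algebra.
Set Implicit Arguments.
Unset Strict Implicit.
Unset Printing Implicit Defensive.

Import GRing.Theory.

(* Finite multigraphs; loops and multiple edges are allowed.  The pair
   (src e, tgt e) is the fixed reference orientation of e; the underlying
   undirected graph is given by the sets ends e (a singleton for a loop). *)
Record mgraph := MGraph {
  vert : finType;
  edge : finType;
  src : edge -> vert;
  tgt : edge -> vert }.

Definition ends (G : mgraph) (e : edge G) : {set vert G} :=
  [set src e; tgt e].

(* Isomorphism of the underlying undirected graphs: the reference orientations
   need not correspond. *)
Definition isomorphic (G H : mgraph) : Prop :=
  exists (fV : vert G -> vert H) (fE : edge G -> edge H),
    [/\ bijective fV, bijective fE &
        forall e, ends (fE e) = fV @: ends e].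

(* A dart is an edge with a direction of traversal: (e, true) is e in its
   reference orientation and (e, false) is e^-1. *)
Definition dart (G : mgraph) : Type := (edge G * bool)%type.

Definition dsrc (G : mgraph) (d : dart G) : vert G :=
  if d.2 then src d.1 else tgt d.1.

Definition dtgt (G : mgraph) (d : dart G) : vert G :=
  if d.2 then tgt d.1 else src d.1.

(* [cycle] also links the last dart back to the first one. *)
Definition simple_closed_walk (G : mgraph) (w : seq (dart G)) : bool :=
  [&& w != [::],
      cycle (fun d d' : dart G => dtgt d == dsrc d') w,
      uniq [seq dsrc d | d <- w] &
      uniq [seq d.1 | d <- w]].

Definition walk_edges (G : mgraph) (w : seq (dart G)) : {set edge G} :=
  [set e in [seq d.1 | d <- w]].

Definition circle (G : mgraph) (C : {set edge G}) : Prop :=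
  exists2 w : seq (dart G), simple_closed_walk w & walk_edges w = C.

(* A homomorphism from the free group on the edges to A is the same thing as
   its restriction g to the edges; walk_gain g w is the image of the word w. *)
Definition dart_gain (G : mgraph) (A : groupType) (g : edge G -> A)
    (d : dart G) : A :=
  (if d.2 then g d.1 else (g d.1)^-1)%g.

Definition walk_gain (G : mgraph) (A : groupType) (g : edge G -> A)
    (w : seq (dart G)) : A :=
  (\prod_(d <- w) dart_gain g d)%g.

Definition balanced_circle (G : mgraph) (A : groupType) (g : edge G -> A)
    (C : {set edge G}) : Prop :=
  exists w : seq (dart G),
    [/\ simple_closed_walk w, walk_edges w = C & walk_gain g w = 1%g].

Definition balanced (G : mgraph) (A : groupType) (g : edge G -> A) : Prop :=
  forall C : {set edge G}, circle C -> balanced_circle g C.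

(* Edge sets under symmetric difference are represented by their indicator
   vectors over F_2. *)
Notation edge_vec G := {ffun edge G -> ('F_2)^o}.

Definition chi (G : mgraph) (S : {set edge G}) : edge_vec G :=
  [ffun e => ((e \in S)%:R)%R].

(* A loop counts twice. *)
Definition degree (G : mgraph) (S : {set edge G}) (v : vert G) : nat :=
  \sum_(e in S) ((src e == v) + (tgt e == v)).

Definition binary_cycle (G : mgraph) (S : {set edge G}) : bool :=
  [forall v, ~~ odd (degree S v)].

Definition boundary (G : mgraph) (x : edge_vec G) : {ffun vert G -> ('F_2)^o} :=
  [ffun v => (\sum_e x e *+ ((src e == v) + (tgt e == v)))%R].

Fact boundary_is_linear (G : mgraph) : linear (@boundary G).
Proof.
move=> a x y; apply/ffunP=> v; rewrite !ffunE scaler_sumr -big_split /=.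
by apply: eq_bigr => e _; rewrite !ffunE mulrnDl scalerMnr.
Qed.
HB.instance Definition _ (G : mgraph) :=
  GRing.isLinear.Build _ _ _ _ (@boundary G) (@boundary_is_linear G).

Definition cycle_space (G : mgraph) : {vspace edge_vec G} :=
  lker (linfun (@boundary G)).

Lemma F2_natr_eq0 (n : nat) : ((n%:R : 'F_2) == 0)%R = ~~ odd n.
Proof.
by rewrite -(inj_eq val_inj) /= -dvdn2 /dvdn; rewrite val_Fp_nat.
Qed.

Lemma chi_cycle_space (G : mgraph) (S : {set edge G}) :
  (chi S \in cycle_space G) = binary_cycle S.
Proof.
have bE v : boundary (chi S) v = ((degree S v)%:R)%R :> 'F_2.
  rewrite !ffunE /degree natr_sum [in RHS]big_mkcond /=.
  by apply: eq_bigr => e _; rewrite ffunE; case: ifP; rewrite ?mul0rn.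
rewrite memv_ker lfunE /=; apply/eqP/forallP => [b0 v | ev].
  by rewrite -F2_natr_eq0 -bE b0 ffunE.
by apply/ffunP=> v; rewrite bE ffunE; apply/eqP; rewrite F2_natr_eq0.
Qed.

Definition circle_test_valid (G : mgraph) (A : groupType) (g : edge G -> A) :
    Prop :=
  (exists B : seq {set edge G},
     basis_of (cycle_space G) [seq chi C | C <- B] /\
     forall C, C \in B -> balanced_circle g C) ->
  balanced g.

Definition circle_test_valid_for (K : groupType -> Prop) (G : mgraph) : Prop :=
  forall A : groupType, K A ->
  forall g : edge G -> A, circle_test_valid g.

(* The injective morphisms into B are, up to isomorphism, the inclusions of its
   subgroups; in particular K is closed under isomorphism. *)
Definition subgroup_closed (K : groupType -> Prop) : Prop :=
  forall (A B : groupType) (f : {multiplicative A -> B}),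
    injective f -> K B -> K A.

(* The canonical group law on 'Z_3 is addition. *)
Definition Z3 : groupType := 'Z_3.

(* H is isomorphic to a subgraph of G. *)
Definition subgraph (H G : mgraph) : Prop :=
  exists (fV : vert H -> vert G) (fE : edge H -> edge G),
    [/\ injective fV, injective fE &
        forall e, ends (fE e) = fV @: ends e].

(* H is isomorphic to G / e: the ends of e are identified (and no other
   vertices), e disappears, every other edge is kept. *)
Definition contraction (G : mgraph) (e : edge G) (H : mgraph) : Prop :=
  exists (fV : vert G -> vert H) (fE : edge H -> edge G),
    [/\ forall y, exists x, fV x = y,
        forall x y, fV x = fV y <-> x = y \/ (x \in ends e /\ y \in ends e),
        injective fE,
        forall f, (exists h, fE h = f) <-> f <> e &
        forall h, ends h = fV @: ends (fE h)].

(* Closed under isomorphism, since [subgraph] is. *)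
Inductive minor (G : mgraph) : mgraph -> Prop :=
| minor_refl : minor G G
| minor_subgraph (H H' : mgraph) :
    minor G H -> subgraph H' H -> minor G H'
| minor_contraction (H H' : mgraph) (e : edge H) :
    minor G H -> contraction e H' -> minor G H'.

(* "Any two edges" means any two distinct edges: a single link is inseparable. *)
Definition inseparable (G : mgraph) : Prop :=
  forall e f : edge G, e != f ->
    exists C : {set edge G}, [/\ circle C, e \in C & f \in C].

Section EdgeSubgraph.
Variables (G : mgraph) (F : {set edge G}).

Definition cover_verts : {set vert G} := \bigcup_(e in F) ends e.

Fact src_cover_verts (e : {e : edge G | e \in F}) :
  src (val e) \in cover_verts.
Proof. by apply/bigcupP; exists (val e); rewrite ?(valP e) ?set21. Qed.

Fact tgt_cover_verts (e : {e : edge G | e \in F}) :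
  tgt (val e) \in cover_verts.
Proof. by apply/bigcupP; exists (val e); rewrite ?(valP e) ?set22. Qed.

Definition edge_subgraph : mgraph :=
  @MGraph {v : vert G | v \in cover_verts} {e : edge G | e \in F}
    (fun e => Sub (src (val e)) (src_cover_verts e))
    (fun e => Sub (tgt (val e)) (tgt_cover_verts e)).
End EdgeSubgraph.

(* A block is given by its edge set, since isolated vertices are disregarded. *)
Definition block (G : mgraph) (F : {set edge G}) : Prop :=
  [/\ F != set0, inseparable (edge_subgraph F) &
      forall F' : {set edge G},
        F \subset F' -> inseparable (edge_subgraph F') -> F' = F].

(* The new vertex v' and the new edge e_v are both None; S is the set of
   selected vw edges. *)
Definition extrude (G : mgraph) (v : vert G) (S : {set edge G}) : mgraph :=
  let move_end (e : edge G) (x : vert G) : option (vert G) :=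
    if (e \in S) && (x == v) then None else Some x in
  @MGraph (option (vert G)) (option (edge G))
    (fun oe => if oe is Some e then move_end e (src e) else Some v)
    (fun oe => if oe is Some e then move_end e (tgt e) else None).

Inductive extrusion_of (G0 : mgraph) : mgraph -> Prop :=
| extrusion_zero : extrusion_of G0 G0
| extrusion_step (G : mgraph) (v w : vert G) (S : {set edge G}) :
    extrusion_of G0 G ->
    w != v -> S != set0 -> (forall e, e \in S -> ends e = [set v; w]) ->
    extrusion_of G0 (extrude v S).

Definition mult_graph (V : finType) (mu : V -> V -> nat) : mgraph :=
  @MGraph V {p : V * V & 'I_(mu p.1 p.2)}
    (fun e => (tag e).1) (fun e => (tag e).2).

Definition K1loop : mgraph := mult_graph (fun _ _ : unit => 1).

Definition mK2 (m : nat) : mgraph :=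
  mult_graph (fun x y : bool => if ~~ x && y then m else 0).

(* C_l(m_1, ..., m_l) for ms = [:: m_1; ...; m_l], l >= 3; ordS is the cyclic
   successor. *)
Definition Cmult (ms : seq nat) : mgraph :=
  mult_graph (fun i j : 'I_(size ms) => if j == ordS i then nth 0 ms i else 0).

Definition K4mm (m m' : nat) : mgraph :=
  mult_graph (fun i j : 'I_4 =>
    match val i, val j with
    | 0, 1 => m
    | 2, 3 => m'
    | 0, 2 | 0, 3 | 1, 2 | 1, 3 => 1
    | _, _ => 0
    end).

Definition K4dd : mgraph :=
  mult_graph (fun i j : 'I_4 =>
    match val i, val j with
    | 0, 1 | 0, 2 => 2
    | 0, 3 | 1, 2 | 1, 3 | 2, 3 => 1
    | _, _ => 0
    end).

(* W_n for n >= 3, with hub None. *)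
Definition wheel (n : nat) : mgraph :=
  mult_graph (fun x y : option 'I_n =>
    match x, y with
    | None, Some _ => 1
    | Some i, Some j => (j == ordS i : nat)
    | _, None => 0
    end).

Inductive base_graph : mgraph -> Prop :=
| base_K1loop : base_graph K1loop
| base_mK2 (m : nat) : 1 <= m -> base_graph (mK2 m)
| base_C3 (m : nat) : 2 <= m -> base_graph (Cmult [:: m; 2; 2])
| base_K4 (m m' : nat) : 1 <= m -> 1 <= m' -> base_graph (K4mm m m').

(* Main.v *)
(* Duality turns the Circle Test into a statement about signs.  Call a set of edges
   balanced if the gains on it come from a potential on the vertices.  The balanced
   circles of [g] fail to span the binary cycle space exactly when some unbalanced
   gain function with values in the group of order two is balanced on every
   [g]-balanced edge set.  So the test is valid if and only if every unbalanced [g]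
   admits such a sign function.  In this form validity passes easily to subgraphs,
   contractions and extrusions and is determined by the blocks; it fails for the four
   forbidden graphs over Z_3, and for the base graphs the sign function is explicit.

   For the structure theorem, contract the edge [e_v] of a vertex that could have been
   extruded as long as there is one.  In the remaining irreducible block, each side of a
   2-separation {x, y} contains a path x - z - y with both edges doubled after
   contraction, so two sides give 2C_4.  Hence a block with at least four vertices is
   3-connected: with five or more it contracts to W_4 (Tutte), with four it is a
   multigraph on K_4 whose multiple edges are disjoint because K_4'' is excluded. *)
Require Import Defs.
From HB Require Import structures.
From mathcomp Require Import all_boot all_order all_algebra.
From Stdlib Require Import Classical.
Set Implicit Arguments.
Unset Strict Implicit.
Unset Printing Implicit Defensive.

(** In a nonabelian group an element of the binary cycle space has no gain, so [g] is not a
    functional on that space; moreover the circles of a minor do not match circles of the graph one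
    by one. Potentials avoid both obstacles: they need no base point, direction or circle, they move
    along vertex maps, and they treat [g] and its sign function alike. Every balanced edge set lies
    in some [pot g th], so a sign function has to be tested on these sets only. Over the group of
    order two the test is valid for every graph, because [g] serves as its own sign function. Z_3 is
    the smallest group over which it can fail, and all four forbidden graphs already fail there,
    while the sign functions of the base graphs exist over every group. The reduction to irreducible
    blocks has one purpose: a vertex that still has exactly two neighbours is joined to both by
    multiple edges, and these are the source of the doubled edges of 2C_4. *)

(** * Potentials *)

(* The group of order two: a sign gain function is a binary functional on edge sets. *)
Definition sign : Type := bool.
HB.instance Definition _ := Choice.on sign.
HB.instance Definition _ :=
  @isGroup.Build sign false id addb addbA addFb addbF addbb addbb.

Lemma signM (a b : sign) : (a * b)%g = a (+) b. Proof. by []. Qed.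
Lemma signV (a : sign) : (a^-1)%g = a. Proof. by []. Qed.

Lemma set2_inj (T : finType) (a b c d : T) :
  [set a; b] = [set c; d] -> (a = c /\ b = d) \/ (a = d /\ b = c).
Proof.
move=> E; have := set21 a b; have := set22 a b; rewrite E !inE.
have := set21 c d; have := set22 c d; rewrite -E !inE.
do 4![case/pred2P=> ?]; subst; by [left|right].
Qed.

Lemma imset_set2 (aT rT : finType) (f : aT -> rT) (a b : aT) :
  f @: [set a; b] = [set f a; f b].
Proof. by rewrite imsetU1 imset_set1. Qed.

Definition adj (G : mgraph) (P : pred (edge G)) : rel (vert G) :=
  fun x y => [exists e, P e && (ends e == [set x; y])].

Section Adjacency.
Variables (G : mgraph).
Implicit Types (P Q : pred (edge G)) (x y : vert G) (e : edge G).

Lemma adjP P x y :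
  reflect (exists2 e, P e & ends e = [set x; y]) (adj P x y).
Proof.
apply: (iffP existsP) => -[e]; first by case/andP=> Pe /eqP; exists e.
by move=> Pe /eqP Ee; exists e; rewrite Pe.
Qed.

Lemma adj_edge P e : P e -> adj P (src e) (tgt e).
Proof. by move=> Pe; apply/adjP; exists e. Qed.

Lemma adj_sym P : symmetric (adj P).
Proof. by move=> x y; rewrite /adj setUC. Qed.

Lemma connect_adj_sym P : connect_sym (adj P).
Proof. exact/sym_connect_sym/adj_sym. Qed.

Lemma sub_adj P Q x y : {subset P <= Q} -> adj P x y -> adj Q x y.
Proof. by move=> sPQ /adjP[e /sPQ ? ?]; apply/adjP; exists e. Qed.

Lemma sub_connect_adj P Q x y :
  {subset P <= Q} -> connect (adj P) x y -> connect (adj Q) x y.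
Proof.
by move=> sPQ; apply: connect_sub => a b ab; apply/connect1/(sub_adj sPQ ab).
Qed.
End Adjacency.

Lemma connect_map (T U : finType) (r : rel T) (r' : rel U) (f : T -> U) :
  (forall x y, r x y -> connect r' (f x) (f y)) ->
  forall x y, connect r x y -> connect r' (f x) (f y).
Proof.
move=> H x y /connectP[p]; elim: p x => [|z p IH] x /=; first by move=> _ ->.
case/andP=> /H xz pz ey; exact: connect_trans xz (IH _ pz ey).
Qed.

Lemma connect_inv (T : finType) (U : Type) (r : rel T) (f : T -> U) :
  (forall x y, r x y -> f x = f y) ->
  forall x y, connect r x y -> f x = f y.
Proof.
move=> H x y /connectP[p]; elim: p x => [|z p IH] x /=; first by move=> _ ->.
by case/andP=> /H -> pz ey; apply: IH.
Qed.

Section Potentials.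
Variables (G : mgraph) (A : groupType).
Implicit Types (g : edge G -> A) (th : vert G -> A).
Local Open Scope group_scope.

Definition pot g th (e : edge G) : bool := g e == (th (src e))^-1 * th (tgt e).

Definition has_pot g (S : pred (edge G)) : Prop :=
  exists th, forall e, S e -> pot g th e.

(** A spanning forest built greedily: an edge whose ends are already connected by balanced edges
    changes nothing, and an edge between two components is made balanced by rescaling [th] on one of
    them. *)
Lemma spanning_potential g (s : seq (edge G)) :
  exists th, forall e, e \in s ->
    connect (adj [pred f in s | pot g th f]) (src e) (tgt e).
Proof.
elim: s => [|e s [th IH]]; first by exists (fun=> 1).
pose r := adj [pred f in s | pot g th f].
have sub1 th' : {in s, forall f, pot g th f -> pot g th' f} ->
    forall x y, connect r x y ->
    connect (adj [pred f in e :: s | pot g th' f]) x y.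
  move=> H x y; apply: sub_connect_adj => f; rewrite !inE => /andP[fs pf].
  by rewrite fs orbT (H f).
have [cn|ncn] := boolP (connect r (src e) (tgt e)).
  exists th => f; rewrite inE => /predU1P[->|/IH]; exact: sub1.
(* The left factor that balances [e]. A constant left factor on a whole component cancels on the
   edges inside it. *)
pose k := th (src e) * g e * (th (tgt e))^-1.
pose K x := connect r (tgt e) x.
pose th' x := if K x then k * th x else th x.
have Ke f : f \in s -> K (src f) = K (tgt f).
  by move/IH=> cf; rewrite /K (same_connect_r (connect_adj_sym _) cf).
have H f : f \in s -> pot g th f -> pot g th' f.
  move=> fs; rewrite /pot /th' (Ke f fs); case: ifP => // _.
  by rewrite invgM -mulgA (mulKg k).
have pe : pot g th' e.
  rewrite /pot /th' {1}/K (connect_adj_sym _ (tgt e)) (negbTE ncn).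
  by rewrite /K connect0 /k mulgVK mulKg.
exists th' => f; rewrite inE => /predU1P[->|/IH]; last exact: sub1.
by apply/connect1/adj_edge; rewrite !inE eqxx.
Qed.

(** Along an edge balanced by both, the two potentials are multiplied on the right by the same gain,
    so the left quotient between them does not change. *)
Lemma pot_diff_connect g th th' (P : pred (edge G)) (x y : vert G) :
  (forall f, P f -> pot g th f && pot g th' f) -> connect (adj P) x y ->
  th x * (th' x)^-1 = th y * (th' y)^-1.
Proof.
move=> H cn; apply: (connect_inv (f := fun x => th x * (th' x)^-1) _ cn) =>
  {cn} u v /adjP[f /H/andP[/eqP E /eqP]].
rewrite E => E'.
have step : th (src f) * (th' (src f))^-1 = th (tgt f) * (th' (tgt f))^-1.
  apply: (mulgI (th (src f))^-1); rewrite mulKg mulgA E'.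
  by rewrite -mulgA mulgV mulg1.
by case/set2_inj=> -[<- <-].
Qed.

Lemma pot_change g th th' (e : edge G) :
  th (src e) * (th' (src e))^-1 = th (tgt e) * (th' (tgt e))^-1 ->
  pot g th e = pot g th' e.
Proof.
move=> E; rewrite /pot; congr (_ == _).
apply: (mulgI (th (src e))); rewrite mulVKg mulgA E.
by rewrite -mulgA mulVg mulg1.
Qed.

End Potentials.

(** * Walks and circles *)

Section Walks.
Variable G : mgraph.
Implicit Types (d : dart G) (w : seq (dart G)) (x y : vert G) (e : edge G).

Fixpoint walk x w : bool :=
  if w is d :: w' then (dsrc d == x) && walk (dtgt d) w' else true.

Definition walk_end x w : vert G := last x [seq dtgt d | d <- w].

Lemma path_walk d d0 w :
  path (fun d d' : dart G => dtgt d == dsrc d') d (rcons w d0) =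
  walk (dtgt d) w && (walk_end (dtgt d) w == dsrc d0).
Proof.
elim: w d => [|d1 w IH] d /=; first by rewrite andbT.
by rewrite IH (eq_sym (dtgt d)) andbA.
Qed.

Lemma simple_closed_walk_cons d w :
  simple_closed_walk (d :: w) =
  [&& walk (dtgt d) w, walk_end (dtgt d) w == dsrc d,
      uniq [seq dsrc d' | d' <- d :: w] & uniq [seq d'.1 | d' <- d :: w]].
Proof.
rewrite /simple_closed_walk /cycle path_walk.
by rewrite (_ : (d :: w != [::]) = true) // -andbA.
Qed.

Lemma dart_of_ends e x y :
  ends e = [set x; y] -> exists d, [/\ d.1 = e, dsrc d = x & dtgt d = y].
Proof. by case/set2_inj=> -[<- <-]; [exists (e, true) | exists (e, false)]. Qed.

Lemma path_darts (P : pred (edge G)) x p :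
  path (adj P) x p -> exists w, [/\ walk x w, [seq dtgt d | d <- w] = p,
    [seq dsrc d | d <- w] = belast x p & all (fun d => P d.1) w].
Proof.
elim: p x => [|y p IH] x /=; first by exists [::].
case/andP=> /adjP[e Pe /dart_of_ends[d [de dx dy]]] /IH[w [ww wt ws wP]].
by exists (d :: w); rewrite /= dx dy eqxx ww wt ws wP de Pe.
Qed.

Lemma walk_srcs x w :
  walk x w -> {in w, forall d, dsrc d \in x :: [seq dtgt d | d <- w]}.
Proof.
elim: w x => [//|d1 w IH] x /= /andP[/eqP <- w1] d2.
rewrite inE => /predU1P[->|/(IH _ w1)]; first by rewrite mem_head.
by rewrite (in_cons (dsrc d1)) => ->; rewrite orbT.
Qed.

(** If the first edge recurred later, its start [x] would be an end of a later dart and hence recur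
    among the vertices. *)
Lemma walk_uniq_edges x w :
  walk x w -> uniq (x :: [seq dtgt d | d <- w]) -> uniq [seq d.1 | d <- w].
Proof.
elim: w x => //= d w IH x /andP[/eqP dx wd] /andP[xN uw].
rewrite (IH _ wd uw) andbT; apply/mapP=> -[d' d'w de].
have srcs := walk_srcs wd.
have d't : dtgt d' \in dtgt d :: map (@dtgt G) w.
  by rewrite inE map_f ?orbT.
have d's := srcs _ d'w; case/negP: xN; rewrite -dx.
by move: d's d't; rewrite /dsrc /dtgt -de; case: (d'.2); case: (d.2).
Qed.

Lemma circle_through (P : pred (edge G)) e :
  connect (adj P) (tgt e) (src e) -> ~~ P e ->
  exists w, simple_closed_walk ((e, true) :: w) /\ all (fun d => P d.1) w.
Proof.
case/connectP=> p0 /shortenP[p pp up _] {p0} ep nPe.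
have [w [ww wt ws wP]] := path_darts pp.
exists w; split => //; rewrite simple_closed_walk_cons.
rewrite [dtgt _]/= ww /walk_end wt -ep eqxx /= ws.
rewrite {1}/dsrc /= ep -rcons_uniq -lastI up.
rewrite (walk_uniq_edges ww) ?wt // andbT.
apply/mapP=> -[d dw /= E]; case/negP: nPe.
by rewrite E; apply: (allP wP).
Qed.

Section Gains.
Variables (A : groupType) (g : edge G -> A).
Implicit Type th : vert G -> A.
Local Open Scope group_scope.

Lemma dart_gain_pot th d :
  pot g th d.1 -> dart_gain g d = (th (dsrc d))^-1 * th (dtgt d).
Proof.
rewrite /pot /dart_gain /dsrc /dtgt => /eqP->.
by case: d.2; rewrite // invgM invgK.
Qed.

Lemma walk_gain_pot th x w :
  walk x w -> (forall d, d \in w -> pot g th d.1) ->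
  walk_gain g w = (th x)^-1 * th (walk_end x w).
Proof.
rewrite /walk_gain /walk_end.
elim: w x => [|d w IH] x /=; first by rewrite big_nil mulVg.
case/andP=> /eqP <- wd H; rewrite big_cons (dart_gain_pot (th := th)) ?H ?mem_head //.
rewrite (IH _ wd) => [|d' d'w]; last by rewrite H // inE d'w orbT.
by rewrite -mulgA mulVKg.
Qed.

Lemma simple_closed_walk_gain th w :
  simple_closed_walk w -> (forall e, e \in walk_edges w -> pot g th e) ->
  walk_gain g w = 1.
Proof.
case: w => [//|d w]; rewrite simple_closed_walk_cons => /and4P[ww /eqP we _ _] H.
rewrite (walk_gain_pot (th := th) (x := dsrc d)) ?/= ?eqxx //.
  by rewrite /walk_end /= -[X in _ * th X]/(walk_end _ _) we mulVg.
by move=> d' d'w; apply: H; rewrite inE map_f.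
Qed.

(** The potential of a vertex is the gain of the walk up to its visit there. *)
Lemma balanced_walk_pot w :
  simple_closed_walk w -> walk_gain g w = 1 ->
  exists th, forall e, e \in walk_edges w -> pot g th e.
Proof.
case: w => [//|d0 w0]; set w := d0 :: w0.
rewrite /simple_closed_walk => /and4P[_ cyc us _] w1.
pose srcs := [seq dsrc d | d <- w].
pose th x := walk_gain g (take (index x srcs) w); exists th => e.
rewrite inE => /mapP[d dw ->] {e}.
suff E : dart_gain g d = (th (dsrc d))^-1 * th (dtgt d).
  move: E; rewrite /pot /dart_gain /dsrc /dtgt; case: d.2 => [->//|E].
  by rewrite -(invgK (g d.1)) E invgM invgK.
have [i ilt di] := nthP d0 dw.
have ths : th (dsrc d) = walk_gain g (take i w).
  rewrite /th -di -(nth_map d0 (dsrc d0)) // index_uniq ?size_map //.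
have tht : th (dtgt d) = walk_gain g (take i.+1 w).
  have [lt|ge] := ltnP i.+1 (size w).
    have -> : dtgt d = nth (dsrc d0) srcs i.+1.
      rewrite (nth_map d0) // -di; apply/eqP.
      move: cyc; rewrite /= -cats1 cat_path => /andP[/(pathP d0) H _].
      exact: (H i).
    by rewrite /th index_uniq ?size_map.
  (* The closing dart returns to the start, whose potential is the empty product; this is where the
     total gain has to be 1. *)
  rewrite take_oversize // w1.
  have -> : dtgt d = dsrc d0.
    have ei : i = size w0 by apply/eqP; rewrite eqn_leq -ltnS ilt.
    move: cyc; rewrite /= rcons_path -di => /andP[_ /eqP <-].
    by rewrite ei -last_nth.
  by rewrite /th /srcs /= eqxx take0 /walk_gain big_nil.
by rewrite ths tht (take_nth d0) // di /walk_gain -cats1 big_cat big_seq1 mulKg.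
Qed.

(** An edge [e] of [S] closes a circle with edges balanced by a spanning potential [th]. The witness
    that this circle is balanced may have another start or direction, but its potential [th'] is
    independent of both. On the rest of the circle [th] and [th'] give the same gain, so they differ
    by the same left factor at both ends of [e], and [th] balances [e] too. *)
Lemma circles_pot (S : pred (edge G)) :
  (forall C : {set edge G}, circle C -> {subset C <= S} -> balanced_circle g C) ->
  has_pot g S.
Proof.
move=> H; have [th Hth] := spanning_potential g (filter S (enum (edge G))).
exists th => e Se; apply/idPn => npe.
set P := [pred f in _ | _] in Hth.
have cn : connect (adj P) (tgt e) (src e).
  by rewrite connect_adj_sym Hth // mem_filter Se mem_enum.
have [|w [scw wP]] := circle_through cn; first by rewrite /= (negbTE npe) andbF.
have wS : {subset walk_edges ((e, true) :: w) <= S}.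
  move=> f; rewrite inE /= inE => /predU1P[->//|/mapP[d /(allP wP) /= + ->]].
  by rewrite mem_filter => /andP[/andP[]].
have [|w' [scw' we w'1]] := H _ _ wS; first by exists ((e, true) :: w).
have [th' Hth'] := balanced_walk_pot scw' w'1; rewrite we in Hth'.
have pe' : pot g th' e by apply: Hth'; rewrite inE mem_head.
have /andP[ww /eqP we'] : walk (tgt e) w && (walk_end (tgt e) w == src e).
  by move: scw; rewrite simple_closed_walk_cons => /and4P[-> -> _ _].
have sub th1 : (forall d, d \in w -> pot g th1 d.1) ->
    walk_gain g w = (th1 (tgt e))^-1 * th1 (src e).
  by move=> H1; rewrite (walk_gain_pot ww H1) we'.
have H1 d : d \in w -> pot g th d.1 by move=> /(allP wP)/andP[].
have H2 d : d \in w -> pot g th' d.1.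
  by move=> dw; apply: Hth'; rewrite inE /= inE map_f ?orbT.
have E : th (src e) * (th' (src e))^-1 = th (tgt e) * (th' (tgt e))^-1.
  apply: (mulgI (th (tgt e))^-1); rewrite mulKg mulgA -(sub _ H1) (sub _ H2).
  by rewrite -mulgA mulgV mulg1.
by case/negP: npe; rewrite (pot_change g E).
Qed.
End Gains.
End Walks.

(** * Binary cycles *)

Section Parity.
Variable G : mgraph.
Implicit Types (ph : edge G -> sign) (ps : vert G -> sign).
Implicit Types (C D : {set edge G}) (e : edge G).

Definition cobd ps e : sign := ps (src e) (+) ps (tgt e).

Definition parity ph C : sign := \big[addb/false]_(e in C) ph e.

(** Cycles as the orthogonal complement of the coboundaries, a form that needs no degrees and pairs
    directly with sign potentials. *)
Definition cyc C : Prop := forall ps, parity (cobd ps) C = false.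

Definition symdiff C D : {set edge G} := (C :\: D) :|: (D :\: C).

Lemma in_symdiff C D e : (e \in symdiff C D) = (e \in C) (+) (e \in D).
Proof. by rewrite !inE; case: (e \in C); case: (e \in D). Qed.

Lemma eq_parity ph ph' C :
  (forall e, e \in C -> ph e = ph' e) -> parity ph C = parity ph' C.
Proof. exact: eq_bigr. Qed.

Lemma parity_add ph ph' C :
  parity (fun e => ph e (+) ph' e) C = parity ph C (+) parity ph' C.
Proof. exact: big_split. Qed.

Lemma parity0 C : parity (fun=> false) C = false.
Proof. by rewrite /parity big1. Qed.

Lemma parityE ph C : parity ph C = \big[addb/false]_e ((e \in C) && ph e).
Proof. by rewrite /parity big_mkcond; apply: eq_bigr => e _; case: ifP. Qed.

Lemma parity_symdiff ph C D :
  parity ph (symdiff C D) = parity ph C (+) parity ph D.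
Proof.
rewrite !parityE -big_split; apply: eq_bigr => e _.
by rewrite in_symdiff andb_addl.
Qed.

Lemma parity_indic e C : parity (fun f => f == e) C = (e \in C).
Proof.
rewrite parityE (bigD1 e) //= eqxx andbT big1 ?addbF // => f /negbTE->.
by rewrite andbF.
Qed.

Lemma cyc_symdiff C D : cyc C -> cyc D -> cyc (symdiff C D).
Proof. by move=> cC cD ps; rewrite parity_symdiff cC cD. Qed.

Lemma pot_signE ph ps e : pot ph ps e = (ph e == cobd ps e).
Proof. by []. Qed.

Lemma cyc_pot ph ps C :
  cyc C -> (forall e, e \in C -> pot ph ps e) -> parity ph C = false.
Proof. by move=> cC H; rewrite -(cC ps); apply: eq_parity => e /H/eqP. Qed.

Lemma walk_gain_parity ph w :
  simple_closed_walk w -> walk_gain ph w = parity ph (walk_edges w).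
Proof.
case/and4P=> _ _ _ uw; rewrite /parity.
transitivity (\big[addb/false]_(e <- [seq d.1 | d <- w]) ph e).
  rewrite big_map; apply: eq_bigr => d _; rewrite /dart_gain.
  by case: d.2.
by rewrite (big_uniq _ uw); apply: eq_bigl => e; rewrite inE.
Qed.

Lemma circle_cyc C : circle C -> cyc C.
Proof.
case=> w sw <- ps; rewrite -(walk_gain_parity _ sw).
by apply: (@simple_closed_walk_gain _ _ _ ps) => // e _; rewrite pot_signE.
Qed.

Lemma circle_neq0 C : circle C -> exists e, e \in C.
Proof. by case=> -[//|d w] _ <-; exists d.1; rewrite inE mem_head. Qed.

(* If an edge [f] of [C] is missing from [D], the sign function supported on [e] and
   [f] is balanced on [C] but not on [D]. *)
Lemma circle_sub_cyc C D e : circle C -> D \subset C -> cyc D -> e \in D -> D = C.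
Proof.
move=> [w sw <-] sD cD eD; apply/eqP; rewrite eqEsubset sD /=.
apply/subsetP => f fw; apply/idPn => fD.
pose ph f' : sign := (f' == e) (+) (f' == f).
have [|ps Hps] := @balanced_walk_pot G _ ph _ sw.
  by rewrite walk_gain_parity // parity_add !parity_indic fw (subsetP sD).
have : parity ph D = false.
  by apply: (cyc_pot (ps := ps)) => // e' /(subsetP sD); apply: Hps.
by rewrite parity_add !parity_indic eD (negbTE fD).
Qed.

(** If the rest of [C] did not connect the ends of [e], the indicator of the component of [tgt e]
    would have a coboundary that meets [C] in [e] alone. *)
Lemma cyc_circle C e :
  cyc C -> e \in C -> exists D, [/\ circle D, D \subset C & e \in D].
Proof.
move=> cC eC; pose P f := (f \in C) && (f != e).
have [||w [sw wP]] := @circle_through G P e.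
- apply/idPn => ncn; pose ps x : sign := connect (adj P) (tgt e) x.
  have := cC ps; rewrite /parity (bigD1 e) //= big1 => [|f Pf].
    by rewrite /cobd /ps connect0 (negbTE ncn).
  have cf : connect (adj P) (src f) (tgt f) by apply/connect1/adj_edge.
  by rewrite /cobd /ps (same_connect_r (connect_adj_sym _) cf) addbb.
- by rewrite /P eqxx andbF.
exists (walk_edges ((e, true) :: w)); split; first by exists ((e, true) :: w).
  apply/subsetP=> f; rewrite inE /= inE => /predU1P[->//|/mapP[d /(allP wP)]].
  by case/andP=> dC _ ->.
by rewrite inE mem_head.
Qed.

(** A description without walks, by which circles are carried to and from edge subgraphs. *)
Lemma circleP C :
  circle C <-> [/\ C != set0, cyc C &
    forall D, D \subset C -> D != set0 -> cyc D -> D = C].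
Proof.
split=> [cC|[/set0Pn[e eC] cC min]].
  split; [|exact: circle_cyc|].
    by have [e eC] := circle_neq0 cC; apply/set0Pn; exists e.
  by move=> D sD /set0Pn[e eD] cD; apply: circle_sub_cyc eD.
have [D [cD sD eD]] := cyc_circle cC eC.
rewrite -(min D) //; last exact: circle_cyc.
by apply/set0Pn; exists e.
Qed.

(** Transitivity of sharing a circuit in a binary matroid, by induction on the size of the union.
    The symmetric difference contains a circle [C3] through [e] and a circle [C4] through [f]; they
    meet [C2] and [C1] respectively, so one of the pairs [C3, C2], [C1, C4], [C3, C4] has a smaller
    union. *)
Lemma circle_trans C1 C2 e f :
  circle C1 -> circle C2 -> e \in C1 -> f \in C2 -> C1 :&: C2 != set0 ->
  exists C, [/\ circle C, C \subset C1 :|: C2, e \in C & f \in C].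
Proof.
have [n] := ubnP #|C1 :|: C2|; elim: n C1 C2 => // n IH C1 C2 ltn c1 c2 e1 f2 ne.
have [e2|e2] := boolP (e \in C2); first by exists C2; rewrite subsetUr.
have [f1|f1] := boolP (f \in C1); first by exists C1; rewrite subsetUl.
have cS := cyc_symdiff (circle_cyc c1) (circle_cyc c2).
have [C3 [c3 s3 e3]] : exists D, [/\ circle D, D \subset symdiff C1 C2 & e \in D].
  by apply: cyc_circle cS _; rewrite in_symdiff e1 (negbTE e2).
have [C4 [c4 s4 f4]] : exists D, [/\ circle D, D \subset symdiff C1 C2 & f \in D].
  by apply: cyc_circle cS _; rewrite in_symdiff f2 (negbTE f1).
have sU D : D \subset symdiff C1 C2 -> D \subset C1 :|: C2.
  move=> sD; apply: subset_trans sD _; apply/subsetP=> h.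
  by rewrite in_symdiff inE; case: (h \in C1); case: (h \in C2).
case/set0Pn: ne => h /setIP[h1 h2].
have hS : h \notin symdiff C1 C2 by rewrite in_symdiff h1 h2.
have not_sub D C : circle C -> h \in C -> D \subset symdiff C1 C2 -> circle D ->
    exists2 k, k \in D & k \notin C.
  move=> cC hC sD cD; apply/subsetPn; apply: contra hS => sDC.
  have [k kD] := circle_neq0 cD.
  by rewrite (subsetP sD) // (circle_sub_cyc cC sDC (circle_cyc cD) kD).
have [k3 k33 k31] := not_sub C3 C1 c1 h1 s3 c3.
have [k4 k44 k42] := not_sub C4 C2 c2 h2 s4 c4.
have k32 : k3 \in C2.
  by have := subsetP s3 _ k33; rewrite in_symdiff (negbTE k31).
have k41 : k4 \in C1.
  by have := subsetP s4 _ k44; rewrite in_symdiff (negbTE k42) addbF.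
have step D E : circle D -> circle E -> D :|: E \proper C1 :|: C2 ->
    e \in D -> f \in E -> D :&: E != set0 ->
    exists C, [/\ circle C, C \subset C1 :|: C2, e \in C & f \in C].
  move=> cD cE pDE eD fE nDE.
  have [|C [cC sC eC fC]] := IH D E _ cD cE eD fE nDE.
    exact: leq_trans (proper_card pDE) _.
  by exists C; split=> //; apply: subset_trans sC (proper_sub pDE).
have [p32|np32] := boolP (C3 :|: C2 \proper C1 :|: C2).
  by apply: step p32 _ _ _ => //; apply/set0Pn; exists k3; rewrite inE k33.
have [p14|np14] := boolP (C1 :|: C4 \proper C1 :|: C2).
  by apply: step p14 _ _ _ => //; apply/set0Pn; exists k4; rewrite inE k41.
(* The union of [C3] and [C4] misses [h]. As [C1] and [C4] cover everything, [C4] contains all of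
   [C2] outside [C1], in particular [k3]. *)
apply: (step C3 C4) => //.
  rewrite properE subUset !sU //=; apply/subsetPn; exists h; first by rewrite inE h1.
  by rewrite inE negb_or (contra (subsetP s3 h)) // (contra (subsetP s4 h)).
apply/set0Pn; exists k3; rewrite inE k33 /=.
move: np14; rewrite properE subUset subsetUl (sU _ s4) /= negbK => /subsetP.
by move/(_ k3); rewrite !inE k32 (negbTE k31) => /(_ isT).
Qed.

End Parity.

(** * The dual form of the Circle Test *)

Section CircleTest.
Variable G : mgraph.
Import GRing.Theory.
Local Open Scope ring_scope.

Lemma F2_natr_addb (a b : bool) : ((a (+) b)%:R : 'F_2) = a%:R + b%:R.
Proof. by apply/eqP; case: a; case: b. Qed.

Lemma parity_natr (ph : edge G -> sign) (C : {set edge G}) :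
  ((parity ph C : bool)%:R : 'F_2) = \sum_(e in C) (ph e : bool)%:R.
Proof.
apply: (big_ind2 (fun (a : bool) (x : 'F_2) => a%:R = x)) => // a x b y.
by rewrite F2_natr_addb => -> ->.
Qed.

Lemma odd_degree (S : {set edge G}) v :
  odd (degree S v) = parity (cobd (eq_op^~ v)) S.
Proof.
rewrite /degree /parity (big_morph odd oddD (erefl (odd 0))).
by apply: eq_bigr => e _; rewrite oddD !oddb.
Qed.

(** Degree parities are the pairings with coboundaries of single vertices, and every coboundary is a
    sum of these. *)
Lemma cyc_cycle_space (S : {set edge G}) : (chi S \in cycle_space G) <-> cyc S.
Proof.
rewrite chi_cycle_space; split=> [/forallP ev ps | cS]; last first.
  by apply/forallP=> v; rewrite odd_degree cS.
pose F v e : bool := ps v && cobd (fun x => x == v) e.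
have E e : cobd ps e = \big[addb/false]_v F v e.
  rewrite /F /cobd; under eq_bigr => v _ do rewrite andb_addr.
  rewrite big_split /=.
  have one x : \big[addb/false]_v (ps v && (x == v)) = ps x.
    rewrite (bigD1 x) //= eqxx andbT big1 ?addbF // => v.
    by rewrite eq_sym => /negbTE->; rewrite andbF.
  by rewrite !one.
rewrite /parity (eq_bigr _ (fun e _ => E e)) exchange_big big1 // => v _.
have := ev v; rewrite odd_degree /F; case: (ps v) => [/negbTE //|_].
by rewrite big1.
Qed.

Definition supp (x : edge_vec G) : {set edge G} := [set e | x e != 0].

Lemma chi_supp (x : edge_vec G) : chi (supp x) = x.
Proof.
apply/ffunP=> e; rewrite ffunE inE; apply/eqP.
by case: (x e : 'I_2) => -[|[|k]].
Qed.

Definition functional (ph : edge G -> sign) (x : edge_vec G) : ('F_2)^o :=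
  \sum_e x e * (ph e : bool)%:R.

Fact functional_linear (ph : edge G -> sign) : linear (functional ph).
Proof.
move=> a x y; rewrite /functional scaler_sumr -big_split.
by apply: eq_bigr => e _ /=; rewrite !ffunE mulrDl scalerAl.
Qed.
HB.instance Definition _ (ph : edge G -> sign) :=
  GRing.isLinear.Build _ _ _ _ (functional ph) (functional_linear ph).

Lemma functional_chi ph S : functional ph (chi S) = (parity ph S : bool)%:R.
Proof.
rewrite parity_natr [RHS]big_mkcond; apply: eq_bigr => e _.
by rewrite ffunE; case: ifP => _; rewrite ?mul1r ?mul0r.
Qed.

Lemma F2_cases (x : 'F_2) : x = (x != 0)%:R.
Proof. by apply/eqP; case: (x : 'I_2) => -[|[|k]]. Qed.

Lemma edge_vec_sum (x : edge_vec G) : x = \sum_e x e *: chi [set e].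
Proof.
apply/ffunP=> f; rewrite sum_ffunE (bigD1 f) //= big1 => [|e ne].
  by rewrite !ffunE inE eqxx addr0 /GRing.scale /= mulr1.
by rewrite !ffunE inE eq_sym (negbTE ne) scaler0.
Qed.

(** With a projection [p] onto [V], the vector [x - p x] has a nonzero coordinate [e0]. The
    functional is that coordinate of [y - p y], and [ph] lists its values on the unit vectors. *)
Lemma separation (V : {vspace edge_vec G}) (x : edge_vec G) :
  x \notin V -> exists ph, (forall y, y \in V -> functional ph y = 0) /\
                           functional ph x != 0.
Proof.
move=> xV; pose p := projv V.
have [e0 ne0] : exists e, (x - p x) e != 0.
  apply/existsP; apply: contraR xV => /existsPn H.
  suff -> : x = p x by apply: memv_proj.
  apply/ffunP=> e; have := H e; rewrite negbK !ffunE subr_eq0 => /eqP //.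
pose ph e : sign := (chi [set e] - p (chi [set e])) e0 != 0.
have E y : functional ph y = (y - p y) e0.
  rewrite {2 3}[y]edge_vec_sum linear_sum -sumrB sum_ffunE.
  apply: eq_bigr => e _; rewrite linearZ -scalerBr ffunE.
  by rewrite [X in _ *: X]F2_cases.
by exists ph; split=> [y yV|]; rewrite E // /p projv_id // subrr ffunE.
Qed.

Lemma span_sub_basis (K : fieldType) (vT : vectType K) (T : eqType) (f : T -> vT)
    (s : seq T) :
  exists2 t, {subset t <= s} & basis_of <<map f s>>%VS (map f t).
Proof.
elim: s => [|c s [t ts bt]]; first by exists [::]; rewrite //= span_nil nil_basis.
have [fc|fc] := boolP (f c \in <<map f s>>%VS).
  exists t => [x /ts xs|]; first by rewrite inE xs orbT.
  have /addv_idPr E : (<[f c]> <= <<map f s>>)%VS by rewrite -memvE.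
  by rewrite /= span_cons E.
exists (c :: t) => [x|]; first by rewrite !inE => /predU1P[->|/ts->]; rewrite ?eqxx ?orbT.
rewrite /basis_of /= !span_cons (span_basis bt) eqxx free_cons.
by rewrite (span_basis bt) fc (basis_free bt).
Qed.

(** Turns the balanced circles, which are given by a [Prop], into a finite set from which a basis
    can be drawn. *)
Lemma finset_of_Prop (T : finType) (P : T -> Prop) :
  exists S : {set T}, forall x, x \in S <-> P x.
Proof.
suff H (s : seq T) : exists S : {set T}, forall x, x \in S <-> x \in s /\ P x.
  have [S HS] := H (enum T); exists S => x; rewrite HS mem_enum.
  by split=> [[]|].
elim: s => [|a s [S HS]].
  by exists set0 => x; rewrite inE; split=> [|[]].
have [Pa|nPa] := classic (P a).
  exists (a |: S) => x; rewrite !inE; split=> [/predU1P[->|/HS[-> Px]]|].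
  - by rewrite eqxx.
  - by rewrite orbT.
  by case=> /predU1P[->|xs Px]; rewrite ?eqxx ?(introT (HS x)) ?orbT //; apply/orP; right;
    apply/HS.
exists S => x; rewrite HS inE; split=> [[-> Px]|[/predU1P[->|//]]] //.
by rewrite orbT.
Qed.

Section Dual.
Variables (A : groupType) (g : edge G -> A).

Lemma balanced_pot : balanced g <-> has_pot g predT.
Proof.
split=> [bal|[th Hth] C [w sw wC]].
  by apply: circles_pot => C cC _; apply: bal.
by exists w; split=> //; apply: (simple_closed_walk_gain (th := th)) => // e _; apply: Hth.
Qed.

Lemma balanced_circle_circle (C : {set edge G}) : balanced_circle g C -> circle C.
Proof. by case=> w [sw wC _]; exists w. Qed.
End Dual.

Lemma has_pot_parity (ph : edge G -> sign) (S : pred (edge G)) :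
  has_pot ph S <->
  (forall C, circle C -> {subset C <= S} -> parity ph C = false).
Proof.
split=> [[ps Hps] C cC sC|H].
  by apply: (cyc_pot (circle_cyc cC) (ps := ps)) => e /sC; apply: Hps.
apply: circles_pot => C cC sC; have [w sw wC] := cC; exists w; split=> //.
by rewrite walk_gain_parity // wC H.
Qed.

(** The right side is orthogonality to the balanced circles; the left side is the form that passes
    between graphs. *)
Lemma compatibleP (A : groupType) (g : edge G -> A) (ph : edge G -> sign) :
  (forall th, has_pot ph (pot g th)) <->
  (forall C, balanced_circle g C -> parity ph C = false).
Proof.
split=> [H C bC|H th].
  have [w [sw wC w1]] := bC; have [th Hth] := balanced_walk_pot sw w1.
  apply: (proj1 (has_pot_parity ph _) (H th)); first by exists w.
  by rewrite -wC.
apply/has_pot_parity => C cC sC; apply: H; have [w sw wC] := cC.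
exists w; split=> //; apply: (simple_closed_walk_gain (th := th)) => // e.
by rewrite wC => /sC.
Qed.

(* The linear dual of the Circle Test: a functional [ph] that vanishes on the
   balanced circles of [g] must vanish on the whole cycle space. *)
Definition dual_test (A : groupType) (g : edge G -> A) : Prop :=
  (forall ph : edge G -> sign,
     (forall th, has_pot ph (pot g th)) -> has_pot ph predT) ->
  has_pot g predT.

Lemma circle_test_dual (A : groupType) (g : edge G -> A) :
  circle_test_valid g <-> dual_test g.
Proof.
split=> [ct H|dt [B [bB balB]]]; apply/balanced_pot.
  apply: ct; have [S HS] := finset_of_Prop (balanced_circle g).
  have [B sB bB] := span_sub_basis (@chi G) (enum S).
  exists B; split=> [|C /sB]; last by rewrite mem_enum => /HS.
  suff <- : <<[seq chi C | C <- enum S]>>%VS = cycle_space G by [].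
  apply/eqP; rewrite eqEsubv; apply/andP; split.
    apply/span_subvP=> _ /mapP[C + ->]; rewrite mem_enum => /HS/balanced_circle_circle.
    by move/circle_cyc/cyc_cycle_space.
  (* A cycle outside the span of the balanced circles is separated from it by a sign function that
     is compatible with [g] and yet not balanced. *)
  apply/subvP => x xc; apply/idPn => xV.
  have [ph [phV]] := separation xV; case/negP.
  rewrite -[x]chi_supp functional_chi.
  have [|ps Hps] := H ph.
    apply/compatibleP => C /HS CS; have := phV (chi C).
    rewrite functional_chi memv_span ?map_f ?mem_enum // => /(_ isT).
    by case: (parity ph C).
  rewrite (cyc_pot (ps := ps)) // => [|e _]; last exact: Hps.
  by apply/cyc_cycle_space; rewrite chi_supp.
apply: dt => ph /compatibleP phB; apply/has_pot_parity => C /circle_cyc/cyc_cycle_space cC _.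
have : (cycle_space G <= lker (linfun (functional ph)))%VS.
  rewrite -(span_basis bB); apply/span_subvP=> _ /mapP[D /balB/phB DB ->].
  by rewrite memv_ker lfunE /= functional_chi DB.
move/subvP/(_ _ cC); rewrite memv_ker lfunE /= functional_chi.
by case: (parity ph C).
Qed.

End CircleTest.

(** * Subgraphs, contractions and extrusions *)

Definition dual_valid (A : groupType) (G : mgraph) : Prop :=
  forall g : edge G -> A, dual_test g.

Section Transfer.
Variables (A : groupType).
Local Open Scope group_scope.

Lemma eq_gainV (x a b : A) : (x^-1 == a^-1 * b) = (x == b^-1 * a).
Proof. by rewrite eqg_invLR invgM invgK. Qed.

(** Reference orientations need not correspond in a subgraph or contraction, so a transferred gain
    is inverted where they disagree. For a loop both choices agree: each says that [x] is 1. *)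
Lemma orient_eq (T : finType) (th : T -> A) (s t a b : T) (x : A) :
  [set s; t] = [set a; b] ->
  ((if s == a then x else x^-1) == (th s)^-1 * th t) = (x == (th a)^-1 * th b).
Proof.
case/set2_inj=> -[-> ->]; first by rewrite eqxx.
by case: (b =P a) => [->|_]; rewrite ?eq_gainV.
Qed.
End Transfer.

Lemma cobd_ends (G : mgraph) (ps : vert G -> sign) (e : edge G) x y :
  ends e = [set x; y] -> cobd ps e = ps x (+) ps y.
Proof. by rewrite /cobd; case/set2_inj=> -[-> ->] //; rewrite addbC. Qed.

(* Each edge outside [H] gets the gain that makes it balanced with a spanning forest
   of [H]. *)
Lemma dual_valid_subgraph (A : groupType) (G H : mgraph) :
  subgraph H G -> dual_valid A G -> dual_valid A H.
Proof.
move=> [fV [fE [injV injE Ends]]] dv g' dt.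
have [th' Hth'] := spanning_potential g' (enum (edge H)).
pose ext (B : Type) (f : vert H -> B) (b : B) x : B :=
  if [pick y | fV y == x] is Some y then f y else b.
have extE (B : Type) (f : vert H -> B) b y : ext B f b (fV y) = f y.
  rewrite /ext; case: pickP => [z /eqP/injV->//|/(_ y)].
  by rewrite eqxx.
pose th0 := ext A th' 1%g.
pose g (e : edge G) : A := if [pick h | fE h == e] is Some h
  then if src e == fV (src h) then g' h else (g' h)^-1%g
  else ((th0 (src e))^-1 * th0 (tgt e))%g.
have gE h : g (fE h) = if src (fE h) == fV (src h) then g' h else (g' h)^-1%g.
  rewrite /g; case: pickP => [z /eqP/injE->//|/(_ h)].
  by rewrite eqxx.
have EndsE h : [set src (fE h); tgt (fE h)] = [set fV (src h); fV (tgt h)].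
  by rewrite -imset_set2 -Ends.
have potE th h : pot g th (fE h) = pot g' (th \o fV) h.
  by rewrite /pot gE (orient_eq _ _ (EndsE h)).
have [|th Hth] := dv g; last first.
  by exists (th \o fV) => h _; rewrite -potE; apply: Hth.
move=> ph compat; pose ph' : edge H -> sign := ph \o fE.
have potsE ps h : pot ph ps (fE h) = pot ph' (ps \o fV) h.
  by rewrite !pot_signE (cobd_ends _ (EndsE h)).
have [|ps' Hps'] := dt ph'.
  move=> th; have [ps Hps] := compat (ext A th 1%g); exists (ps \o fV) => h hp.
  rewrite -potsE; apply: Hps; rewrite potE.
  by move: hp; rewrite /pot /= !extE.
(* [ps2] is right outside [H] and on the spanning forest of [H]. There it differs from [ps'] by a
   constant on each component, so it is right on all of [H]. *)
have [ps2 Hps2] := compat th0.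
have th0E h : pot g' th' h -> pot ph' (ps2 \o fV) h.
  by move=> hp; rewrite -potsE; apply: Hps2; rewrite potE /pot /= /th0 !extE.
exists ps2 => e _; have [h eh|nh] := pickP (fun h => fE h == e); last first.
  apply: Hps2; rewrite /pot /g; case: pickP => [h|_ //].
  by rewrite nh.
rewrite -(eqP eh) potsE.
have := Hth' h; rewrite mem_enum => /(_ isT) cn.
rewrite -(pot_change ph' (th := ps')) ?Hps' //.
by apply: (pot_diff_connect (g := ph') _ cn) => f /andP[_ fp]; rewrite Hps' ?th0E.
Qed.

(** The edge [e] gets gain 1, so the potentials on [H] are the potentials on [G] that balance
    [e]. *)
Lemma dual_valid_contraction (A : groupType) (G H : mgraph) (e : edge G) :
  contraction e H -> dual_valid A G -> dual_valid A H.
Proof.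
move=> [fV [fE [surV fVE injE imE Ends]]] dv g' dt.
have [s Hs] := fin_all_exists surV.
pose g (f : edge G) : A := if [pick h | fE h == f] is Some h
  then if fV (src f) == src h then g' h else (g' h)^-1%g else 1%g.
have gE h : g (fE h) = if fV (src (fE h)) == src h then g' h else (g' h)^-1%g.
  rewrite /g; case: pickP => [z /eqP/injE->//|/(_ h)].
  by rewrite eqxx.
have ge : g e = 1%g.
  rewrite /g; case: pickP => // h /eqP eh.
  by case: (proj1 (imE e)) => //; exists h.
have fVe : fV (src e) = fV (tgt e).
  by apply/fVE; right; rewrite set21 set22.
have EndsE h : [set fV (src (fE h)); fV (tgt (fE h))] = [set src h; tgt h].
  by rewrite -imset_set2 -[LHS]Ends.
have potE th h : pot g (th \o fV) (fE h) = pot g' th h.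
  by rewrite /pot gE (orient_eq _ _ (EndsE h)).
have pote th : pot g (th \o fV) e by rewrite /pot ge /= fVe mulVg.
have edgeP f : f = e \/ exists h, f = fE h.
  have [->|/eqP/imE[h <-]] := eqVneq f e; [by left | by right; exists h].
have desc (B : Type) (th : vert G -> B) :
    th (src e) = th (tgt e) -> forall x, th (s (fV x)) = th x.
  move=> E x; have /fVE[->//|] := Hs (fV x).
  by rewrite !inE => -[/pred2P[]-> /pred2P[]->].
have [|th Hth] := dv g; last first.
  have /eqP : pot g th e by apply: Hth.
  rewrite ge => E; have /desc thE : th (src e) = th (tgt e).
    by apply: (mulgI (th (src e))^-1%g); rewrite -E mulVg.
  exists (th \o s) => h _; rewrite -potE /pot /= !thE; exact: Hth.
(* [ph] may be nonzero on [e]. Since [e] is balanced by the constant potential, [ps0] explains its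
   sign there, and adding the coboundary of [ps0] makes [ph] descend to [H]. *)
move=> ph compat; have [ps0 Hps0] := compat (fun=> 1%g).
have phe : ph e = cobd ps0 e.
  by apply/eqP; rewrite -pot_signE Hps0 // /pot ge mulVg.
pose ph' h : sign := ph (fE h) (+) cobd ps0 (fE h).
have potsE ps h : pot ph (fun x => ps (fV x) (+) ps0 x) (fE h) = pot ph' ps h.
  rewrite !pot_signE /ph' (cobd_ends ps (esym (EndsE h))) /cobd addbACA.
  by apply/eqP/eqP => [->|<-]; rewrite ?addbK ?addbNK.
have [|ps' Hps'] := dt ph'.
  move=> th; have [ps Hps] := compat (th \o fV).
  pose ps1 x := ps x (+) ps0 x.
  have /desc ps1E : ps1 (src e) = ps1 (tgt e).
    have /eqP := Hps _ (pote th); rewrite phe /cobd /ps1.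
    by case: (ps (src e)); case: (ps (tgt e)); case: (ps0 (src e)); case: (ps0 (tgt e)).
  exists (ps1 \o s) => h hp; rewrite -potsE.
  rewrite pot_signE /cobd /= !ps1E /ps1 !addbK; apply/eqP/eqP.
  by apply: Hps; rewrite potE.
exists (fun x => ps' (fV x) (+) ps0 x) => f _.
have [->|[h ->]] := edgeP f; last by rewrite potsE Hps'.
by rewrite pot_signE phe /cobd fVe addbACA addbb.
Qed.

(** Allows later proofs to assume gain 1 on the edges of a chosen forest. *)
Lemma dual_test_switch (A : groupType) (G : mgraph) (g : edge G -> A)
    (eta : vert G -> A) :
  dual_test (fun e => eta (src e) * g e * (eta (tgt e))^-1)%g -> dual_test g.
Proof.
set g' := fun e => _ => dt H.
have potE th e : pot g' (fun x => th x * (eta x)^-1)%g e = pot g th e.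
  rewrite /pot /g' invgM invgK -!mulgA (inj_eq (mulgI _)) !mulgA.
  by rewrite (inj_eq (mulIg _)).
have [|th' Hth'] := dt.
  move=> ph compat; apply: H => th.
  have [ps Hps] := compat (fun x => th x * (eta x)^-1)%g.
  by exists ps => e; rewrite -potE; apply: Hps.
exists (fun x => th' x * eta x)%g => e _; rewrite -potE.
have := Hth' e isT; rewrite /pot /=.
by rewrite !mulgK.
Qed.

(* Edges at [None] go to [w] or are [e_v], so a balanced set that does not identify
   the potentials of [None] and [v] is glued at [w] from two balanced sets. *)
Lemma dual_valid_extrude (A : groupType) (G : mgraph) (v w : vert G)
    (S : {set edge G}) :
  w != v -> (forall e, e \in S -> ends e = [set v; w]) ->
  dual_valid A G -> dual_valid A (extrude v S).
Proof.
move=> nwv Sends dv g0.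
pose eta (x : vert (extrude v S)) : A := if x is Some _ then 1%g else g0 None.
apply: (dual_test_switch (eta := eta)); set g := fun e => _.
have gN : g None = 1%g by rewrite /g /= mul1g mulgV.
move: {g0 eta} g gN => g gN.
pose g' (e : edge G) : A := g (Some e).
have merge (B : Type) (F : vert (extrude v S) -> B) e : F None = F (Some v) ->
    F (src (Some e : edge (extrude v S))) = F (Some (src e)) /\
    F (tgt (Some e : edge (extrude v S))) = F (Some (tgt e)).
  move=> FN; rewrite /=; split; case: ifP => // /andP[_ /eqP->] //.
have potm (B : groupType) (h : edge (extrude v S) -> B) th e : th None = th (Some v) ->
    pot h th (Some e) = pot (fun f => h (Some f)) (fun x => th (Some x)) e.
  by move=> tN; have [E1 E2] := merge _ _ e tN; rewrite /pot E1 E2.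
have potN (B : groupType) (h : edge (extrude v S) -> B) th : h None = 1%g ->
    pot h th None = (th None == th (Some v)).
  by move=> hN; rewrite /pot hN /= eq_sym mulg_eq1 eqg_inv eq_sym.
move=> dt; have [|th' Hth'] := dv g'; last first.
  pose th (x : vert (extrude v S)) := if x is Some y then th' y else th' v.
  exists th => -[e|] _; last by rewrite potN.
  by rewrite potm //; apply: Hth'.
move=> ph' compat.
pose ph (e : edge (extrude v S)) : sign := if e is Some f then ph' f else false.
have [|ps Hps] := dt ph; last first.
  exists (fun x => ps (Some x)) => e _.
  have /eqP psN : ps None == ps (Some v) by rewrite -(potN _ ph) // Hps.
  by have := Hps (Some e) isT; rewrite potm.
move=> th; have [thN|thN] := eqVneq (th None) (th (Some v)).
  have [ps' Hps'] := compat (fun x => th (Some x)).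
  pose ps (x : vert (extrude v S)) : sign := if x is Some y then ps' y else ps' v.
  exists ps => -[e|] ep; last by rewrite potN.
  by rewrite potm // in ep; rewrite potm //; apply: Hps'.
(* [ps1] serves the edges that stay at [v]; [ps2], where [v] takes the potential of [None], serves
   the moved ones. The sign at [None] is chosen so that it differs from that of [w] as in [ps2], and
   [e_v] is unbalanced here and imposes nothing. *)
have [ps1 Hps1] := compat (fun x => th (Some x)).
have [ps2 Hps2] := compat (fun x => if x == v then th None else th (Some x)).
pose ps (x : vert (extrude v S)) : sign :=
  if x is Some y then ps1 y else ps1 w (+) ps2 w (+) ps2 v.
exists ps => -[e|]; last by rewrite potN // (negbTE thN).
have [eS|eS] := boolP (e \in S).
  have := Hps2 e; rewrite /pot /= !eS /= /g'.
  case/set2_inj: (Sends e eS) => -[-> ->]; rewrite eqxx (negbTE nwv) /=;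
    move=> H /H /eqP ->; apply/eqP; rewrite !signM !signV;
    by case: (ps1 w); case: (ps2 w); case: (ps2 v).
by have := Hps1 e; rewrite /pot /= (negbTE eS).
Qed.

Lemma dual_valid_extrusion (A : groupType) (G0 H : mgraph) :
  extrusion_of G0 H -> dual_valid A G0 -> dual_valid A H.
Proof.
elim=> // G v w S _ IH nwv _ Sends dv.
exact: dual_valid_extrude nwv Sends (IH dv).
Qed.

Lemma isomorphic_subgraph (G H : mgraph) : isomorphic G H -> subgraph G H.
Proof. by case=> fV [fE [/bij_inj iV /bij_inj iE E]]; exists fV, fE. Qed.

Lemma dual_valid_minor (A : groupType) (G H : mgraph) :
  minor G H -> dual_valid A G -> dual_valid A H.
Proof.
move=> m dv; elim: m => // [H1 H2 _ IH /dual_valid_subgraph|H1 H2 e _ IH /dual_valid_contraction].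
  exact.
exact.
Qed.

(** * Blocks *)

Section EdgeSubgraphs.
Variables (G : mgraph) (F : {set edge G}).
Let H := edge_subgraph F.

Definition edge_val (e : edge H) : edge G := val e.
Definition vert_val (x : vert H) : vert G := val x.

Lemma edge_val_inj : injective edge_val. Proof. exact: val_inj. Qed.

Lemma edge_val_in e : edge_val e \in F. Proof. exact: valP. Qed.

Lemma edge_valP e : e \in F -> exists e' : edge H, edge_val e' = e.
Proof. by move=> eF; exists (Sub e eF). Qed.

Lemma edge_subgraph_subgraph : subgraph H G.
Proof.
exists vert_val, edge_val; split; [exact: val_inj|exact: val_inj|] => e.
by rewrite /ends imset_set2.
Qed.

Definition vert_ext (T : Type) (f : vert H -> T) (t : T) (x : vert G) : T :=
  if insub x is Some y then f y else t.

Lemma vert_extE T (f : vert H -> T) t y : vert_ext f t (vert_val y) = f y.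
Proof. by rewrite /vert_ext /vert_val valK. Qed.

Lemma src_val (e : edge H) : vert_val (src e) = src (edge_val e). Proof. by []. Qed.
Lemma tgt_val (e : edge H) : vert_val (tgt e) = tgt (edge_val e). Proof. by []. Qed.

Lemma parity_val (ph : edge G -> sign) (D : {set edge H}) :
  parity ph (edge_val @: D) = parity (ph \o edge_val) D.
Proof. by rewrite /parity big_imset //= => x y _ _ /val_inj. Qed.

Lemma edge_val_preim (C : {set edge G}) :
  C \subset F -> C = edge_val @: (edge_val @^-1: C).
Proof.
move=> sC; apply/setP=> e; apply/idP/imsetP => [eC|[e' + ->]]; last by rewrite inE.
have [e' ee] := edge_valP (subsetP sC _ eC).
by exists e'; rewrite ?inE ee.
Qed.

Lemma cyc_val (D : {set edge H}) : cyc (edge_val @: D) <-> cyc D.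
Proof.
split=> cD ps.
  rewrite -(cD (vert_ext ps false)) parity_val; apply: eq_parity => e _.
  by rewrite /cobd -(vert_extE ps false (src e)) -(vert_extE ps false (tgt e)).
by rewrite parity_val -(cD (ps \o vert_val)).
Qed.

Lemma circle_val (D : {set edge H}) : circle (edge_val @: D) <-> circle D.
Proof.
have vs (C C' : {set edge H}) : (edge_val @: C \subset edge_val @: C') = (C \subset C').
  apply/idP/idP => [|/imsetS//]; move=> /subsetP s; apply/subsetP=> e eC.
  by have := s _ (imset_f _ eC); rewrite mem_imset //; apply: edge_val_inj.
split=> /circleP[n0 cD min]; apply/circleP; split; try exact/cyc_val.
- by apply: contraNneq n0 => ->; rewrite imset0.
- move=> D' sD' n0' cD'; apply: (imset_inj edge_val_inj); apply: min.
  + by rewrite vs.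
  + by rewrite imset_eq0.
  + exact/cyc_val.
- by rewrite imset_eq0.
- have sDF : edge_val @: D \subset F.
    by apply/subsetP => _ /imsetP[e _ ->]; apply: edge_val_in.
  move=> C sC n0' cC; rewrite (edge_val_preim (subset_trans sC sDF)).
  have EC := edge_val_preim (subset_trans sC sDF).
  rewrite (min (edge_val @^-1: C)) //.
  + by rewrite -vs -EC.
  + by rewrite -(imset_eq0 edge_val) -EC.
  + by apply/cyc_val; rewrite -EC.
Qed.

Lemma inseparable_val :
  inseparable H <-> (forall e f, e \in F -> f \in F -> e != f ->
    exists C, [/\ circle C, C \subset F, e \in C & f \in C]).
Proof.
split=> ins.
  move=> e f /edge_valP[e' <-] /edge_valP[f' <-] ne.
  have [|C [cC eC fC]] := ins e' f'; first by apply: contraNneq ne => ->.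
  exists (edge_val @: C); split; try exact: imset_f; first exact/circle_val.
  by apply/subsetP => _ /imsetP[h _ ->]; apply: edge_val_in.
move=> e f ne.
have [|C [cC sC eC fC]] := ins _ _ (edge_val_in e) (edge_val_in f).
  by apply: contra ne => /eqP/edge_val_inj->.
exists (edge_val @^-1: C); split; rewrite ?inE //.
by apply/circle_val; rewrite -edge_val_preim.
Qed.

End EdgeSubgraphs.

(** By [circle_trans] the union of a block and a circle that meets it is inseparable, so maximality
    applies. *)
Lemma block_circle (G : mgraph) (F C : {set edge G}) e :
  block F -> circle C -> e \in C -> e \in F -> C \subset F.
Proof.
move=> [_ /inseparable_val insF maxF] cC eC eF.
rewrite -(maxF (F :|: C)) ?subsetUl ?subsetUr //.
have H f : f \in F :|: C -> exists D, [/\ circle D, D \subset F :|: C, e \in D & f \in D].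
  have [->|nf] := eqVneq f e; first by exists C; rewrite subsetUr.
  case/setUP=> [fF|fC]; last by exists C; rewrite subsetUr.
  have [|D [cD sD eD fD]] := insF e f eF fF; first by rewrite eq_sym.
  by exists D; split=> //; apply: subset_trans sD (subsetUl _ _).
apply/inseparable_val => f f' /H[D [cD sD eD fD]] /H[D' [cD' sD' eD' fD']] _.
have [|E [cE sE fE fE']] := circle_trans cD cD' fD fD'.
  by apply/set0Pn; exists e; rewrite inE eD.
by exists E; split=> //; apply: subset_trans sE _; rewrite subUset sD.
Qed.

Lemma circle_inseparable (G : mgraph) (C : {set edge G}) :
  circle C -> inseparable (edge_subgraph C).
Proof. by move=> cC; apply/inseparable_val => e f eC fC _; exists C. Qed.

Lemma inseparable_block (G : mgraph) (F : {set edge G}) :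
  F != set0 -> inseparable (edge_subgraph F) ->
  exists2 F', block F' & F \subset F'.
Proof.
have [n] := ubnP (#|edge G| - #|F|); elim: n F => // n IH F ltn n0 ins.
have [mx|nmx] := classic (forall F' : {set edge G},
    F \subset F' -> inseparable (edge_subgraph F') -> F' = F).
  by exists F.
have [F' nF'] := not_all_ex_not _ _ nmx.
have [sF nF2] := imply_to_and _ _ nF'.
have [ins' /eqP ne] := imply_to_and _ _ nF2.
have pF : F \proper F' by rewrite properEneq eq_sym ne.
have [||F2 bF2 sF2] := IH F' _ _ ins'; last by exists F2 => //; apply: subset_trans sF2.
  rewrite -ltnS (leq_trans _ ltn) // ltnS ltn_sub2l ?(proper_card pF) //.
  exact: leq_trans (proper_card pF) (max_card _).
by apply: contraNneq n0 => E; rewrite -subset0 -E.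
Qed.

(** A balanced circle lies in a given block or misses it, so a compatible sign function on the block
    stays compatible when extended by zero. Conversely each circle lies in some block, where its
    balance is decided. *)
Lemma dual_valid_blocks (A : groupType) (G : mgraph) :
  (forall F : {set edge G}, block F -> dual_valid A (edge_subgraph F)) ->
  dual_valid A G.
Proof.
move=> dv g dt; apply: circles_pot => C cC _.
have [e eC] := circle_neq0 cC.
have [|F bF sCF] := inseparable_block _ (circle_inseparable cC).
  by apply/set0Pn; exists e.
have [|th Hth] := dv F bF (g \o @edge_val G F).
  move=> ph' compat.
  pose ph f : sign := if insub f is Some f' then ph' f' else false.
  have phE f : ph (edge_val f) = ph' f by rewrite /ph /edge_val valK.
  have [|ps Hps] := dt ph; last first.
    by exists (ps \o @vert_val G F) => f _; have := Hps (edge_val f) isT; rewrite /pot phE.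
  apply/compatibleP => D bD.
  have [/pred0P D0|/pred0Pn[f /andP[/= fD fF]]] := boolP [disjoint D & F].
    rewrite -(parity0 D); apply: eq_parity => f fD; rewrite /ph insubF //.
    by have := D0 f; rewrite /= fD.
  have sDF := block_circle bF (balanced_circle_circle bD) fD fF.
  rewrite (edge_val_preim sDF) parity_val.
  rewrite (eq_parity (ph' := ph')) => [|h _]; last exact: phE.
  have [w [sw wD w1]] := bD; have [th Hth] := balanced_walk_pot sw w1.
  have [ps Hps] := compat (th \o @vert_val G F).
  apply: (cyc_pot (ps := ps)) => [|h].
    apply/cyc_val; rewrite -edge_val_preim //.
    exact: circle_cyc (balanced_circle_circle bD).
  by rewrite inE => hD; apply: Hps; have := Hth (edge_val h); rewrite wD; apply.
have [w sw wC] := cC; exists w; split=> //.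
apply: (simple_closed_walk_gain (th := vert_ext th 1%g)) => // f.
rewrite wC => /(subsetP sCF)/edge_valP[f' <-].
by rewrite /pot -src_val -tgt_val !vert_extE; apply: Hth.
Qed.

(** * The forbidden minors *)

(* Numerical coding of the edges of a multigraph: [(x, y, k)] is the [k]-th edge
   from [x] to [y]; [l] lists the codes of all edges. *)
Section Coded.
Variables (V : finType) (mu : V -> V -> nat) (c : V -> nat) (d : nat -> V).
Variables (n : nat) (l : seq (nat * nat * nat)).
Hypotheses (cK : cancel c d) (cn : forall x, c x < n).
Let G := mult_graph mu.

Definition code (e : edge G) : nat * nat * nat := (c (src e), c (tgt e), val (tagged e)).

Lemma code_inj : injective code.
Proof.
case=> [[x y] i] [[x' y'] j] []; rewrite /= => /(can_inj cK) ex /(can_inj cK) ey.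
by subst x' y' => /val_inj->.
Qed.

Definition codes_ok : bool :=
  all (fun a => all (fun b => all (fun k => (a, b, k) \in l)
    (iota 0 (mu (d a) (d b)))) (iota 0 n)) (iota 0 n) &&
  all (fun t => [&& c (d t.1.1) == t.1.1, c (d t.1.2) == t.1.2 &
    t.2 < mu (d t.1.1) (d t.1.2)]) l.
Hypothesis ok : codes_ok.

Lemma code_in e : code e \in l.
Proof.
case/andP: ok => /allP ok1 _; case: e => [[x y] i]; rewrite /code /=.
have ci z : c z \in iota 0 n by rewrite mem_iota add0n cn.
have /allP ok2 := ok1 _ (ci x); have /allP := ok2 _ (ci y).
by rewrite !cK; apply; rewrite mem_iota add0n ltn_ord.
Qed.

Lemma codeP t : t \in l -> exists e, code e = t.
Proof.
case/andP: ok => _ /allP ok2 /ok2; case: t => [[x y] k] /and3P[/= /eqP ex /eqP ey lk].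
by exists (@existT _ (fun p => 'I_(mu p.1 p.2)) (d x, d y) (Ordinal lk));
   rewrite /code /= ex ey.
Qed.

(** On codes instead of dependent pairs, potentials are functions on [nat] and every edge condition
    of a concrete graph is settled by evaluation. *)
Lemma coded_dual_invalid (A : groupType) (gn : nat * nat * nat -> A) :
  (forall ph : nat * nat * nat -> sign,
    (forall th : nat -> A, exists ps : nat -> sign, forall t, t \in l ->
       gn t == ((th t.1.1)^-1 * th t.1.2)%g -> ph t = ps t.1.1 (+) ps t.1.2) ->
    exists ps : nat -> sign, forall t, t \in l -> ph t = ps t.1.1 (+) ps t.1.2) ->
  (forall th : nat -> A, exists2 t, t \in l & gn t != ((th t.1.1)^-1 * th t.1.2)%g) ->
  ~ dual_valid A G.
Proof.
move=> H unb /(_ (gn \o code)) []; last first.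
  move=> th Hth; have [t /codeP[e <-]] := unb (th \o d).
  by rewrite /= !cK; case/negP; apply: Hth.
move=> ph compat; pose phn t : sign := [exists e, (code e == t) && ph e].
have phE e : phn (code e) = ph e.
  apply/existsP/idP => [[f /andP[/eqP/code_inj->]] //|pe].
  by exists e; rewrite eqxx.
have [|ps Hps] := H phn; last first.
  exists (ps \o c) => e _; rewrite pot_signE -phE.
  by rewrite (Hps _ (code_in e)).
move=> th; have [ps Hps] := compat (th \o c).
exists (ps \o d) => t /codeP[e <-] et; rewrite phE /= !cK.
exact/eqP/Hps.
Qed.

End Coded.

Definition Z3_of_nat (k : nat) : Z3 := (inZp k : 'Z_3).

Definition Z3_listed (l : seq (nat * nat * nat)) (gs : seq nat) t : Z3 :=
  Z3_of_nat (nth 0 gs (index t l)).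

Definition Z3_values (ks : seq nat) (v : nat) : Z3 := Z3_of_nat (nth 0 ks v).

Definition ord3 (v : nat) : 'I_3 :=
  match v with
  | 0 => @Ordinal 3 0 isT | 1 => @Ordinal 3 1 isT | _ => @Ordinal 3 2 isT
  end.

Definition ord4 (v : nat) : 'I_4 :=
  match v with
  | 0 => @Ordinal 4 0 isT | 1 => @Ordinal 4 1 isT
  | 2 => @Ordinal 4 2 isT | _ => @Ordinal 4 3 isT
  end.

Lemma ord3K : cancel (@nat_of_ord 3) ord3.
Proof. by case=> -[|[|[|]]] // i; apply: val_inj. Qed.

Lemma ord4K : cancel (@nat_of_ord 4) ord4.
Proof. by case=> -[|[|[|[|]]]] // i; apply: val_inj. Qed.

Definition hub_dec (v : nat) : option 'I_4 := if v == 4 then None else Some (ord4 v).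

Definition hub_code (x : option 'I_4) : nat := if x is Some i then i else 4.

Lemma hub_decK : cancel hub_code hub_dec.
Proof. by case=> [i|] //; rewrite /hub_dec /= (ltn_eqF (ltn_ord i)) ord4K. Qed.

Lemma hub_code_lt x : hub_code x < 5.
Proof. by case: x => [i|] //=; rewrite ltnW // ltnS ltn_ord. Qed.

(* In each of the next four proofs a digon (for the wheel, a triangle) is unbalanced
   although the balanced circles in the equations [E0], [E1], ... form a basis of the
   cycle space. *)
Lemma Cmult_332_dual_invalid : ~ dual_valid Z3 (Cmult [:: 3; 3; 2]).
Proof.
pose l := [:: (0, 1, 0); (0, 1, 1); (0, 1, 2); (1, 2, 0);
  (1, 2, 1); (1, 2, 2); (2, 0, 0); (2, 0, 1)].
(* For each choice of a second and a third edge exactly one first edge closes a balanced triangle: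
   six triangles, and the cycle space has dimension 8 - 3 + 1 = 6. *)
pose gs := [:: 0; 1; 2; 0; 1; 2; 0; 1].
apply: (@coded_dual_invalid _ _ _ ord3 3 l ord3K (@ltn_ord 3) _ _ (Z3_listed l gs)).
- by vm_compute.
- move=> ph H.
  have E0 : ph (0, 1, 0) (+) ph (1, 2, 0) (+) ph (2, 0, 0) = false.
    have [p Hp] := H (Z3_values [:: 0; 0; 0]).
    rewrite (Hp (0, 1, 0) isT isT) (Hp (1, 2, 0) isT isT) (Hp (2, 0, 0) isT isT) /=.
    by case: (p 0); case: (p 1); case: (p 2).
  have E1 : ph (0, 1, 2) (+) ph (1, 2, 1) (+) ph (2, 0, 0) = false.
    have [p Hp] := H (Z3_values [:: 0; 2; 0]).
    rewrite (Hp (0, 1, 2) isT isT) (Hp (1, 2, 1) isT isT) (Hp (2, 0, 0) isT isT) /=.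
    by case: (p 0); case: (p 1); case: (p 2).
  have E2 : ph (0, 1, 1) (+) ph (1, 2, 2) (+) ph (2, 0, 0) = false.
    have [p Hp] := H (Z3_values [:: 0; 1; 0]).
    rewrite (Hp (0, 1, 1) isT isT) (Hp (1, 2, 2) isT isT) (Hp (2, 0, 0) isT isT) /=.
    by case: (p 0); case: (p 1); case: (p 2).
  have E3 : ph (0, 1, 2) (+) ph (1, 2, 0) (+) ph (2, 0, 1) = false.
    have [p Hp] := H (Z3_values [:: 0; 2; 2]).
    rewrite (Hp (0, 1, 2) isT isT) (Hp (1, 2, 0) isT isT) (Hp (2, 0, 1) isT isT) /=.
    by case: (p 0); case: (p 1); case: (p 2).
  have E4 : ph (0, 1, 1) (+) ph (1, 2, 1) (+) ph (2, 0, 1) = false.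
    have [p Hp] := H (Z3_values [:: 0; 1; 2]).
    rewrite (Hp (0, 1, 1) isT isT) (Hp (1, 2, 1) isT isT) (Hp (2, 0, 1) isT isT) /=.
    by case: (p 0); case: (p 1); case: (p 2).
  have E5 : ph (0, 1, 0) (+) ph (1, 2, 2) (+) ph (2, 0, 1) = false.
    have [p Hp] := H (Z3_values [:: 0; 0; 2]).
    rewrite (Hp (0, 1, 0) isT isT) (Hp (1, 2, 2) isT isT) (Hp (2, 0, 1) isT isT) /=.
    by case: (p 0); case: (p 1); case: (p 2).
  (* The sign potential is read off along the spanning path 0, 1, 2. *)
  exists (nth false [:: false; ph (0, 1, 0); ph (0, 1, 0) (+) ph (1, 2, 0)]) => t tl;
    apply/eqP; move: t tl; apply/allP => /=.
  move: E0 E1 E2 E3 E4 E5.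
  case: (ph (0, 1, 0)) => //;
  case: (ph (0, 1, 1)) => //;
  case: (ph (0, 1, 2)) => //;
  case: (ph (1, 2, 0)) => //;
  case: (ph (1, 2, 1)) => //;
  case: (ph (1, 2, 2)) => //;
  case: (ph (2, 0, 0)) => //;
  case: (ph (2, 0, 1)) => //.
- move=> th; apply/hasP; rewrite has_predC; apply/allP => A.
  have /eqP E0 := A (0, 1, 0) isT; have /eqP := A (0, 1, 1) isT.
  by rewrite -E0.
Qed.

Lemma Cmult_2222_dual_invalid : ~ dual_valid Z3 (Cmult [:: 2; 2; 2; 2]).
Proof.
pose l := [:: (0, 1, 0); (0, 1, 1); (1, 2, 0); (1, 2, 1);
  (2, 3, 0); (2, 3, 1); (3, 0, 0); (3, 0, 1)].
(* A circle of length four is balanced when it has no or three edges of gain 1: five circles, and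
   the dimension is 8 - 4 + 1 = 5. *)
pose gs := [:: 0; 1; 0; 1; 0; 1; 0; 1].
apply: (@coded_dual_invalid _ _ _ ord4 4 l ord4K (@ltn_ord 4) _ _ (Z3_listed l gs)).
- by vm_compute.
- move=> ph H.
  have E0 : ph (0, 1, 0) (+) ph (1, 2, 0) (+) ph (2, 3, 0) (+) ph (3, 0, 0) = false.
    have [p Hp] := H (Z3_values [:: 0; 0; 0; 0]).
    rewrite (Hp (0, 1, 0) isT isT) (Hp (1, 2, 0) isT isT) (Hp (2, 3, 0) isT isT) (Hp (3,
      0, 0) isT isT) /=.
    by case: (p 0); case: (p 1); case: (p 2); case: (p 3).
  have E1 : ph (0, 1, 1) (+) ph (1, 2, 1) (+) ph (2, 3, 1) (+) ph (3, 0, 0) = false.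
    have [p Hp] := H (Z3_values [:: 0; 1; 2; 0]).
    rewrite (Hp (0, 1, 1) isT isT) (Hp (1, 2, 1) isT isT) (Hp (2, 3, 1) isT isT) (Hp (3,
      0, 0) isT isT) /=.
    by case: (p 0); case: (p 1); case: (p 2); case: (p 3).
  have E2 : ph (0, 1, 1) (+) ph (1, 2, 1) (+) ph (2, 3, 0) (+) ph (3, 0, 1) = false.
    have [p Hp] := H (Z3_values [:: 0; 1; 2; 2]).
    rewrite (Hp (0, 1, 1) isT isT) (Hp (1, 2, 1) isT isT) (Hp (2, 3, 0) isT isT) (Hp (3,
      0, 1) isT isT) /=.
    by case: (p 0); case: (p 1); case: (p 2); case: (p 3).
  have E3 : ph (0, 1, 1) (+) ph (1, 2, 0) (+) ph (2, 3, 1) (+) ph (3, 0, 1) = false.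
    have [p Hp] := H (Z3_values [:: 0; 1; 1; 2]).
    rewrite (Hp (0, 1, 1) isT isT) (Hp (1, 2, 0) isT isT) (Hp (2, 3, 1) isT isT) (Hp (3,
      0, 1) isT isT) /=.
    by case: (p 0); case: (p 1); case: (p 2); case: (p 3).
  have E4 : ph (0, 1, 0) (+) ph (1, 2, 1) (+) ph (2, 3, 1) (+) ph (3, 0, 1) = false.
    have [p Hp] := H (Z3_values [:: 0; 0; 1; 2]).
    rewrite (Hp (0, 1, 0) isT isT) (Hp (1, 2, 1) isT isT) (Hp (2, 3, 1) isT isT) (Hp (3,
      0, 1) isT isT) /=.
    by case: (p 0); case: (p 1); case: (p 2); case: (p 3).
  exists (nth false [:: false; ph (0, 1, 0); ph (0, 1, 0) (+) ph (1, 2, 0); ph (0, 1, 0)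
    (+) ph (1, 2, 0) (+) ph (2, 3, 0)]) => t tl;
    apply/eqP; move: t tl; apply/allP => /=.
  move: E0 E1 E2 E3 E4.
  case: (ph (0, 1, 0)) => //;
  case: (ph (0, 1, 1)) => //;
  case: (ph (1, 2, 0)) => //;
  case: (ph (1, 2, 1)) => //;
  case: (ph (2, 3, 0)) => //;
  case: (ph (2, 3, 1)) => //;
  case: (ph (3, 0, 0)) => //;
  case: (ph (3, 0, 1)) => //.
- move=> th; apply/hasP; rewrite has_predC; apply/allP => A.
  have /eqP E0 := A (0, 1, 0) isT; have /eqP := A (0, 1, 1) isT.
  by rewrite -E0.
Qed.

Lemma K4dd_dual_invalid : ~ dual_valid Z3 (K4dd).
Proof.
pose l := [:: (0, 1, 0); (0, 1, 1); (0, 2, 0); (0, 2, 1);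
  (0, 3, 0); (1, 2, 0); (1, 3, 0); (2, 3, 0)].
(* The equations come from one balanced triangle and four balanced quadrilaterals; the dimension is
   8 - 4 + 1 = 5. *)
pose gs := [:: 0; 1; 0; 1; 0; 1; 1; 1].
apply: (@coded_dual_invalid _ _ _ ord4 4 l ord4K (@ltn_ord 4) _ _ (Z3_listed l gs)).
- by vm_compute.
- move=> ph H.
  have E0 : ph (0, 1, 0) (+) ph (0, 2, 1) (+) ph (1, 2, 0) = false.
    have [p Hp] := H (Z3_values [:: 0; 0; 1; 0]).
    rewrite (Hp (0, 1, 0) isT isT) (Hp (0, 2, 1) isT isT) (Hp (1, 2, 0) isT isT) /=.
    by case: (p 0); case: (p 1); case: (p 2).
  have E1 : ph (0, 2, 0) (+) ph (0, 3, 0) (+) ph (1, 2, 0) (+) ph (1, 3, 0) = false.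
    have [p Hp] := H (Z3_values [:: 0; 2; 0; 0]).
    rewrite (Hp (0, 2, 0) isT isT) (Hp (0, 3, 0) isT isT) (Hp (1, 2, 0) isT isT) (Hp (1,
      3, 0) isT isT) /=.
    by case: (p 0); case: (p 1); case: (p 2); case: (p 3).
  have E2 : ph (0, 1, 1) (+) ph (0, 3, 0) (+) ph (1, 2, 0) (+) ph (2, 3, 0) = false.
    have [p Hp] := H (Z3_values [:: 0; 1; 2; 0]).
    rewrite (Hp (0, 1, 1) isT isT) (Hp (0, 3, 0) isT isT) (Hp (1, 2, 0) isT isT) (Hp (2,
      3, 0) isT isT) /=.
    by case: (p 0); case: (p 1); case: (p 2); case: (p 3).
  have E3 : ph (0, 1, 0) (+) ph (0, 2, 0) (+) ph (1, 3, 0) (+) ph (2, 3, 0) = false.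
    have [p Hp] := H (Z3_values [:: 0; 0; 0; 1]).
    rewrite (Hp (0, 1, 0) isT isT) (Hp (0, 2, 0) isT isT) (Hp (1, 3, 0) isT isT) (Hp (2,
      3, 0) isT isT) /=.
    by case: (p 0); case: (p 1); case: (p 2); case: (p 3).
  have E4 : ph (0, 1, 1) (+) ph (0, 2, 1) (+) ph (1, 3, 0) (+) ph (2, 3, 0) = false.
    have [p Hp] := H (Z3_values [:: 0; 1; 1; 2]).
    rewrite (Hp (0, 1, 1) isT isT) (Hp (0, 2, 1) isT isT) (Hp (1, 3, 0) isT isT) (Hp (2,
      3, 0) isT isT) /=.
    by case: (p 0); case: (p 1); case: (p 2); case: (p 3).
  exists (nth false [:: false; ph (0, 1, 0); ph (0, 2, 0); ph (0, 3, 0)]) => t tl;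
    apply/eqP; move: t tl; apply/allP => /=.
  move: E0 E1 E2 E3 E4.
  case: (ph (0, 1, 0)) => //;
  case: (ph (0, 1, 1)) => //;
  case: (ph (0, 2, 0)) => //;
  case: (ph (0, 2, 1)) => //;
  case: (ph (0, 3, 0)) => //;
  case: (ph (1, 2, 0)) => //;
  case: (ph (1, 3, 0)) => //;
  case: (ph (2, 3, 0)) => //.
- move=> th; apply/hasP; rewrite has_predC; apply/allP => A.
  have /eqP E0 := A (0, 1, 0) isT; have /eqP := A (0, 1, 1) isT.
  by rewrite -E0.
Qed.

Lemma wheel4_dual_invalid : ~ dual_valid Z3 (wheel 4).
Proof.
pose l := [:: (4, 0, 0); (4, 1, 0); (4, 2, 0); (4, 3, 0);
  (0, 1, 0); (1, 2, 0); (2, 3, 0); (3, 0, 0)].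
(* A circle through the hub is balanced when it has three rim edges, and the rim itself has gain 4,
   which is not 0 in Z_3: four circles, and the dimension is 8 - 5 + 1 = 4. *)
pose gs := [:: 0; 0; 0; 0; 1; 1; 1; 1].
apply: (@coded_dual_invalid _ _ _ hub_dec 5 l hub_decK hub_code_lt _ _ (Z3_listed l gs)).
- by vm_compute.
- move=> ph H.
  have E0 : ph (4, 0, 0) (+) ph (4, 3, 0) (+) ph (0, 1, 0) (+) ph (1, 2, 0)
    (+) ph (2, 3, 0) = false.
    have [p Hp] := H (Z3_values [:: 0; 1; 2; 0; 0]).
    rewrite (Hp (4, 0, 0) isT isT) (Hp (4, 3, 0) isT isT) (Hp (0, 1, 0) isT isT) (Hp (1,
      2, 0) isT isT) (Hp (2, 3, 0) isT isT) /=.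
    by case: (p 0); case: (p 1); case: (p 2); case: (p 3); case: (p 4).
  have E1 : ph (4, 2, 0) (+) ph (4, 3, 0) (+) ph (0, 1, 0) (+) ph (1, 2, 0)
    (+) ph (3, 0, 0) = false.
    have [p Hp] := H (Z3_values [:: 1; 2; 0; 0; 0]).
    rewrite (Hp (4, 2, 0) isT isT) (Hp (4, 3, 0) isT isT) (Hp (0, 1, 0) isT isT) (Hp (1,
      2, 0) isT isT) (Hp (3, 0, 0) isT isT) /=.
    by case: (p 0); case: (p 1); case: (p 2); case: (p 3); case: (p 4).
  have E2 : ph (4, 1, 0) (+) ph (4, 2, 0) (+) ph (0, 1, 0) (+) ph (2, 3, 0)
    (+) ph (3, 0, 0) = false.
    have [p Hp] := H (Z3_values [:: 2; 0; 0; 1; 0]).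
    rewrite (Hp (4, 1, 0) isT isT) (Hp (4, 2, 0) isT isT) (Hp (0, 1, 0) isT isT) (Hp (2,
      3, 0) isT isT) (Hp (3, 0, 0) isT isT) /=.
    by case: (p 0); case: (p 1); case: (p 2); case: (p 3); case: (p 4).
  have E3 : ph (4, 0, 0) (+) ph (4, 1, 0) (+) ph (1, 2, 0) (+) ph (2, 3, 0)
    (+) ph (3, 0, 0) = false.
    have [p Hp] := H (Z3_values [:: 0; 0; 1; 2; 0]).
    rewrite (Hp (4, 0, 0) isT isT) (Hp (4, 1, 0) isT isT) (Hp (1, 2, 0) isT isT) (Hp (2,
      3, 0) isT isT) (Hp (3, 0, 0) isT isT) /=.
    by case: (p 0); case: (p 1); case: (p 2); case: (p 3); case: (p 4).
  exists (nth false [:: false; ph (4, 0, 0) (+) ph (4, 1, 0); ph (4, 0, 0) (+) ph (4, 2,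
    0); ph (4, 0, 0) (+) ph (4, 3, 0); ph (4, 0, 0)]) => t tl;
    apply/eqP; move: t tl; apply/allP => /=.
  move: E0 E1 E2 E3.
  case: (ph (4, 0, 0)) => //;
  case: (ph (4, 1, 0)) => //;
  case: (ph (4, 2, 0)) => //;
  case: (ph (4, 3, 0)) => //;
  case: (ph (0, 1, 0)) => //;
  case: (ph (1, 2, 0)) => //;
  case: (ph (2, 3, 0)) => //;
  case: (ph (3, 0, 0)) => //.
- move=> th; apply/hasP; rewrite has_predC; apply/allP => A.
  have /eqP E0 := A (4, 0, 0) isT; have /eqP E1 := A (4, 1, 0) isT.
  have /eqP := A (0, 1, 0) isT; rewrite /= in E0 E1 *.
  have -> : ((th 0%N)^-1 * th 1%N = ((th 4%N)^-1 * th 0%N)^-1 * ((th 4%N)^-1 * th 1%N))%g.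
    by rewrite invgM invgK -mulgA mulVKg.
  by rewrite -E0 -E1.
Qed.

(** * The base graphs *)

Lemma dual_test_of_sign (A : groupType) (G : mgraph) (g : edge G -> A)
    (ph : edge G -> sign) :
  (forall th, has_pot ph (pot g th)) -> ~ has_pot ph predT -> dual_test g.
Proof. by move=> compat npot /(_ ph compat). Qed.

Lemma dual_valid_K1loop (A : groupType) : dual_valid A K1loop.
Proof.
move=> g; pose e0 : edge K1loop := @existT _ (fun p : unit * unit => 'I_1) (tt, tt) ord0.
have eE e : e = e0 by case: e => -[[] []] i; congr existT; rewrite [i]ord1.
have potE (B : groupType) (h : edge K1loop -> B) th e : pot h th e = (h e0 == 1%g).
  by rewrite (eE e) /pot /= mulVg.
have [g1|g1] := eqVneq (g e0) 1%g.
  by move=> _; exists (fun=> 1%g) => e _; rewrite potE g1.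
apply: (@dual_test_of_sign _ _ _ (fun=> true)).
  by move=> th; exists (fun=> false) => e; rewrite potE (negbTE g1).
by case=> ps /(_ e0 isT); rewrite potE.
Qed.

Lemma dual_valid_mK2 (A : groupType) m : dual_valid A (mK2 m).
Proof.
move=> g; case: m g => [|m] g.
  by move=> _; exists (fun=> 1%g) => -[[[] []]] [].
pose ed i : edge (mK2 m.+1) :=
  @existT _ (fun p : bool * bool => 'I_(if ~~ p.1 && p.2 then m.+1 else 0)) (false, true) i.
have edP e : exists i, e = ed i.
  by case: e => -[[] []] [] // i lt; exists (Ordinal lt).
pose g0 := g (ed ord0).
have [/forallP all0|] := boolP [forall i, g (ed i) == g0].
  move=> _; exists (fun b => if b then g0 else 1%g) => e _.
  have [i ->] := edP e; rewrite /pot /= invg1 mul1g; exact: all0.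
rewrite negb_forall => /existsP[i1 ni1].
(* A balanced set of parallel edges has a single gain, so any function of the gain is compatible;
   this one separates [i1] from the first edge. *)
pose ph e : sign := g e != g0.
apply: (@dual_test_of_sign _ _ _ ph).
  move=> th; pose t := ((th false)^-1 * th true)%g.
  exists (fun b => b && (t != g0)) => e; have [i ->] := edP e.
  by rewrite /pot /= -/t => /eqP E; rewrite /ph E.
case=> ps Hps; have := Hps (ed ord0) isT; have := Hps (ed i1) isT.
by rewrite !pot_signE /ph eqxx ni1 /cobd /=; case: (ps false); case: (ps true).
Qed.

Section K4signs.
Variable A : groupType.
Local Open Scope group_scope.

(* On K_4(m, m') switch the gains of [p], [q], [r] to 1 and let [s] be the fourth
   single gain.  Unless every [a] is in {1, s^-1} and every [d] in {1, s}, the sign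
   function marking the other values is unbalanced; if they all are and [s != 1],
   the one marking [s] and the gains different from 1 is. *)
Lemma K4_signs (s t1 t2 t3 : A) : exists p1 p2 p3 : bool,
  [/\ t2 = 1 -> p2 = false, t3 = 1 -> p3 = false, t2 = t1 -> p2 = p1,
      t3 = t1 * s -> p3 = p1 &
      p1 = (t1 != 1) && (t1 * s != 1) /\
      p2 (+) p3 = (t3 != t2) && (t3 != t2 * s)].
Proof.
pose f := (t1 != 1) && (t1 * s != 1); pose h := (t3 != t2) && (t3 != t2 * s).
exists f; rewrite -/f -/h.
have [e21|n21] := eqVneq t2 t1.
  exists f, (f (+) h); rewrite /f /h e21; split=> // [->|->|->|].
  - by rewrite eqxx.
  - by rewrite ![1 == _]eq_sym; case: (t1 == 1); case: (_ == 1).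
  - by rewrite eqxx andbF addbF.
  - by rewrite addKb.
have [e2|n2] := eqVneq t2 1.
  exists false, h; rewrite /f /h e2 mul1g; split=> // [->|E|->].
  - by rewrite eqxx.
  - by move: n21; rewrite e2 E eqxx.
  have -> : (t1 * s == s) = (t1 == 1) by rewrite -{2}[s]mul1g (inj_eq (mulIg s)).
  by rewrite andbC.
have [e3|n3] := eqVneq t3 1.
  exists h, false; rewrite addbF; split=> // [/eqP|/eqP| E].
  - by rewrite (negbTE n2).
  - by rewrite (negbTE n21).
  by rewrite /f -E e3 eqxx andbF.
exists (f (+) h), f; rewrite addbAC addbb; split=> // [/eqP|/eqP|/eqP].
- by rewrite (negbTE n2).
- by rewrite (negbTE n3).
by rewrite (negbTE n21).
Qed.

(** [t1], [t2], [t3] are the potentials at the vertices 1, 2, 3 relative to vertex 0, and the [p]s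
    are the signs sought there. Each implication belongs to an edge class that the potential
    balances. The fourth single edge now carries the sign [true], whence [~~ p1]. *)
Lemma K4_signs1 (s t1 t2 t3 : A) : s != 1 -> exists p1 p2 p3 : bool,
  [/\ t2 = 1 -> p2 = false, t3 = 1 -> p3 = false, t2 = t1 -> p2 = p1,
      t3 = t1 * s -> p3 = ~~ p1 &
      ((t1 == 1) || (t1 * s == 1) -> p1 = (t1 != 1)) /\
      ((t3 == t2) || (t3 == t2 * s) -> p2 (+) p3 = (t3 != t2))].
Proof.
move=> ns; have nsx x : (x * s == x) = false.
  by rewrite -{2}[x]mulg1 (inj_eq (mulgI _)) (negbTE ns).
have [e21|n21] := eqVneq t2 t1.
  exists (t1 != 1), (t1 != 1), (if t3 == 1 then false else (t3 == t1) (+) (t1 == 1)).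
  rewrite -e21 {e21}; split=> //; first by move=> ->; rewrite eqxx.
  - by move=> ->; rewrite eqxx.
  - move=> ->; rewrite nsx; case: (eqVneq (t2 * s) 1) => [E|_].
      by case: (eqVneq t2 1) => // e2; case/eqP: ns; rewrite -E e2 mul1g.
    by rewrite negbK.
  split=> // /orP[]/eqP->.
    by rewrite eqxx; case: (t2 == 1).
  rewrite nsx; case: (eqVneq (t2 * s) 1) => [E|_]; last by case: (t2 == 1).
  by case: (eqVneq t2 1) => // e2; case/eqP: ns; rewrite -E e2 mul1g.
have [e2|n2] := eqVneq t2 1.
  exists (if (t1 == 1) || (t1 * s == 1) then t1 != 1 else t3 == 1), false, (t3 != 1).
  rewrite e2; split=> //; first by move=> ->; rewrite eqxx.
  - by move=> E; move: n21; rewrite e2 E eqxx.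
  - move=> ->; case: (eqVneq t1 1) => [->|_] /=; first by rewrite mul1g ns.
    by case: (t1 * s == 1).
  by split=> [->|].
exists (t1 != 1), ((if t3 == 1 then false else t1 == 1) (+) (t3 != t2)),
       (if t3 == 1 then false else t1 == 1).
split; try by [move=> /eqP; rewrite ?(negbTE n2) ?(negbTE n21)|move=> ->; rewrite eqxx].
  move=> ->; case: (eqVneq (t1 * s) 1) => [E|_]; last by rewrite negbK.
  by case: (eqVneq t1 1) => // e1; case/eqP: ns; rewrite -E e1 mul1g.
by split=> // _; rewrite addbAC addbb.
Qed.
End K4signs.

Section K4mm.
Variables (A : groupType) (m m' : nat).
Let G := K4mm m m'.
Local Open Scope group_scope.

Definition K4mk (x y : 'I_4) : 'I_(match val x, val y with
    | 0, 1 => m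
    | 2, 3 => m'
    | 0, 2 | 0, 3 | 1, 2 | 1, 3 => 1
    | _, _ => 0
    end) -> edge G :=
  fun i => @existT _ (fun p : 'I_4 * 'I_4 => 'I_(match val p.1, val p.2 with
    | 0, 1 => m
    | 2, 3 => m'
    | 0, 2 | 0, 3 | 1, 2 | 1, 3 => 1
    | _, _ => 0
    end)) (x, y) i.

Definition K4a (i : 'I_m) : edge G := K4mk (x := ord4 0) (y := ord4 1) i.
Definition K4d (i : 'I_m') : edge G := K4mk (x := ord4 2) (y := ord4 3) i.
Definition K4p : edge G := K4mk (x := ord4 0) (y := ord4 2) ord0.
Definition K4q : edge G := K4mk (x := ord4 0) (y := ord4 3) ord0.
Definition K4r : edge G := K4mk (x := ord4 1) (y := ord4 2) ord0.
Definition K4s : edge G := K4mk (x := ord4 1) (y := ord4 3) ord0.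

Lemma K4_edge_ind (P : edge G -> Prop) :
  (forall i, P (K4a i)) -> (forall i, P (K4d i)) ->
  P K4p -> P K4q -> P K4r -> P K4s -> forall e, P e.
Proof.
move=> Pa Pd Pp Pq Pr Ps [[x y] i]; move: i; rewrite -(ord4K x) -(ord4K y).
case: (nat_of_ord x) => [|[|[|?]]]; case: (nat_of_ord y) => [|[|[|?]]] i;
  try (by case: i); try exact: Pa; try exact: Pd; rewrite [i]ord1.
- exact: Pp.
- exact: Pq.
- exact: Pr.
- exact: Ps.
Qed.

Lemma K4_has_potP (B : groupType) (h : edge G -> B) (S : pred (edge G)) th :
  (forall e, S e -> pot h th e) <-> 
  [/\ forall i, S (K4a i) -> h (K4a i) = (th (ord4 0))^-1 * th (ord4 1),
      forall i, S (K4d i) -> h (K4d i) = (th (ord4 2))^-1 * th (ord4 3),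
      S K4p -> h K4p = (th (ord4 0))^-1 * th (ord4 2),
      S K4q -> h K4q = (th (ord4 0))^-1 * th (ord4 3) &
      (S K4r -> h K4r = (th (ord4 1))^-1 * th (ord4 2)) /\
      (S K4s -> h K4s = (th (ord4 1))^-1 * th (ord4 3))].
Proof.
split=> [H|[Ha Hd Hp Hq [Hr Hs]]].
  by split=> [i|i|||]; try (split); move/H/eqP.
apply: K4_edge_ind => [i|i||||] e; rewrite /pot; apply/eqP.
- exact: Ha.
- exact: Hd.
- exact: Hp.
- exact: Hq.
- exact: Hr.
- exact: Hs.
Qed.

Lemma dual_valid_K4mm : dual_valid A G.
Proof.
move=> g0.
pose eta (x : 'I_4) := match val x with
  | 0 => 1 | 1 => g0 K4p * (g0 K4r)^-1 | 2 => g0 K4p | _ => g0 K4q end.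
apply: (@dual_test_switch A G g0 eta); set g : edge G -> A := fun e => _.
have gp : g K4p = 1 by rewrite /g /eta /= mul1g mulgV.
have gq : g K4q = 1 by rewrite /g /eta /= mul1g mulgV.
have gr : g K4r = 1 by rewrite /g /eta /= mulgVK mulgV.
move: {g0 eta} g gp gq gr => g gp gq gr; set s := g K4s; move=> dt.
pose mk (B : Type) (b0 b1 b2 b3 : B) (x : 'I_4) : B :=
  match val x with 0 => b0 | 1 => b1 | 2 => b2 | _ => b3 end.
pose sgn (fa fd : A -> bool) (c : bool) (e : edge G) : sign :=
  match val (src e), val (tgt e) with
  | 0, 1 => fa (g e) | 2, 3 => fd (g e) | 1, 3 => c | _, _ => false end.
(* With sign [false] at vertex 0, compatibility asks for three signs for each potential; the premise
   [dt] then makes [sgn] balanced. *)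
have sgnP fa fd c : (forall th : 'I_4 -> A,
    let t i := (th (ord4 0))^-1 * th (ord4 i) in
    exists p1 p2 p3 : bool, [/\ t 2 = 1 -> p2 = false, t 3 = 1 -> p3 = false,
      t 2 = t 1%N -> p2 = p1, t 3 = t 1%N * s -> p3 = c (+) p1 &
      (forall i, g (K4a i) = t 1%N -> p1 = fa (t 1%N)) /\
      (forall i, g (K4d i) = (t 2)^-1 * t 3 -> p2 (+) p3 = fd ((t 2)^-1 * t 3))]) ->
  exists ps : vert G -> sign, forall e, pot (sgn fa fd c) ps e.
- move=> H; have [|ps Hps] := dt (sgn fa fd c); last by exists ps => e; apply: Hps.
  move=> th; have [p1 [p2 [p3 [H2 H3 H12 H13 [Ha Hd]]]]] := H th.
  have mulE (x y : A) : x^-1 * y = ((th (ord4 0))^-1 * x)^-1 * ((th (ord4 0))^-1 * y).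
    by rewrite invgM invgK -mulgA mulVKg.
  exists (mk _ false p1 p2 p3); apply/K4_has_potP.
  have t1 (x y : A) : 1 = x^-1 * y -> x = y by move/esym/mulg1_eq; rewrite invgK.
  split=> [i|i|||]; rewrite /sgn /mk /= /pot /=.
  + by move=> /eqP E; rewrite E (Ha _ E).
  + by move=> /eqP; rewrite mulE => E; rewrite E signM signV (Hd _ E).
  + by rewrite gp => /eqP/esym/H2 ->.
  + by rewrite gq => /eqP/esym/H3 ->.
  split; first by rewrite gr => /eqP; rewrite mulE => /t1/esym/H12->; rewrite signM addbb.
  by rewrite -/s => /eqP; rewrite mulE => E;
    rewrite H13 ?E ?mulVKg // signM signV addbCA addbb addbF.
pose f0 a := (a != 1) && (a * s != 1); pose h0 b := (b != 1) && (b != s).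
(* [K4p], [K4q] and [K4r] form a spanning tree of edges with sign [false], so [ps] is constant and
   every sign vanishes. *)
have constP fa fd c ps : (forall e, pot (sgn fa fd c) ps e) ->
    [/\ forall i, fa (g (K4a i)) = false, forall i, fd (g (K4d i)) = false & c = false].
  move=> Hps.
  have /eqP Ep : false == ps (ord4 0) (+) ps (ord4 2) := Hps K4p.
  have /eqP Eq : false == ps (ord4 0) (+) ps (ord4 3) := Hps K4q.
  have /eqP Er : false == ps (ord4 1) (+) ps (ord4 2) := Hps K4r.
  have /eqP Es : c == ps (ord4 1) (+) ps (ord4 3) := Hps K4s.
  have Ea i : fa (g (K4a i)) = ps (ord4 0) (+) ps (ord4 1) by apply/eqP; exact: (Hps (K4a i)).
  have Ed i : fd (g (K4d i)) = ps (ord4 2) (+) ps (ord4 3) by apply/eqP; exact: (Hps (K4d i)).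
  split=> [i|i|]; rewrite ?Ea ?Ed ?Es; move: Ep Eq Er;
    by case: (ps _); case: (ps _); case: (ps _); case: (ps _).
have [|ps /constP[Qa Qd _]] := sgnP f0 h0 false.
  move=> th t; have [p1 [p2 [p3 [H2 H3 H12 H13 [E1 E2]]]]] := K4_signs s (t 1%N) (t 2) (t 3).
  exists p1, p2, p3; split=> //; split=> [i _|i _]; first exact: E1.
  rewrite E2 /h0 mulg_eq1 eqg_inv [t 2 == _]eq_sym; congr (_ && ~~ _).
  by rewrite -[RHS](inj_eq (mulgI (t 2))) mulVKg.
have [s1|ns] := eqVneq s 1.
  exists (fun=> 1); apply/K4_has_potP; rewrite invg1 mul1g; split=> // i _.
  - by have := Qa i; rewrite /f0 s1 mulg1 andbb => /negbFE/eqP.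
  - by have := Qd i; rewrite /h0 s1 andbb => /negbFE/eqP.
have [|ps' /constP[] //] := sgnP (fun a => a != 1) (fun b => b != 1) true.
move=> th t.
have [p1 [p2 [p3 [H2 H3 H12 H13 [E1 E2]]]]] := K4_signs1 (t 1%N) (t 2) (t 3) ns.
exists p1, p2, p3; split=> //; split=> i.
  have := Qa i => /[swap] ->; rewrite /f0 => /negbT; rewrite negb_and !negbK; exact: E1.
have := Qd i => /[swap] ->; rewrite /h0 => /negbT; rewrite negb_and !negbK mulg_eq1 eqg_inv.
rewrite [t 2 == _]eq_sym -[_ == s](inj_eq (mulgI (t 2))) mulVKg; exact: E2.
Qed.
End K4mm.

Section C3m22.
Variables (A : groupType) (m : nat).
Let G := Cmult [:: m; 2; 2].
Local Open Scope group_scope.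

Definition C3mk (x y : 'I_3) (i : 'I_(if y == ordS x then nth 0 [:: m; 2;
  2] x else 0)) : edge G :=
  @existT _ (fun p : 'I_3 * 'I_3 => 'I_(if p.2 == ordS p.1 then nth 0 [:: m; 2; 2] p.1 else 0))
    (x, y) i.

Definition C3a (i : 'I_m) : edge G := @C3mk (ord3 0) (ord3 1) i.
Definition C3b (i : 'I_2) : edge G := @C3mk (ord3 1) (ord3 2) i.
Definition C3c (i : 'I_2) : edge G := @C3mk (ord3 2) (ord3 0) i.

Lemma C3_edge_ind (P : edge G -> Prop) :
  (forall i, P (C3a i)) -> (forall i, P (C3b i)) -> (forall i, P (C3c i)) ->
  forall e, P e.
Proof.
move=> Pa Pb Pc [[x y] i]; move: i; rewrite -(ord3K x) -(ord3K y).
case: (nat_of_ord x) => [|[|?]]; case: (nat_of_ord y) => [|[|?]] i;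
  by case: i.
Qed.

Lemma C3_has_potP (B : groupType) (h : edge G -> B) (S : pred (edge G)) th :
  (forall e, S e -> pot h th e) <->
  [/\ forall i, S (C3a i) -> h (C3a i) = (th (ord3 0))^-1 * th (ord3 1),
      forall i, S (C3b i) -> h (C3b i) = (th (ord3 1))^-1 * th (ord3 2) &
      forall i, S (C3c i) -> h (C3c i) = (th (ord3 2))^-1 * th (ord3 0)].
Proof.
split=> [H|[Ha Hb Hc]]; first by split=> i /H/eqP.
apply: C3_edge_ind => i e; rewrite /pot; apply/eqP.
- exact: Ha.
- exact: Hb.
- exact: Hc.
Qed.

Definition C3sign (g : edge G -> A) (fa fb fc : A -> bool) (e : edge G) : sign :=
  match val (src e) with 0 => fa (g e) | 1 => fb (g e) | _ => fc (g e) end.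

(** The sign of an edge depends on its class and gain only, so balanced digons have parity zero and
    only balanced triangles impose conditions. *)
Lemma C3sign_compatible g (fa fb fc : A -> bool) :
  (forall i j k, g (C3a i) * g (C3b j) * g (C3c k) = 1 ->
     fa (g (C3a i)) (+) fb (g (C3b j)) (+) fc (g (C3c k)) = false) ->
  forall th, has_pot (C3sign g fa fb fc) (pot g th).
Proof.
move=> H th.
pose u1 := (th (ord3 0))^-1 * th (ord3 1).
pose u2 := (th (ord3 1))^-1 * th (ord3 2).
pose u3 := (th (ord3 2))^-1 * th (ord3 0).
have u123 : u1 * u2 * u3 = 1.
  by rewrite /u1 /u2 /u3 !mulgA !mulgK mulVg.
pose pa := [exists i, g (C3a i) == u1]; pose pc := [exists k, g (C3c k) == u3].
(* If a class has no balanced edge, its condition is void and the sign is chosen to suit the other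
   classes. *)
pose p2 := if pc then fc u3 else fa u1 (+) fb u2.
pose p1 := if pa then fa u1 else p2 (+) fb u2.
exists (fun x : 'I_3 => match val x with 0 => false | 1 => p1 | _ => p2 end).
apply/C3_has_potP; rewrite /C3sign /pot /= -/u1 -/u2 -/u3 signM signV.
split=> i /eqP E; rewrite E ?signM ?signV ?addbF /=.
- by rewrite /p1; have -> : pa by apply/existsP; exists i; rewrite E.
- rewrite /p1 /p2; have [/existsP[j /eqP Ej]|_] := boolP pa; last by rewrite addbAC addbb.
  have [/existsP[k /eqP Ek]|_] := boolP pc; last by rewrite addKb.
  have := H j i k; rewrite E Ek Ej => /(_ u123).
  by case: (fa _); case: (fb _); case: (fc _).
- by rewrite /p2; have -> : pc by apply/existsP; exists i; rewrite E.
Qed.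

Lemma ord2_cases (i : 'I_2) : i = ord0 \/ i = ord_max.
Proof. by case: i => -[|[|//]] i; [left|right]; apply: val_inj. Qed.

Lemma dual_valid_C3m22 : dual_valid A G.
Proof.
move=> g dt; pose b0 := g (C3b ord0); pose b1 := g (C3b ord_max).
pose c0 := g (C3c ord0); pose c1 := g (C3c ord_max).
have bE i : g (C3b i) = b0 \/ g (C3b i) = b1 by case: (ord2_cases i) => ->; [left|right].
have cE i : g (C3c i) = c0 \/ g (C3c i) = c1 by case: (ord2_cases i) => ->; [left|right].
have constr i j k : g (C3a i) * g (C3b j) * g (C3c k) = 1 ->
    (g (C3a i))^-1 = g (C3b j) * g (C3c k).
  by rewrite -mulgA => /mulg1_eq.
have signs fa fb fc ps : (forall e, pot (C3sign g fa fb fc) ps e) ->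
  [/\ forall i, fa (g (C3a i)) = ps (ord3 0) (+) ps (ord3 1),
      forall i, fb (g (C3b i)) = ps (ord3 1) (+) ps (ord3 2) &
      forall i, fc (g (C3c i)) = ps (ord3 2) (+) ps (ord3 0)].
  by move=> H; split=> i; apply/eqP; [exact: (H (C3a i))|exact: (H (C3b i))|exact: (H (C3c i))].
have [/andP[nb nc]|] := boolP ((b1 != b0) && (c1 != c0)).
  (* Two distinct [b]s and two distinct [c]s: the triangles that one [a] balances are
     either of the form [b0 c0], [b1 c1] or of the form [b0 c1], [b1 c0]. *)
  pose fa a := (a^-1 == b0 * c1) || (a^-1 == b1 * c0).
  have [|ps Hps] := dt (C3sign g fa (eq_op^~ b1) (eq_op^~ c1)).
    apply: C3sign_compatible => i j k /constr; rewrite /fa => ->.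
    have [->|->] := bE j; have [->|->] := cE k;
      rewrite ?(inj_eq (mulgI _)) ?(inj_eq (mulIg _)) ?eqxx
        ?(negbTE nb) ?(negbTE nc) ?[b0 == b1]eq_sym ?[c0 == c1]eq_sym
        ?(negbTE nb) ?(negbTE nc) //= ?orbT //.
  have [_ H _] := signs _ _ _ _ (fun e => Hps e isT).
  have := H ord_max; rewrite -(H ord0) -/b0 -/b1 eqxx eq_sym (negbTE nb) //.
rewrite negb_and !negbK => nbc.
(* Now the two [b]s or the two [c]s coincide, so a balanced triangle has no or two marked edges. If
   this sign function is balanced, no edge is marked, since those of gain [b0] and [c0] are not. *)
have [|ps Hps] := dt (C3sign g (fun a => a^-1 != b0 * c0) (fun b => b != b0) (fun c =>
  c != c0)).
  apply: C3sign_compatible => i j k /constr ->.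
  have [->|->] := bE j; have [->|->] := cE k; case/orP: nbc => /eqP E;
    rewrite ?E ?(inj_eq (mulgI _)) ?(inj_eq (mulIg _)) ?eqxx ?addbb ?addbF ?addbb //=.
have [Ha Hb Hc] := signs _ _ _ _ (fun e => Hps e isT).
have E01 := Hb ord0; have E20 := Hc ord0; rewrite /= !eqxx in E01 E20.
have E10 : ps (ord3 0) (+) ps (ord3 1) = false.
  by move: E01 E20; case: (ps _); case: (ps _); case: (ps _).
exists (fun x : 'I_3 => match val x with 0 => 1 | 1 => (b0 * c0)^-1 | _ => c0^-1 end).
apply/C3_has_potP; split=> i _; rewrite /= ?invg1 ?mul1g ?mulg1 ?invgK ?mulgK.
- by have := Ha i; rewrite E10 => /negbFE/eqP <-; rewrite invgK.
- by have := Hb i; rewrite -E01 => /negbFE/eqP.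
- by have := Hc i; rewrite -E20 => /negbFE/eqP.
Qed.
End C3m22.

(** * Multiplicities and branch sets *)

Definition between (G : mgraph) (x y : vert G) : {set edge G} :=
  [set e | ends e == [set x; y]].

Definition mult (G : mgraph) (x y : vert G) : nat := #|between x y|.

Definition loopless (G : mgraph) : Prop := forall e : edge G, src e != tgt e.

Section Multiplicity.
Variable G : mgraph.
Implicit Types x y : vert G.

Lemma multC x y : mult x y = mult y x.
Proof. by rewrite /mult /between setUC. Qed.

Lemma mult_gt0 x y : (0 < mult x y) = adj predT x y.
Proof.
apply/card_gt0P/adjP => [[e]|[e _ E]]; first by rewrite inE => /eqP E; exists e.
by exists e; rewrite inE E.
Qed.

Lemma loopless_adj x y : loopless G -> adj predT x y -> x != y.
Proof.
move=> nl /adjP[e _ /set2_inj H]; have := nl e.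
by case: H => -[<- <-] //; rewrite eq_sym.
Qed.

End Multiplicity.

Section MultGraph.
Variables (W : finType) (mu : W -> W -> nat) (G : mgraph) (f : W -> vert G).
Hypothesis f_inj : injective f.
Hypothesis mu_asym : forall w w', 0 < mu w w' -> mu w' w = 0.
Hypothesis mu_le : forall w w', mu w w' <= mult (f w) (f w').

(** The index of an edge is its position in the enumeration of [between]. By [mu_asym] each pair of
    vertices carries edges in one direction only, so no edge is hit twice. *)
Definition mult_edge (e : edge (mult_graph mu)) : edge G :=
  enum_val (widen_ord (mu_le (tag e).1 (tag e).2) (tagged e)).

Lemma mult_edge_ends e : ends (mult_edge e) = [set f (src e); f (tgt e)].
Proof.
by have := enum_valP (widen_ord (mu_le (tag e).1 (tag e).2) (tagged e));
  rewrite inE => /eqP.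
Qed.

Lemma mult_edge_inj : injective mult_edge.
Proof.
move=> e e' E; have := mult_edge_ends e; rewrite E mult_edge_ends.
move: E; case: e => [[x y] i]; case: e' => [[x' y'] j] E /=.
have m0 : 0 < mu x y by apply: leq_ltn_trans (ltn_ord i).
have m0' : 0 < mu x' y' by apply: leq_ltn_trans (ltn_ord j).
case/set2_inj=> -[/f_inj ex /f_inj ey]; subst x' y'; last first.
  by rewrite (mu_asym m0) in m0'.
by move: E => /enum_val_inj/(congr1 val) /= /val_inj ->.
Qed.

Lemma mult_graph_subgraph : subgraph (mult_graph mu) G.
Proof.
exists f, mult_edge; split=> //; first exact: mult_edge_inj.
by move=> e; rewrite mult_edge_ends /ends imset_set2.
Qed.

Lemma mult_graph_isomorphic :
  (forall x, exists w, f w = x) -> loopless G ->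
  (forall w w', w != w' -> mult (f w) (f w') <= mu w w' + mu w' w) ->
  isomorphic G (mult_graph mu).
Proof.
move=> f_surj nl mu_ge.
have f_bij : bijective f.
  have [h Hh] := fin_all_exists f_surj.
  by exists h => // w; apply: f_inj; rewrite Hh.
have onto (e : edge G) w w' : ends e = [set f w; f w'] -> mult (f w) (f w') <= mu w w' ->
    exists e', mult_edge e' = e.
  move=> E le; have eb : e \in between (f w) (f w') by rewrite inE E.
  have lt : enum_rank_in eb e < mu w w' by apply: leq_trans (ltn_ord _) le.
  exists (@existT _ (fun p => 'I_(mu p.1 p.2)) (w, w') (Ordinal lt)).
  rewrite -[RHS](enum_rankK_in eb eb) /mult_edge /=.
  by congr enum_val; apply: val_inj.
have E_surj e : exists e', mult_edge e' = e.
  have [w ew] := f_surj (src e); have [w' ew'] := f_surj (tgt e).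
  have ne : w != w' by apply: contraNneq (nl e) => E; rewrite -ew -ew' E.
  have := mu_ge _ _ ne; have [|m0] := posnP (mu w' w).
    by move=> ->; rewrite addn0; apply: onto; rewrite ew ew'.
  rewrite (mu_asym m0) add0n multC; apply: onto.
  by rewrite ew ew' setUC.
have [fV' fVK fVK'] := f_bij; have [fE' HE'] := fin_all_exists E_surj.
have fE'K : cancel mult_edge fE' by move=> e; apply: mult_edge_inj; rewrite HE'.
exists fV', fE'; split; [by exists f|by exists mult_edge|].
move=> e; rewrite -{2}(HE' e) mult_edge_ends imset_set2 !fVK.
by [].
Qed.

End MultGraph.

Section Merge.
Variables (G : mgraph) (u v : vert G) (e : edge G).
Hypothesis nvu : v != u.
Hypothesis ends_e : ends e = [set v; u].

Definition merge_proj (x : vert G) : {x | x != u} := insubd (Sub v nvu) x.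

(** A concrete G/e in which [v] stands for the merged vertex, so that [val] is a section of the
    projection. *)
Definition merge : mgraph :=
  @MGraph {x | x != u} {f | f != e}
    (fun f => merge_proj (src (val f))) (fun f => merge_proj (tgt (val f))).

Lemma val_merge_proj x : val (merge_proj x) = if x == u then v else x.
Proof. by rewrite /merge_proj val_insubd; case: eqP. Qed.

Lemma merge_projK (y : vert merge) : merge_proj (val y) = y.
Proof. by apply: val_inj; rewrite val_merge_proj (negbTE (valP y)). Qed.

Lemma merge_proj_uv : merge_proj u = merge_proj v.
Proof. by apply: val_inj; rewrite !val_merge_proj eqxx if_same. Qed.

Lemma merge_proj_eq x y :
  merge_proj x = merge_proj y -> x = y \/ (x \in [set v; u] /\ y \in [set v; u]).
Proof.
move/(congr1 val); rewrite !val_merge_proj !inE.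
case: (eqVneq x u) => [->|_]; case: (eqVneq y u) => [->|_] E; rewrite ?orbT; auto.
- by right; rewrite E eqxx.
- by right; rewrite E eqxx.
Qed.

Lemma merge_ends (f : edge merge) :
  ends f = [set merge_proj x | x in ends (val f)].
Proof. by rewrite /ends imset_set2. Qed.

Lemma merge_contraction : contraction e merge.
Proof.
exists merge_proj, val; split=> [y|x y||f|].
- by exists (val y); rewrite merge_projK.
- split=> [/merge_proj_eq|[->//|]]; rewrite ends_e //.
  by rewrite !inE => -[/pred2P[]-> /pred2P[]->] //; rewrite merge_proj_uv.
- exact: val_inj.
- split=> [[h <-]|ne]; first exact/eqP/(valP h).
  by have /eqP ne' := ne; exists (Sub f ne').
- exact: merge_ends.
Qed.

Lemma card_merge : #|vert merge| = #|vert G|.-1.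
Proof. by rewrite card_sig cardC1. Qed.

Lemma merge_adj x y :
  adj predT x y -> merge_proj x = merge_proj y \/
    adj (G := merge) predT (merge_proj x) (merge_proj y).
Proof.
case/adjP=> f _ E; have [fe|ne] := eqVneq f e.
  left; move: E; rewrite fe ends_e => /set2_inj[][<- <-] //; by rewrite merge_proj_uv.
right; apply/adjP; exists (Sub f ne) => //.
by rewrite merge_ends SubK E imset_set2.
Qed.

Lemma merge_minor G0 : minor G0 G -> minor G0 merge.
Proof. by move=> m; apply: minor_contraction m merge_contraction. Qed.

End Merge.

Section Models.
Variables (W : finType) (mu : W -> W -> nat).

Definition fiber_rel (G : mgraph) (be : vert G -> option W) (w : W) : rel (vert G) :=
  [rel a b | [&& adj predT a b, be a == Some w & be b == Some w]].

Definition joining (G : mgraph) (be : vert G -> option W) (w w' : W) : {set edge G} :=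
  [set f | be @: ends f == [set Some w; Some w']].

(* [be] maps each vertex to the branch set that contains it, if any. *)
Definition model (G : mgraph) (be : vert G -> option W) : Prop :=
  [/\ forall w, exists x, be x = Some w,
      forall w x y, be x = Some w -> be y = Some w -> connect (fiber_rel be w) x y &
      forall w w', mu w w' <= #|joining be w w'|].

Hypothesis mu_asym : forall w w', 0 < mu w w' -> mu w' w = 0.

(** Contract a link inside a branch set as long as there is one; afterwards the branch sets are
    single vertices and the target is a subgraph. *)
Lemma model_minor (G0 G : mgraph) (be : vert G -> option W) :
  model be -> minor G0 G -> minor G0 (mult_graph mu).
Proof.
have [n] := ubnP #|vert G|; elim: n G be => // n IH G be ltn [surj conn edges] mG.
pose inner (e : edge G) :=
  [&& src e != tgt e, be (src e) == be (tgt e) & be (src e) != None].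
have neq w w' : 0 < mu w w' -> w != w'.
  by move=> m0; apply: contraTneq m0 => <-; rewrite -leqNgt;
    case: posnP (@mu_asym w w) => [->|_ ->].
have [e /and3P[nvu /eqP be_e bN]|no_inner] := pickP inner.
  pose pr := merge_proj nvu; pose be' (y : vert (merge e nvu)) := be (val y).
  have be'E x : be' (pr x) = be x.
    by rewrite /be' val_merge_proj; case: eqP => [->|].
  apply: (IH (merge e nvu) be'); last exact: merge_minor mG.
    by rewrite card_merge -ltnS (leq_trans _ ltn) // prednK //; apply/card_gt0P; exists (src e).
  split=> [w|w x y Ex Ey|w w'].
  - by have [x Ex] := surj w; exists (pr x); rewrite be'E.
  - rewrite -(merge_projK x) -(merge_projK y).
    apply: (connect_map (f := pr)) (conn _ _ _ Ex Ey) => a b /and3P[ab ba bb].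
    have [E|ab'] := @merge_adj _ _ _ e nvu (erefl _) _ _ ab.
      by rewrite /pr E connect0.
    by apply/connect1/and3P; split; rewrite ?be'E.
  - have [->//|/neq nw] := posnP (mu w w').
    apply: leq_trans (edges w w') _; rewrite -(card_imset _ val_inj).
    apply/subset_leq_card/subsetP => f; rewrite inE => /eqP Ef.
    have nfe : f != e.
      apply: contraNneq nw => fe; move: Ef; rewrite fe imset_set2 be_e.
      by case/set2_inj=> -[->] => -[->].
    apply/imsetP; exists (Sub f nfe) => //.
    by rewrite inE merge_ends SubK -imset_comp -Ef; apply/eqP/eq_imset => x; apply: be'E.
have be_inj w x y : be x = Some w -> be y = Some w -> x = y.
  move=> Ex Ey; apply: (connect_inv (f := id)) (conn _ _ _ Ex Ey).
  move=> a b /and3P[/adjP[f _ Ef] /eqP Ea /eqP Eb]; have := no_inner f.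
  by rewrite /inner; case/set2_inj: Ef => -[-> ->]; rewrite Ea Eb eqxx andbT => /negbFE/eqP.
have [f Hf] := fin_all_exists surj.
apply: minor_subgraph mG _; apply: (@mult_graph_subgraph _ _ _ f) => // [w w' E|w w'].
  by apply/eqP; rewrite -(inj_eq (@Some_inj _)) -!Hf E.
apply: leq_trans (edges w w') _; apply/subset_leq_card/subsetP => e.
rewrite !inE => /eqP; rewrite imset_set2 => /set2_inj[][E1 E2].
  by rewrite /ends (be_inj _ _ _ E1 (Hf w)) (be_inj _ _ _ E2 (Hf w')).
by rewrite /ends (be_inj _ _ _ E1 (Hf w')) (be_inj _ _ _ E2 (Hf w)) setUC.
Qed.
End Models.

(** * Biconnected graphs *)

Definition off (G : mgraph) (X : {set vert G}) : rel (vert G) :=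
  fun x y => [&& adj predT x y, x \notin X & y \notin X].

Definition conn_off (G : mgraph) (X : {set vert G}) : Prop :=
  forall a b, a \notin X -> b \notin X -> connect (off X) a b.

Definition biconnected (G : mgraph) : Prop :=
  [/\ loopless G, 1 < #|vert G|, conn_off (set0 : {set vert G}) &
      forall v : vert G, conn_off [set v]].

Section Isomorphisms.
Implicit Types G H K : mgraph.

Lemma isomorphic_trans G H K : isomorphic G H -> isomorphic H K -> isomorphic G K.
Proof.
case=> fV [fE [bV bE E]] [fV' [fE' [bV' bE' E']]].
exists (fV' \o fV), (fE' \o fE); split; try exact: bij_comp.
by move=> e; rewrite /= E' E imset_comp.
Qed.

Definition move_end G (v : vert G) (S : {set edge G}) (e : edge G) (x : vert G) :
    option (vert G) :=
  if (e \in S) && (x == v) then None else Some x.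

Lemma extrude_ends G (v : vert G) S (e : edge G) :
  ends (Some e : edge (extrude v S)) = move_end v S e @: ends e.
Proof. by rewrite imset_set2. Qed.

Lemma bijective_omap (T U : Type) (f : T -> U) : bijective f -> bijective (omap f).
Proof. by case=> g fK gK; exists (omap g); case=> //= x; rewrite ?fK ?gK. Qed.

Lemma isomorphic_extrude G H (fV : vert G -> vert H) (fE : edge G -> edge H)
    (v : vert G) (S : {set edge G}) :
  bijective fV -> bijective fE -> (forall e, ends (fE e) = fV @: ends e) ->
  isomorphic (extrude v S) (extrude (fV v) (fE @: S)).
Proof.
move=> bV bE E; exists (omap fV), (omap fE); split; try exact: bijective_omap.
case=> [e|]; last by rewrite /ends imset_set2.
rewrite [LHS]extrude_ends extrude_ends E -!imset_comp; apply: eq_imset => x /=.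
rewrite /move_end (mem_imset _ _ (bij_inj bE)) (inj_eq (bij_inj bV)).
by case: ifP.
Qed.

(** [extrusion_of] is not closed under isomorphism, so the induction on blocks repeats the extrusion
    on the copy it was given. *)
Lemma extrusion_of_isomorphic (G0 G H H' : mgraph) (v w : vert H) (S : {set edge H}) :
  w != v -> S != set0 -> (forall e, e \in S -> ends e = [set v; w]) ->
  isomorphic G (extrude v S) -> extrusion_of G0 H' -> isomorphic H H' ->
  exists2 H2, extrusion_of G0 H2 & isomorphic G H2.
Proof.
move=> nwv n0 HS iG xH' [fV [fE [bV bE E]]].
exists (extrude (fV v) (fE @: S)); last first.
  exact: isomorphic_trans iG (isomorphic_extrude v S bV bE E).
apply: (extrusion_step (w := fV w)) => //.
- by rewrite (inj_eq (bij_inj bV)).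
- by rewrite imset_eq0.
- by move=> _ /imsetP[e eS ->]; rewrite E (HS e eS) imset_set2.
Qed.
End Isomorphisms.

Section Off.
Variables (G : mgraph).
Implicit Types X Y : {set vert G}.

Lemma off_sym X : symmetric (off X).
Proof. by move=> x y; rewrite /off adj_sym andbA andbAC -andbA. Qed.

Lemma connect_off_sym X : connect_sym (off X).
Proof. exact/sym_connect_sym/off_sym. Qed.

End Off.

Section MergeOff.
Variables (G : mgraph) (u v : vert G) (e : edge G).
Hypothesis nvu : v != u.
Hypothesis ends_e : ends e = [set v; u].
Let H := merge e nvu.
Let pr : vert G -> vert H := merge_proj nvu.

Lemma merge_conn_off (X : {set vert H}) :
  conn_off (pr @^-1: X) -> conn_off X.
Proof.
move=> cX a b aX bX.
have cab : connect (off (pr @^-1: X)) (val a) (val b).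
  by apply: cX; rewrite inE /pr merge_projK.
rewrite -(merge_projK a) -(merge_projK b).
apply: (connect_map (f := pr)) cab => x y /and3P[xy]; rewrite !inE => xX yX.
have [E|xy'] := merge_adj nvu ends_e xy; first by rewrite /pr E connect0.
by apply/connect1/and3P.
Qed.

Lemma merge_preim1 (y : vert H) :
  pr @^-1: [set y] = if y == pr v then [set u; v] else [set val y].
Proof.
apply/setP=> x; rewrite !inE -(inj_eq val_inj) val_merge_proj.
case: (y =P pr v) => [->|ne]; rewrite !inE ?val_merge_proj ?(negbTE nvu).
  by case: (x =P u) => [->|_] /=; rewrite ?eqxx.
case: (x =P u) => [->|_] //; rewrite [u == _]eq_sym (negbTE (valP y)).
by apply/eqP => E; apply: ne; apply: val_inj; rewrite val_merge_proj (negbTE nvu).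
Qed.
End MergeOff.

Section Reducible.
Variables (G : mgraph) (u v w : vert G) (e : edge G).
Hypotheses (nvu : v != u) (nwu : w != u) (nwv : w != v).
Hypothesis ends_e : ends e = [set v; u].
Hypothesis nbr_u : forall x, adj predT u x -> x = v \/ x = w.
Hypothesis mult_uv : mult u v = 1.
Hypothesis mult_uw : 0 < mult u w.
Hypothesis bcG : biconnected G.
Let H := merge e nvu.
Let pr : vert G -> vert H := merge_proj nvu.
Let S : {set edge H} := [set f | val f \in between u w].

Lemma only_edge_uv f : f \in between u v -> f = e.
Proof.
move=> fb; have eb : e \in between u v by rewrite inE ends_e setUC.
have /cards1P[e' E] : #|between u v| == 1 by rewrite -mult_uv.
by move: fb eb; rewrite E !inE => /eqP-> /eqP->.
Qed.

Lemma edge_at_u f : f != e -> u \in ends f -> f \in between u w.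
Proof.
move=> nfe; rewrite !inE => /pred2P uf.
have [x Ex] : exists x, ends f = [set u; x].
  by case: uf => ->; [exists (tgt f)|exists (src f); rewrite setUC].
have [|ex|<-] := nbr_u (x := x); [by apply/adjP; exists f| |by rewrite Ex].
by case/eqP: nfe; apply: only_edge_uv; rewrite inE Ex ex.
Qed.

Lemma merge_biconnected : biconnected H.
Proof.
have [nl c2 c0 c1] := bcG; split.
- move=> f; apply/eqP => /merge_proj_eq[E|[sf tf]].
    by have := nl (val f); rewrite E eqxx.
  case/eqP: (valP f); apply: only_edge_uv; rewrite inE; apply/eqP.
  have := nl (val f); rewrite /ends.
  move: sf tf; rewrite !inE => /pred2P[]-> /pred2P[]->; rewrite ?eqxx //.
  by rewrite setUC.
- rewrite card_merge -ltnS prednK; last by apply/card_gt0P; exists u.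
  apply: leq_trans (max_card (u |: [set v; w])).
  by rewrite cardsU1 cards2 !inE negb_or ![u == _]eq_sym nvu nwu eq_sym nwv.
- by apply: merge_conn_off ends_e _ _; rewrite preimset0.
- move=> y; apply: (merge_conn_off ends_e); rewrite merge_preim1.
  case: ifP => // _ a b; rewrite !inE !negb_or => /andP[au av] /andP[bu bv].
  have := c1 v a b; rewrite !inE => /(_ av bv) cab.
  (* The merged vertex is removed. A walk that avoids [v] enters and leaves [u] through [w], so [u]
     may be replaced by [w]. *)
  pose r x := if x == u then w else x.
  have ar : a = r a by rewrite /r (negbTE au).
  have br : b = r b by rewrite /r (negbTE bu).
  rewrite ar br.
  apply: (connect_map (f := r)) cab => x z /and3P[xz]; rewrite !inE => xv zv.
  have nuv : w \notin [set u; v] by rewrite !inE negb_or nwu.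
  rewrite /r; case: (eqVneq x u) xz => [->|xu] xz; case: (eqVneq z u) xz => [->|zu] xz.
  + exact: connect0.
  + have [zE|->] := nbr_u xz; [by rewrite zE eqxx in zv|exact: connect0].
  + rewrite adj_sym in xz; have [xE|->] := nbr_u xz; [by rewrite xE eqxx in xv|exact: connect0].
  + by apply/connect1/and3P; rewrite !inE !negb_or xu zu.
Qed.

Lemma moved_edges_neq0 : S != set0.
Proof.
have [f fb] := card_gt0P mult_uw.
have nfe : f != e.
  apply: contraTneq fb => ->; rewrite inE ends_e; apply/eqP => /set2_inj[][E1 E2].
    by have := nvu; rewrite E1 eqxx.
  by have := nwv; rewrite E1 eqxx.
by apply/set0Pn; exists (Sub f nfe); rewrite inE.
Qed.

Lemma moved_edges_ends f : f \in S -> ends f = [set pr v; pr w].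
Proof.
by rewrite inE inE => /eqP E; rewrite merge_ends E imset_set2 merge_proj_uv.
Qed.

Lemma merge_proj_neq : pr w != pr v.
Proof. by rewrite -(inj_eq val_inj) !val_merge_proj (negbTE nwu) (negbTE nvu). Qed.

(** [u] becomes the new vertex and [e] the new edge; every other edge at [u] leads to [w] and is one
    of the moved edges. *)
Lemma merge_extrude : isomorphic G (extrude (pr v) S).
Proof.
pose fV x : option (vert H) := if x == u then None else Some (pr x).
pose fE (f : edge G) : option (edge H) := insub f.
exists fV, fE; split.
- exists (fun y : option (vert H) => if y is Some y' then val y' else u) => [x|[y|]].
  + by rewrite /fV; case: eqP => [->//|/eqP/negbTE xu]; rewrite val_merge_proj xu.
  + by rewrite /fV (negbTE (valP y)) /pr merge_projK.
  + by rewrite /fV eqxx.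
- exists (fun y : option (edge H) => if y is Some y' then val y' else e) => [x|[y|]].
  + by rewrite /fE; case: insubP => [f _ <-//|]; rewrite negbK => /eqP->.
  + by rewrite /fE valK.
  + by rewrite /fE insubF // eqxx.
- move=> f; rewrite /fE; case: insubP => [f' nfe ff'|]; last first.
    rewrite negbK => /eqP->; rewrite ends_e imset_set2 /fV eqxx (negbTE nvu).
    by [].
  rewrite extrude_ends merge_ends ff' -imset_comp; apply: eq_in_imset => x xf /=.
  rewrite /move_end inE ff' /fV.
  have [fuw|nf] := boolP (f \in between u w).
    move: fuw; rewrite inE => /eqP E; move: xf; rewrite E !inE => /pred2P[]->.
      by rewrite eqxx /= merge_proj_uv eqxx.
    by rewrite (negbTE nwu) /= (negbTE merge_proj_neq).
  case: (x =P u) => // xu; case/negP: nf.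
  by apply: edge_at_u; rewrite -?xu.
Qed.
End Reducible.

(** * Separations by two vertices *)

Section ConnectedSets.
Variable G : mgraph.
Implicit Types (A B D X Y : {set vert G}) (x y z : vert G).

Definition ins D : rel (vert G) := fun x y => [&& adj predT x y, x \in D & y \in D].

Definition connected_set D : Prop := forall x y, x \in D -> y \in D -> connect (ins D) x y.

Lemma ins_sym D : symmetric (ins D).
Proof. by move=> x y; rewrite /ins adj_sym [(x \in D) && _]andbC. Qed.

Lemma connect_ins_sym D : connect_sym (ins D).
Proof. exact/sym_connect_sym/ins_sym. Qed.

Lemma sub_connect_ins A B x y : A \subset B -> connect (ins A) x y -> connect (ins B) x y.
Proof.
move=> /subsetP sAB; apply: connect_sub => a b /and3P[ab aA bA].
by apply/connect1/and3P; split; rewrite ?sAB.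
Qed.

Lemma connected_root D x :
  (forall y, y \in D -> connect (ins D) x y) -> connected_set D.
Proof.
by move=> H y z /H yD /H zD; apply: connect_trans zD; rewrite connect_ins_sym.
Qed.

Lemma connected_set1 x : connected_set [set x].
Proof. by move=> y z /set1P-> /set1P->; apply: connect0. Qed.

Lemma connected_setU A B x :
  connected_set A -> connected_set B -> x \in A -> x \in B -> connected_set (A :|: B).
Proof.
move=> cA cB xA xB; apply: (connected_root (x := x)) => y /setUP[yA|yB].
  exact: sub_connect_ins (subsetUl _ _) (cA _ _ xA yA).
exact: sub_connect_ins (subsetUr _ _) (cB _ _ xB yB).
Qed.

Lemma connected_setU1 A x y :
  connected_set A -> x \in A -> adj predT x y -> connected_set (y |: A).
Proof.
move=> cA xA xy; apply: (connected_root (x := x)) => z /setU1P[->|zA].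
  by apply/connect1/and3P; rewrite !inE eqxx xA orbT.
exact: sub_connect_ins (subsetUr _ _) (cA _ _ xA zA).
Qed.

Definition component (r : rel (vert G)) x : {set vert G} := [set y | connect r x y].

Lemma component_connected (r : rel (vert G)) x :
  (forall a b, r a b -> adj predT a b) -> connected_set (component r x).
Proof.
move=> rA; apply: (connected_root (x := x)) => y; rewrite inE => /connectP[p].
elim/last_ind: p y => [|p z IH] y; first by move=> _ ->; apply: connect0.
rewrite rcons_path last_rcons => /andP[pp rz] ->.
apply: connect_trans (IH _ pp erefl) _; apply/connect1/and3P.
have cl : connect r x (last x p) by apply/connectP; exists p.
by split; rewrite ?inE ?(rA _ _ rz) // (connect_trans cl) // connect1.
Qed.

Definition edges_between A B : {set edge G} :=
  [set f | (src f \in A) && (tgt f \in B) || (src f \in B) && (tgt f \in A)].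

Lemma edges_betweenC A B : edges_between A B = edges_between B A.
Proof. by apply/setP=> f; rewrite !inE orbC. Qed.

Lemma edges_betweenS A B A' B' :
  A \subset A' -> B \subset B' -> edges_between A B \subset edges_between A' B'.
Proof.
move=> /subsetP sA /subsetP sB; apply/subsetP => f; rewrite !inE.
case/orP=> /andP[H1 H2]; first by rewrite (sA _ H1) (sB _ H2).
by rewrite (sA _ H2) (sB _ H1) orbT.
Qed.

Lemma edges_between_ends A B f x y :
  ends f = [set x; y] -> x \in A -> y \in B -> f \in edges_between A B.
Proof.
by move=> /set2_inj[][ex ey] xA yB; rewrite inE ex ey xA yB ?orbT.
Qed.

End ConnectedSets.

Lemma branch_sets_minor (W : finType) (mu : W -> W -> nat) (G0 G : mgraph)
    (B : W -> {set vert G}) :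
  (forall w w', 0 < mu w w' -> mu w' w = 0) ->
  (forall w, B w != set0) -> (forall w, connected_set (B w)) ->
  (forall w w' x, x \in B w -> x \in B w' -> w = w') ->
  (forall w w', mu w w' <= #|edges_between (B w) (B w')|) ->
  minor G0 G -> minor G0 (mult_graph mu).
Proof.
move=> asym n0 conn disj edges; apply: (@model_minor _ _ asym _ _ (fun x =>
  [pick w | x \in B w])).
have beP x w : [pick w | x \in B w] = Some w <-> x \in B w.
  case: pickP => [w' xw'|H]; last by rewrite H.
  by split=> [[<-]|/(disj _ _ _ xw') ->].
split=> [w|w x y /beP xw /beP yw|w w'].
- by have /set0Pn[x xw] := n0 w; exists x; apply/beP.
- apply: connect_sub (conn w _ _ xw yw) => a b /and3P[ab aw bw].
  by apply/connect1/and3P; split=> //; apply/eqP/beP.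
- apply: leq_trans (edges w w') _; apply/subset_leq_card/subsetP => f.
  rewrite !inE imset_set2 => /orP[]/andP[/beP-> /beP->] //.
  by rewrite setUC.
Qed.

(** Since [v] and [w] may be exchanged, a vertex with exactly two neighbours is joined to each by at
    least two edges. *)
Definition irreducible (G : mgraph) : Prop := forall u v w : vert G,
  v != u -> w != u -> w != v -> (forall x, adj predT u x -> x = v \/ x = w) ->
  0 < mult u w -> mult u v != 1.

Section Separation.
Variable G : mgraph.
Hypotheses (bcG : biconnected G) (irG : irreducible G).
Implicit Types (A B D X Y : {set vert G}) (x y z : vert G).

(** Otherwise [y] would be a cut vertex between [D] and [x]. *)
Lemma exit_edge D x y d :
  (forall t s, t \in D -> adj predT t s -> [\/ s \in D, s = x | s = y]) ->
  d \in D -> x \notin D -> y \notin D -> x != y ->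
  exists2 t, t \in D & adj predT t x.
Proof.
move=> nD dD xD yD nxy; have [_ _ _ /(_ y)/(_ d x)] := bcG.
rewrite !inE nxy (contraTneq _ dD) => [/(_ isT isT) cdx|-> //].
have [/exists_inP[t tD tx]|] := boolP [exists t in D, adj predT t x].
  by exists t.
rewrite negb_exists_in => /forall_inP H.
have : (d \in D) = (x \in D).
  apply: (connect_inv (f := fun t => t \in D) _ cdx) => a b /and3P[ab].
  rewrite !inE => ay bY; apply/idP/idP => [aD|bD].
    by case: (nD _ _ aD ab) => // E; [case/negP: (H _ aD); rewrite -E|rewrite E eqxx in bY].
  rewrite adj_sym in ab.
  by case: (nD _ _ bD ab) => // E; [case/negP: (H _ bD); rewrite -E|rewrite E eqxx in ay].
by rewrite dD (negbTE xD).
Qed.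

(** Branch sets, inside [U], of a path of length two with both edges at least doubled. *)
Definition doubled_path (U : {set vert G}) x y : Prop := exists X Y D,
  [/\ [/\ x \in X, y \in Y & D != set0],
      [/\ connected_set X, connected_set Y & connected_set D],
      [/\ [disjoint X & Y], [disjoint X & D] & [disjoint Y & D]],
      X :|: Y :|: D \subset U &
      1 < #|edges_between D X| /\ 1 < #|edges_between D Y|].

Lemma doubled_pathC (U : {set vert G}) x y : doubled_path U x y -> doubled_path U y x.
Proof.
case=> X [Y [D [[xX yY n0] [cX cY cD] [dXY dXD dYD] sU [eX eY]]]].
by exists Y, X, D; split=> //; rewrite 1?disjoint_sym // [Y :|: X]setUC.
Qed.

(* [x'] and [y'] are the attachment vertices of the current fragment [D].  If a single
   edge joins [D] to [X], its end in [D] moves to [X] and a component of the rest of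
   [D] takes over. *)
Lemma fragment_doubled_path (U : {set vert G}) x y X Y D x' y' :
  [/\ x \in X, y \in Y, x' \in X & y' \in Y] -> D != set0 ->
  [/\ connected_set X, connected_set Y & connected_set D] ->
  [/\ [disjoint X & Y], [disjoint X & D] & [disjoint Y & D]] ->
  X :|: Y :|: D \subset U ->
  (forall t s, t \in D -> adj predT t s -> [\/ s \in D, s = x' | s = y']) ->
  doubled_path U x y.
Proof.
have [n] := ubnP #|D|.
elim: n x y X Y D x' y' => // n IH x y X Y D x' y' ltn inXY n0 conn disj sU nD.
wlog eX : x y X Y x' y' inXY conn disj sU nD / #|edges_between D X| <= 1.
  move=> H; have [eX|eX] := leqP #|edges_between D X| 1; first exact: (H x y X Y x' y').
  have [eY|eY] := leqP #|edges_between D Y| 1; last first.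
    by exists X, Y, D; split=> //; case: inXY => xX yY _ _; split.
  apply: doubled_pathC; case: inXY => xX yY x'X y'Y; case: conn => cX cY cD.
  case: disj => dXY dXD dYD.
  apply: (H y x Y X y' x') => //; first by rewrite disjoint_sym.
    by rewrite [Y :|: X]setUC.
  by move=> t s tD ts; case: (nD t s tD ts) => ?; [constructor 1|constructor 3|constructor 2].
case: inXY => xX yY x'X y'Y; case: conn => cX cY cD; case: disj => dXY dXD dYD.
have x'D : x' \notin D by rewrite (disjointFr dXD).
have y'D : y' \notin D by rewrite (disjointFr dYD).
have nxy : x' != y' by apply: contraTneq x'X => ->; rewrite (disjointFl dXY).
have [d0 d0D] := set0Pn _ n0.
have [d dD dx'] := exit_edge nD d0D x'D y'D nxy.
have [f _ Ef] := adjP _ _ _ dx'.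
have one f' : f' \in edges_between D X -> f' = f.
  move=> f'E; have fE := edges_between_ends Ef dD x'X.
  by move: eX; rewrite leqNgt => /card_gt1P H; apply/eqP/idPn => nf; apply: H; exists f', f.
have mult1 : mult d x' = 1.
  apply/eqP/cards1P; exists f; apply/setP => f'; rewrite !inE.
  apply/eqP/eqP => [E|->//]; apply: one; exact: edges_between_ends E dD x'X.
(* If [d] is all of [D], its neighbours are [x'] and [y'] and a single edge leads to [x'], against
   irreducibility. *)
have [D1|/set0Pn[z zD]] := eqVneq (D :\ d) set0.
  have ED : D = [set d].
    by apply/setP=> t; move/setP/(_ t): D1; rewrite !inE; case: eqP => [->|].
  have nD' t s : t \in D -> adj predT t s -> [\/ s \in D, s = y' | s = x'].
    by move=> tD ts; case: (nD t s tD ts) => ?; [constructor 1|constructor 3|constructor 2].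
  have nyx : y' != x' by rewrite eq_sym.
  have [t] := exit_edge nD' d0D y'D x'D nyx; rewrite {1}ED => /set1P-> dy'.
  have nx'd : x' != d by apply: contraNneq x'D => ->.
  have ny'd : y' != d by apply: contraNneq y'D => ->.
  have nbr s : adj predT d s -> s = x' \/ s = y'.
    move=> ds; case: (nD d s dD ds); [|by left|by right].
    rewrite ED => /set1P E; have [nl _ _ _] := bcG.
    by have := loopless_adj nl ds; rewrite E eqxx.
  by have := irG nx'd ny'd nyx nbr; rewrite mult1 mult_gt0 dy' => /(_ isT).
(* The only edge from [D] to [X] starts at [d], so [D'] can be left only to [d] or [y'], its new
   attachment vertices. *)
pose D' := component (ins (D :\ d)) z.
have sD' : D' \subset D :\ d.
  apply/subsetP=> t; rewrite inE => zt.
  have : (z \in D :\ d) = (t \in D :\ d); last by rewrite zD => <-.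
  by apply: (connect_inv (f := fun t => t \in D :\ d) _ zt) => a b /and3P[_ -> ->].
have dD' : d \notin D' by apply: contra (subsetP sD' d) _; rewrite !inE eqxx.
have sD'D : D' \subset D by apply: subset_trans sD' (subsetDl _ _).
apply: (IH x y (d |: X) Y D' d y').
- by rewrite -ltnS (leq_trans _ ltn) // ltnS proper_card // properE sD'D; apply/subsetPn;
  exists d.
- by rewrite !inE eqxx xX orbT.
- by apply/set0Pn; exists z; rewrite inE connect0.
- split=> //; last by apply: component_connected => a b /and3P[].
  by apply: connected_setU1 cX x'X _; rewrite adj_sym.
- split.
  + rewrite disjoints_subset subUset sub1set inE (disjointFl dYD) //=.
    by rewrite -disjoints_subset.
  + rewrite disjoints_subset subUset sub1set inE dD' /= -disjoints_subset.
    exact: disjointWr sD'D dXD.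
  + exact: disjointWr sD'D dYD.
- apply: subset_trans sU; rewrite -!setUA !subUset !sub1set !inE dD !orbT /=.
  by rewrite subsetUl setUCA subsetUl (subset_trans sD'D) // setUA subsetUr.
- move=> t s tD' ts; have tD := subsetP sD'D _ tD'.
  have ntd : t != d by apply: contraTneq tD' => ->.
  case: (nD t s tD ts) => [sD|E|E]; last by constructor 3.
    have [->|nsd] := eqVneq s d; first by constructor 2.
    constructor 1; rewrite inE; rewrite inE in tD'; apply: connect_trans tD' (connect1 _).
    by apply/and3P; rewrite !inE ntd nsd.
  case/adjP: ts => f' _ Ef'; have E' : f' = f.
    by apply: one; apply: edges_between_ends Ef' tD _; rewrite E.
  have : t \in ends f by rewrite -E' Ef' set21.
  by rewrite Ef !inE (negbTE ntd) /= => /eqP Et; rewrite -Et tD in x'D.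
Qed.

Lemma component_doubled_path x y a :
  x != y -> a \notin [set x; y] ->
  doubled_path (component (off [set x; y]) a :|: [set x; y]) x y.
Proof.
move=> nxy aN; set D := component _ _.
have sD : D \subset ~: [set x; y].
  apply/subsetP => t; rewrite inE => /(connect_inv (f := fun z => z \in ~: [set x; y])) H.
  by rewrite -H ?in_setC // => u v /and3P[_]; rewrite !in_setC => -> ->.
have xD : [disjoint [set x] & D].
  by rewrite disjoints_subset sub1set inE; apply/negP => /(subsetP sD); rewrite !inE eqxx.
have yD : [disjoint [set y] & D].
  by rewrite disjoints_subset sub1set inE; apply/negP => /(subsetP sD); rewrite !inE eqxx orbT.
apply: (@fragment_doubled_path _ x y [set x] [set y] D x y).
- by rewrite !set11.
- by apply/set0Pn; exists a; rewrite inE connect0.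
- split; [exact: connected_set1|exact: connected_set1|].
  by apply: component_connected => u v /and3P[].
- by split=> //; rewrite disjoints_subset sub1set !inE.
- by rewrite setUC.
- move=> t s tD ts; have [|sN] := boolP (s \in [set x; y]).
    by rewrite !inE => /pred2P[]->; [constructor 2|constructor 3].
  have tN : t \notin [set x; y] by rewrite -in_setC (subsetP sD).
  constructor 1; rewrite inE; rewrite inE in tD; apply: connect_trans tD (connect1 _).
  exact/and3P.
Qed.

Definition quad (T : Type) (b0 b1 b2 b3 : T) (n : nat) : T :=
  match n with 0 => b0 | 1 => b1 | 2 => b2 | _ => b3 end.

Lemma conn_off_pair (G0 : mgraph) x y :
  minor G0 G -> ~ minor G0 (Cmult [:: 2; 2; 2; 2]) -> x != y ->
  conn_off [set x; y].
Proof.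
move=> mG nC nxy a b aN bN; apply/idPn => nab; apply: nC.
have [X1 [Y1 [D1 [[xX1 yY1 n1] [cX1 cY1 cD1] [dXY1 dXD1 dYD1] sU1 [eX1 eY1]]]]] :=
  component_doubled_path nxy aN.
have [X2 [Y2 [D2 [[xX2 yY2 n2] [cX2 cY2 cD2] [dXY2 dXD2 dYD2] sU2 [eX2 eY2]]]]] :=
  component_doubled_path nxy bN.
have no_both t : t \in component (off [set x; y]) a -> t \in component (off [set x;
  y]) b -> false.
  rewrite !inE => at' bt; case/negP: nab; apply: connect_trans at' _.
  by rewrite connect_off_sym.
have sub (U X Y D : {set vert G}) t : X :|: Y :|: D \subset U ->
  [|| t \in X, t \in Y | t \in D] -> t \in U.
  by move=> sU H; apply: (subsetP sU); rewrite !inE -orbA.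
have inU t : [|| t \in X1, t \in Y1 | t \in D1] -> [|| t \in X2, t \in Y2 | t \in D2] ->
    t = x \/ t = y.
  move=> /(sub _ _ _ _ _ sU1) /setUP[t1|/set2P //] /(sub _ _ _ _ _ sU2) /setUP[t2|/set2P //].
  by case: (notF (no_both _ t1 t2)).
have disj (X Y : {set vert G}) t : [disjoint X & Y] -> t \in X -> t \in Y -> false.
  by move=> d tX tY; rewrite (disjointFr d tX) in tY.
(* The two doubled paths lie on different sides and are glued at [x] and at [y]; the list follows
   the cyclic order of 2C_4. *)
pose B (i : 'I_4) := quad (X1 :|: X2) D1 (Y1 :|: Y2) D2 i.
apply: (@branch_sets_minor _ _ G0 G B) => //.
- by move=> -[[|[|[|[|//]]]] i] -[[|[|[|[|//]]]] j].
- move=> -[[|[|[|[|//]]]] i] //; first by apply/set0Pn; exists x; rewrite inE xX1.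
  by apply/set0Pn; exists y; rewrite inE yY1.
- by move=> -[[|[|[|[|//]]]] i] //;
  [exact: connected_setU cX1 cX2 xX1 xX2|exact: connected_setU cY1 cY2 yY1 yY2].
- move=> w w' t; suff H (i j : 'I_4) : t \in B i -> t \in B j -> i < j -> False.
    move=> ti tj; case: (ltngtP w w') => [ij|ji|/val_inj //].
      by case: (H _ _ ti tj ij).
    by case: (H _ _ tj ti ji).
  have dF (X Y : {set vert G}) : [disjoint X & Y] -> (t \in X) && (t \in Y) = false.
    by move=> d; apply/negP => /andP[tX tY]; have := disj _ _ _ d tX tY.
  have := inU t; have := (dF _ _ dXY1, dF _ _ dXD1, dF _ _ dYD1).
  have := (dF _ _ dXY2, dF _ _ dXD2, dF _ _ dYD2).
  have txy : t = x \/ t = y -> (t \in X1) && (t \in X2) || (t \in Y1) && (t \in Y2).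
    by case=> ->; rewrite ?xX1 ?xX2 ?yY1 ?yY2 ?orbT.
  move=> E2 E1 /(_ _ _)/txy; move: E1 E2.
  case: i => -[|[|[|[|//]]]] ?; case: j => -[|[|[|[|//]]]] ? //; rewrite /B /= ?inE;
  case: (t \in X1); case: (t \in X2); case: (t \in Y1); case: (t \in Y2);
  case: (t \in D1); case: (t \in D2) => -[[e1 e2] e3] [[e4 e5] e6] H; try discriminate;
  by move=> // _ _ _; have := H isT isT.
- move=> -[[|[|[|[|//]]]] i] -[[|[|[|[|//]]]] j] //; rewrite /B /=.
  + rewrite edges_betweenC; apply: leq_trans eX1 _.
    by apply/subset_leq_card/edges_betweenS; rewrite // subsetUl.
  + apply: leq_trans eY1 _.
    by apply/subset_leq_card/edges_betweenS; rewrite // subsetUl.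
  + rewrite edges_betweenC; apply: leq_trans eY2 _.
    by apply/subset_leq_card/edges_betweenS; rewrite // subsetUr.
  + apply: leq_trans eX2 _.
    by apply/subset_leq_card/edges_betweenS; rewrite // subsetUr.
Qed.
End Separation.

(** * Triconnected graphs *)

(** A quantifier over bit strings that evaluates; for [n = 10] it runs through all graphs on five
    labelled vertices. *)
Fixpoint all_bits (n : nat) (P : seq bool -> bool) : bool :=
  if n is m.+1 then all_bits m (fun s => P (true :: s)) && all_bits m (fun s => P (false :: s))
  else P [::].

Lemma all_bitsP n P s : all_bits n P -> size s = n -> P s.
Proof.
elim: s n P => [|b s IH] [|n] P //= /andP[Ht Hf] [sz].
by case: b; [exact: (IH _ _ Ht)|exact: (IH _ _ Hf)].
Qed.

Definition pairs5 : seq (nat * nat) :=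
  [:: (0, 1); (0, 2); (0, 3); (0, 4); (1, 2); (1, 3); (1, 4); (2, 3); (2, 4); (3, 4)].

Definition triples5 : seq (nat * nat * nat) :=
  [seq t <- [seq (ij, k) | ij <- [seq (i, j) | i <- iota 0 5, j <- iota 0 5], k <- iota 0 5] |
    uniq [:: t.1.1; t.1.2; t.2]].

Definition symb (bt : nat -> nat -> bool) (i j : nat) : bool :=
  if i < j then bt i j else bt j i.

Definition wheel_at (bt : nat -> nat -> bool) (p : seq nat) : bool :=
  let a i j := symb bt (nth 0 p i) (nth 0 p j) in
  [&& a 0 1, a 0 2, a 0 3, a 0 4, a 1 2, a 2 3, a 3 4 & a 4 1].

(** The 15 copies of W_4 on five labelled vertices, hub first: five hubs, and three cyclic orders of
    the rim for each. *)
Definition wheel_orders : seq (seq nat) :=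
 [:: [:: 0; 1; 2; 3; 4];
  [:: 0; 1; 2; 4; 3];
  [:: 0; 1; 3; 2; 4];
  [:: 1; 0; 2; 3; 4];
  [:: 1; 0; 2; 4; 3];
  [:: 1; 0; 3; 2; 4];
  [:: 2; 0; 1; 3; 4];
  [:: 2; 0; 1; 4; 3];
  [:: 2; 0; 3; 1; 4];
  [:: 3; 0; 1; 2; 4];
  [:: 3; 0; 1; 4; 2];
  [:: 3; 0; 2; 1; 4];
  [:: 4; 0; 1; 2; 3];
  [:: 4; 0; 1; 3; 2];
  [:: 4; 0; 2; 1; 3]].

(** No vertex has two non-neighbours. In a 3-connected graph on five vertices any three vertices
    induce a connected graph, which gives this. *)
Definition dense5 (bt : nat -> nat -> bool) : bool :=
  all (fun t : nat * nat * nat => symb bt t.1.1 t.1.2 || symb bt t.1.1 t.2) triples5.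

(* The complement of such a graph has maximum degree at most one, so by parity
   it misses some vertex, the hub. *)
Lemma dense5_wheel (bt : nat -> nat -> bool) :
  dense5 bt -> has (wheel_at bt) wheel_orders.
Proof.
pose of_bits (s : seq bool) i j := nth false s (index (i, j) pairs5).
have check : all_bits 10 (fun s => dense5 (of_bits s) ==>
    has (wheel_at (of_bits s)) wheel_orders) by [].
pose s := [seq bt p.1 p.2 | p <- pairs5].
move=> d; have /implyP := all_bitsP (s := s) check erefl; exact.
Qed.

Definition triconnected (G : mgraph) : Prop :=
  forall X : {set vert G}, #|X| <= 2 -> conn_off X.

Section Tutte.
Variable G : mgraph.
Hypothesis triG : triconnected G.
Implicit Types x y z : vert G.

Lemma triconnected_pair x y : conn_off [set x; y].
Proof. by apply: triG; rewrite cards2; case: eqP. Qed.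

(** If the component of [c] had no neighbour of [z], then [x] and [y] alone would separate it from
    [b]. *)
Lemma triconnected_exit x y z c b :
  c \notin [set x; y; z] -> b \notin [set x; y; z] ->
  ~~ connect (off [set x; y; z]) c b ->
  exists2 u, connect (off [set x; y; z]) c u & adj predT u z.
Proof.
move=> cN bN ncb; pose C t := connect (off [set x; y; z]) c t.
have [/existsP[u /andP[cu uz]]|] := boolP [exists u, C u && adj predT u z].
  by exists u.
rewrite negb_exists => /forallP H; case/negP: ncb.
have sub t : t \notin [set x; y; z] -> t \notin [set x; y].
  by apply: contra; rewrite !inE => ->.
have CN t : C t -> t \notin [set x; y; z].
  move/(connect_inv (f := fun t => t \notin [set x; y; z])) => <- // a a' /and3P[_].
  by move=> -> ->.
have step t t' : off [set x; y] t t' -> C t -> C t'.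
  case/and3P=> tt' _ t'N Ct; apply: connect_trans (Ct) (connect1 _).
  apply/and3P; split=> //; first exact: CN.
  rewrite in_setU negb_or t'N inE /=.
  by apply: contraTneq tt' => ->; have := H t; rewrite Ct.
have := @triconnected_pair x y c b (sub _ cN) (sub _ bN).
move/(connect_inv (f := C)) => E; rewrite -/(C b) -E ?/C ?connect0 // => t t' tt'.
by apply/idP/idP; apply: step; rewrite // off_sym.
Qed.

(* Thomassen's argument: a smallest component [C] left by the removal of the ends
   of an edge [xy] and a third vertex [z] contains a neighbour [u] of [z]; if
   [zu] is not contractible either, it yields a smaller component. *)
Lemma contractible_edge x0 y0 :
  x0 != y0 -> adj predT x0 y0 ->
  exists x y, [/\ x != y, adj predT x y & forall z, conn_off [set x; y; z]].
Proof.
move=> n0 a0; apply: NNPP => H.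
have NC x y : x != y -> adj predT x y -> exists z a b,
    [/\ a \notin [set x; y; z], b \notin [set x; y; z] &
        ~~ connect (off [set x; y; z]) a b].
  move=> nxy xy; apply: NNPP => H'; apply: H; exists x, y; split=> // z a b aN bN.
  by apply/idPn => nab; apply: H'; exists z, a, b.
suff small n x y z c b : x != y -> adj predT x y ->
    c \notin [set x; y; z] -> b \notin [set x; y; z] ->
    ~~ connect (off [set x; y; z]) c b ->
    #|component (off [set x; y; z]) c| < n -> False.
  have [z [a [b [aN bN nab]]]] := NC _ _ n0 a0.
  exact: (small _ _ _ _ _ _ n0 a0 aN bN nab (ltnSn _)).
elim: n x y z c b => // n IH x y z c b nxy xy cN bN ncb ltn.
set C := component _ _ in ltn.
have CN t : t \in C -> t \notin [set x; y; z].
  rewrite inE => /(connect_inv (f := fun t => t \notin [set x; y; z])) <- // s s' /and3P[_].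
  by move=> -> ->.
have [u cu uz] := triconnected_exit cN bN ncb.
have uC : u \in C by rewrite inE.
have nzu : z != u.
  by apply: contraNneq (CN _ uC) => <-; rewrite !inE eqxx orbT.
have zu : adj predT z u by rewrite adj_sym.
have [w [a [a' [aN a'N naa']]]] := NC _ _ nzu zu.
(* [x] and [y] are adjacent, so they cannot lie in two different components; one of the components
   of [a] and [a'] avoids both. *)
have [d [d' [dN d'N ndd' [xD yD]]]] : exists d d',
    [/\ d \notin [set z; u; w], d' \notin [set z; u; w],
        ~~ connect (off [set z; u; w]) d d' &
        ~~ connect (off [set z; u; w]) d x /\ ~~ connect (off [set z; u; w]) d y].
  have naa2 : ~~ connect (off [set z; u; w]) a' a by rewrite connect_off_sym.
  have sep s t : connect (off [set z; u; w]) a s -> connect (off [set z; u; w]) a' t ->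
      off [set z; u; w] s t || (s == t) -> False.
    move=> as_ a't st; case/negP: naa'; apply: connect_trans as_ _.
    rewrite connect_off_sym; apply: connect_trans a't _; rewrite connect_off_sym.
    by case/orP: st => [/connect1//|/eqP->].
  have notin s t : s \notin [set z; u; w] -> connect (off [set z; u; w]) s t ->
      t \notin [set z; u; w].
    move=> sN /(connect_inv (f := fun t => t \notin [set z; u; w])) <- // r r' /and3P[_].
    by move=> -> ->.
  have sep2 s t : connect (off [set z; u; w]) a s -> connect (off [set z; u; w]) a' t ->
      adj predT s t || (s == t) -> False.
    move=> as_ a't st; apply: (sep _ _ as_ a't); case/orP: st => [st|->]; last by rewrite orbT.
    by rewrite /off st (notin _ _ aN as_) (notin _ _ a'N a't).
  have [ax|ax] := boolP (connect (off [set z; u; w]) a x).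
    exists a', a; split=> //; split; apply/negP => cc.
      by apply: (sep2 _ _ ax cc); rewrite eqxx orbT.
    by apply: (sep2 _ _ ax cc); rewrite xy.
  have [ay|ay] := boolP (connect (off [set z; u; w]) a y).
    exists a', a; split=> //; split; apply/negP => cc.
      by apply: (sep2 _ _ ay cc); rewrite adj_sym xy.
    by apply: (sep2 _ _ ay cc); rewrite eqxx orbT.
  by exists a, a'.
pose D := component (off [set z; u; w]) d.
have DN t : t \in D -> t \notin [set z; u; w].
  rewrite inE => /(connect_inv (f := fun t => t \notin [set z; u; w])) <- // s s' /and3P[_].
  by move=> -> ->.
have Dxyz t : t \in D -> t \notin [set x; y; z].
  move=> tD; rewrite !inE !negb_or; apply/andP; split; last first.
    by apply: contraTneq (DN _ tD) => ->; rewrite !inE eqxx.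
  by rewrite inE in tD; apply/andP; split; [apply: contraNneq xD|apply: contraNneq yD] => <-.
have perm : [set z; u; w] = [set z; w; u] by rewrite setUAC.
have [t dt tu] : exists2 t, connect (off [set z; u; w]) d t & adj predT t u.
  by rewrite perm; rewrite perm in dN d'N ndd'; apply: triconnected_exit dN d'N ndd'.
have tD : t \in D by rewrite inE.
(* [D] avoids [x], [y], [z] and contains the neighbour [t] of [u], so it lies in [C]; it does not
   contain [u] and is therefore smaller. *)
have tC : t \in C.
  rewrite inE; apply: connect_trans cu (connect1 _); apply/and3P.
  by rewrite adj_sym; split; [|exact: CN|exact: Dxyz].
have sDC : D \subset C.
  apply/subsetP => s sD; rewrite inE; rewrite inE in tC; apply: connect_trans tC _.
  have cD : connected_set D by apply: component_connected => ? ? /and3P[].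
  apply: connect_sub (cD _ _ tD sD) => p q /and3P[pq pD qD]; apply/connect1/and3P.
  by split; [|exact: Dxyz|exact: Dxyz].
apply: (IH z u w d d') => //; rewrite -ltnS (leq_trans _ ltn) // ltnS proper_card //.
rewrite properE sDC; apply/subsetPn; exists u => //.
by apply/negP => /DN; rewrite !inE eqxx orbT.
Qed.

End Tutte.

(** The preimage of [X] has at most two vertices, or it consists of [u], [v] and at most one more
    vertex. *)
Lemma merge_triconnected (G : mgraph) (u v : vert G) (e : edge G) (nvu : v != u) :
  ends e = [set v; u] -> triconnected G -> (forall z, conn_off [set v; u; z]) ->
  triconnected (merge e nvu).
Proof.
move=> Ee tri cvu X leX; apply: (merge_conn_off Ee).
set pr := merge_proj nvu.
have [vX|vX] := boolP (pr v \in X); last first.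
  apply: tri; rewrite -(card_imset _ val_inj) in leX; apply: leq_trans leX.
  apply/subset_leq_card/subsetP => x; rewrite inE => xX; apply/imsetP; exists (pr x) => //.
  rewrite val_merge_proj; case: (x =P u) => // xu.
  by move: xX vX; rewrite xu /pr merge_proj_uv => ->.
have -> : pr @^-1: X = [set u; v] :|: pr @^-1: (X :\ pr v).
  by rewrite -{1}(setD1K vX) preimsetU (@merge_preim1 _ _ _ e nvu) eqxx.
have : #|X :\ pr v| <= 1 by rewrite -ltnS; rewrite (cardsD1 (pr v)) vX in leX.
have [->|/set0Pn[q qX] le1] := eqVneq (X :\ pr v) set0.
  by rewrite preimset0 setU0 setUC => _; have := cvu v; rewrite setUAC setUid setUC.
have -> : X :\ pr v = [set q].
  by apply/eqP; rewrite eq_sym eqEcard sub1set qX cards1.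
rewrite (@merge_preim1 _ _ _ e nvu); case: ifP => _.
  by rewrite setUid setUC; have := cvu v; rewrite setUAC setUid setUC.
by rewrite [[set u; v]]setUC; apply: cvu.
Qed.

Lemma connected_has_link (G : mgraph) :
  1 < #|vert G| -> conn_off (set0 : {set vert G}) ->
  exists x y : vert G, x != y /\ adj predT x y.
Proof.
case/card_gt1P=> a [b [_ _ nab]] c0; apply: NNPP => H.
have cab := c0 a b; rewrite !inE in cab.
case/eqP: nab; apply: (connect_inv (f := id)) (cab isT isT) => x y /and3P[xy _ _].
by apply/eqP/idPn => nxy; apply: H; exists x, y.
Qed.

Lemma triconnected5_wheel (G : mgraph) :
  #|vert G| = 5 -> triconnected G -> subgraph (wheel 4) G.
Proof.
move=> c5 tri; have [x0 _] : exists x0 : vert G, x0 \in vert G by apply/card_gt0P; rewrite c5.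
have sz : size (enum (vert G)) = 5 by rewrite -cardE.
pose f i := nth x0 (enum (vert G)) i.
have f_eq i j : i < 5 -> j < 5 -> (f i == f j) = (i == j).
  by move=> i5 j5; rewrite nth_uniq ?sz ?enum_uniq.
pose bt i j := adj predT (f i) (f j).
have symE i j : symb bt i j = bt i j by rewrite /symb /bt adj_sym if_same.
have d5 : dense5 bt.
  have /allP ok : all (fun t : nat * nat * nat =>
      [&& t.1.1 < 5, t.1.2 < 5, t.2 < 5 & uniq [:: t.1.1; t.1.2; t.2]]) triples5 by [].
  apply/allP => -[[i l] m] /ok /and4P[/= i5 l5 m5]; rewrite !inE !negb_or andbT.
  case/andP=> /andP[nil nim] nlm; rewrite !symE.
  pose X := ~: [set f i; f l; f m].
  have inX t : (t \notin X) = [|| t == f i, t == f l | t == f m] by rewrite !inE negbK orbA.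
  have cX : #|X| <= 2.
    rewrite cardsCs setCK c5 leq_subLR.
    have -> : [set f i; f l; f m] = f i |: [set f l; f m] by rewrite setUA.
    by rewrite cardsU1 cards2 !inE negb_or !f_eq // nil nim nlm.
  have := tri X cX (f i) (f l); rewrite !inX !eqxx orbT => /(_ isT isT).
  apply: contraTT; rewrite negb_or => /andP[nl nm]; apply/negP => cil.
  have : (f i == f i) = (f l == f i).
    apply: (connect_inv (f := fun t => t == f i) _ cil) => x y /and3P[xy].
    have main z z' : adj predT z z' -> z' \notin X -> z == f i -> z' == f i.
      rewrite inX => zz' /or3P[//|/eqP E|/eqP E] /eqP E'.
        by case/negP: nl; rewrite /bt -E -E'.
      by case/negP: nm; rewrite /bt -E -E'.
    move=> xX yX; apply/idP/idP; first exact: main.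
    by apply: main; rewrite // adj_sym.
  by rewrite eqxx f_eq // eq_sym (negbTE nil).
have /hasP[p pw] := dense5_wheel d5.
have /allP ok : all (fun p => [&& size p == 5, uniq p & all (fun i =>
  i < 5) p]) wheel_orders by [].
have /and3P[/eqP p5 up /allP p_lt] := ok _ pw.
rewrite /wheel_at !symE => /and5P[a01 a02 a03 a04 /and4P[a12 a23 a34 a41]].
have lt i : i < 5 -> nth 0 p i < 5 by move=> i5; apply: p_lt; rewrite mem_nth ?p5.
pose h (x : option 'I_4) : vert G := f (nth 0 p (if x is Some i then i.+1 else 0)).
apply: (@mult_graph_subgraph _ _ _ h).
- move=> x y /eqP.
  have ltx (z : option 'I_4) : (if z is Some i then i.+1 else 0) < 5 by case: z => [i|//];
    rewrite ltnS.
  rewrite /h f_eq ?lt // nth_uniq ?p5 //.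
  by case: x y => [i|] [j|] //= /eqP[/val_inj->].
- move=> [i|] [j|] //=; case: i => -[|[|[|[|//]]]] ?; case: j => -[|[|[|[|//]]]] ? //.
- have pos i j : bt (nth 0 p i) (nth 0 p j) -> 0 < mult (f (nth 0 p i)) (f (nth 0 p j)).
    by rewrite mult_gt0.
  move=> [i|] [j|] //=; rewrite ?/h.
    case: i => -[|[|[|[|//]]]] ?; case: j => -[|[|[|[|//]]]] ? //=; exact: pos.
  by case: j => -[|[|[|[|//]]]] ?; apply: pos.
Qed.

Lemma triconnected_wheel (G0 G : mgraph) :
  4 < #|vert G| -> triconnected G -> minor G0 G -> minor G0 (wheel 4).
Proof.
have [n] := ubnP #|vert G|; elim: n G => // n IH G ltn.
rewrite leq_eqVlt => /predU1P[/esym c5|c6] tri mG.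
  exact: minor_subgraph mG (triconnected5_wheel c5 tri).
have [||x0 [y0 [n0 a0]]] := @connected_has_link G.
- exact: leq_trans c6.
- by apply: tri; rewrite cards0.
have [x [y [nxy /adjP[e _ Ee] cxy]]] := contractible_edge tri n0 a0.
apply: (IH (merge e nxy)).
- by rewrite card_merge -ltnS (leq_trans _ ltn) // prednK // (leq_trans _ c6).
- by rewrite card_merge -ltnS prednK // (leq_trans _ c6).
- exact: merge_triconnected Ee tri cxy.
- exact: (@merge_minor _ _ _ _ nxy Ee _ mG).
Qed.

(** * The structure of blocks *)

Section Inseparable.
Variable G : mgraph.
Hypotheses (insG : inseparable G) (coverG : forall x : vert G, exists e, x \in ends e).

(* If [a] and [b] were in different components off [X], the edges of a common
   circle that meet the component of [a] would form a proper subcycle. *)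
Lemma inseparable_conn_off (X : {set vert G}) : #|X| <= 1 -> conn_off X.
Proof.
move=> X1 a b aX bX; have [ea ae] := coverG a; have [eb be] := coverG b.
have [Ee|nee] := eqVneq ea eb.
  have [->|nab] := eqVneq a b; first exact: connect0.
  apply/connect1/and3P; split=> //; apply/adjP; exists ea => //.
  apply/eqP; rewrite eq_sym eqEcard subUset !sub1set ae Ee be /ends !cards2 nab.
  by case: (_ != _).
have [C [cC aC bC]] := insG nee.
pose K x := connect (off X) a x.
have KN x : K x -> x \notin X.
  move/(connect_inv (f := fun x => x \notin X)) => <- // t t' /and3P[_].
  by move=> -> ->.
have Kstep x y : adj predT x y -> K x -> y \notin X -> K y.
  move=> xy Kx yX; apply: connect_trans (Kx) (connect1 _).
  by apply/and3P; split=> //; apply: KN.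
pose CK := [set e in C | K (src e) || K (tgt e)].
have sCK : CK \subset C by apply/subsetP => e; rewrite inE => /andP[].
have in_CK x e : e \in C -> x \in ends e -> K x -> e \in CK.
  by rewrite !inE => -> /pred2P[]-> ->; rewrite ?orbT.
have cCK : cyc CK.
  (* [k] is the sign of the only vertex that [X] may have. Shifted by [k] on the component and zero
     elsewhere, [ps'] has on [C] the coboundary that [ps] has on [CK]. *)
  move=> ps; pose k : sign := if [pick v in X] is Some v then ps v else false.
  have kE v : v \in X -> ps v = k.
    move=> vX; rewrite /k; case: pickP => [v' v'X|/(_ v)]; last by rewrite vX.
    by congr ps; apply: (card_le1_eqP X1).
  pose ps' x : sign := if K x then ps x (+) k else false.
  rewrite -(circle_cyc cC ps') !parityE; apply: eq_bigr => e _.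
  rewrite inE; case: (e \in C) => //=; rewrite /cobd /ps'.
  have st : adj predT (src e) (tgt e) by apply: adj_edge.
  have [Ks|nKs] := boolP (K (src e)); have [Kt|nKt] := boolP (K (tgt e)) => //=.
  - by rewrite addbACA addbb addbF.
  - have tX : tgt e \in X by apply: contraR nKt; apply: Kstep st Ks.
    by rewrite (kE _ tX) addbF.
  - rewrite adj_sym in st.
    have sX : src e \in X by apply: contraR nKs; apply: Kstep st Kt.
    by rewrite (kE _ sX) addbC.
have aCK : ea \in CK by apply: in_CK ae _ => //; apply: connect0.
have ECK := circle_sub_cyc cC sCK cCK aCK.
move: bC; rewrite -ECK inE => /andP[_]; have := adj_edge (P := predT) (e := eb) isT.
move=> st; move: be; rewrite !inE => /pred2P[]E; rewrite -E in st *.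
  by case/orP=> // Kt; apply: Kstep _ Kt bX; rewrite adj_sym.
by case/orP=> // Ks; apply: Kstep _ Ks bX.
Qed.

(** A loop is a circle by itself, so no circle contains it together with another edge. *)
Lemma inseparable_cases (e0 : edge G) : isomorphic G K1loop \/ biconnected G.
Proof.
have [[e le]|nl] := classic (exists e : edge G, src e = tgt e); [left|right].
  have cyc1 : cyc [set e] by move=> ps; rewrite /parity big_set1 /cobd le addbb.
  have only f : f = e.
    apply/eqP/idPn => nfe; have nef : e != f by rewrite eq_sym.
    have [C [cC eC fC]] := insG nef.
    have E : [set e] = C.
      by apply: (circle_sub_cyc (e := e) cC); rewrite ?sub1set ?set11.
    by move: fC; rewrite -E inE (negbTE nfe).
  pose l0 : edge K1loop := @existT _ (fun p : unit * unit => 'I_1) (tt, tt) ord0.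
  have l0E l : l = l0 by case: l => -[[] []] i; congr existT; rewrite [i]ord1.
  have sE x : x = src e.
    by have [f] := coverG x; rewrite (only f) !inE -le orbb => /eqP.
  exists (fun=> tt), (fun=> l0); split.
  - by exists (fun=> src e) => [x|[]]; [exact/esym/sE|].
  - by exists (fun=> e) => [f|l]; [exact/esym/only|exact/esym/l0E].
  - by move=> f; rewrite /ends imset_set2.
have nle (e : edge G) : src e != tgt e by apply/eqP => E; apply: nl; exists e.
split=> //.
- apply/card_gt1P; exists (src e0), (tgt e0); split=> //; exact: nle.
- by apply: inseparable_conn_off; rewrite cards0.
- by move=> v; apply: inseparable_conn_off; rewrite cards1.
Qed.
End Inseparable.

Lemma adj_of_conn_off (G : mgraph) (X : {set vert G}) (a b : vert G) :
  conn_off X -> a \notin X -> b \notin X -> a != b ->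
  (forall t, t \notin X -> t = a \/ t = b) -> adj predT a b.
Proof.
move=> cX aX bX nab only; case: (boolP (adj predT a b)) => // nadj.
have : (a == a) = (b == a).
  apply: (connect_inv (f := fun t => t == a) _ (cX _ _ aX bX)) => x y /and3P[xy xX yX].
  have main z z' : adj predT z z' -> z' \notin X -> z == a -> z' == a.
    move=> zz' z'X /eqP E'; case: (only _ z'X) => [->//|E].
    by move: nadj; rewrite -E -E' zz'.
  by apply/idP/idP; apply: main; rewrite // adj_sym.
by rewrite eqxx eq_sym (negbTE nab).
Qed.

Definition minor_free (G : mgraph) : Prop :=
  [/\ ~ minor G (Cmult [:: 3; 3; 2]), ~ minor G (Cmult [:: 2; 2; 2; 2]),
      ~ minor G K4dd & ~ minor G (wheel 4)].

Definition extruded_base (G : mgraph) : Prop :=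
  exists G0 H : mgraph, [/\ base_graph G0, extrusion_of G0 H & isomorphic G H].

Lemma base_extruded (G B : mgraph) : base_graph B -> isomorphic G B -> extruded_base G.
Proof. by move=> bB iB; exists B, B; split=> //; apply: extrusion_zero. Qed.

Lemma two_vertices (G : mgraph) : #|vert G| = 2 -> biconnected G -> extruded_base G.
Proof.
move=> c2 [nl _ c0 _].
have [a [b [nab abT]]] : exists a b : vert G, a != b /\ forall t, t = a \/ t = b.
  have := mem_enum (vert G); have := enum_uniq (vert G); have := cardE (vert G).
  rewrite c2; case: (enum _) => [|a [|b [|]]] // _ /andP[+ _] mem; rewrite inE => nab.
  by exists a, b; split=> // t; have := mem t; rewrite !inE => /pred2P.
have aab : adj predT a b.
  by apply: (adj_of_conn_off c0); rewrite ?inE.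
apply: (base_extruded (base_mK2 (m := mult a b) _)); first by rewrite mult_gt0.
apply: (@mult_graph_isomorphic _ _ _ (fun x : bool => if x then b else a)) => //.
- by case=> -[] // E; move: nab; rewrite E eqxx.
- by case=> -[].
- by case=> -[].
- by move=> t; case: (abT t) => ->; [exists false|exists true].
- by case=> -[] //= _; rewrite ?addn0 // multC.
Qed.

Section Three.
Variable G : mgraph.
Hypotheses (bcG : biconnected G) (irG : irreducible G).

(** Irreducibility makes all three pairs at least double, and C_3(3,3,2) forbids two pairs with
    three edges or more. *)
Lemma three_vertices (G0 : mgraph) : #|vert G| = 3 -> minor_free G0 -> minor G0 G ->
  extruded_base G.
Proof.
move=> c3 [nC332 _ _ _] mG; have [nl _ _ c1] := bcG.
have [a [b [c [u3 memT]]]] : exists a b c : vert G, uniq [:: a; b; c] /\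
    forall t, t \in [:: a; b; c].
  have := mem_enum (vert G); have := enum_uniq (vert G); have := cardE (vert G).
  rewrite c3; case: (enum _) => [|a [|b [|c [|]]]] // _ u mem; exists a, b, c.
  by split=> // t; rewrite mem.
have quad_inj (x y z : vert G) : uniq [:: x; y;
  z] -> injective (fun i : 'I_3 => quad x y z z i).
  rewrite /= !inE negb_or andbT => /andP[/andP[xy xz] yz].
  move=> [[|[|[|//]]] i] [[|[|[|//]]] j] //= E; try exact: val_inj;
    by move: xy xz yz; rewrite E ?eqxx.
have ge2 (x y z : vert G) : uniq [:: x; y; z] -> (forall t, t \in [:: x; y; z]) -> 1 < mult x y.
  move=> u mem; have := u; rewrite /= !inE negb_or andbT => /andP[/andP[xy xz] yz].
  have a1 : adj predT x y.
    apply: (@adj_of_conn_off G [set z] x y (c1 z)); rewrite ?inE // => t; rewrite inE => tz.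
    by have := mem t; rewrite !inE (negbTE tz) orbF => /pred2P.
  have a2 : adj predT x z.
    apply: (@adj_of_conn_off G [set y] x z (c1 y)); rewrite ?inE // 1?eq_sym // => t;
      rewrite inE => ty.
    by have := mem t; rewrite !inE (negbTE ty) /= => /pred2P.
  rewrite ltn_neqAle mult_gt0 a1 andbT eq_sym.
  apply: (irG (u := x) (v := y) (w := z)); rewrite 1?eq_sym ?mult_gt0 //.
  move=> t xt; have := mem t; rewrite !inE => /or3P[/eqP E|/eqP|/eqP]; [|by left|by right].
  by have := loopless_adj nl xt; rewrite E eqxx.
have no33 (x y z : vert G) : uniq [:: x; y; z] -> (forall t, t \in [:: x; y; z]) ->
    2 < mult x y -> 2 < mult y z -> False.
  move=> u mem xy yz; apply: nC332; apply: minor_subgraph mG _.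
  apply: (@mult_graph_subgraph _ _ _ (fun i : 'I_3 => quad x y z z i)).
  - exact: quad_inj u.
  - by move=> [[|[|[|//]]] i] [[|[|[|//]]] j].
  - move=> [[|[|[|//]]] i] [[|[|[|//]]] j] //=.
    apply: (ge2 z x y); first by rewrite -(rot_uniq 1).
    by move=> t; have := mem t; rewrite -(mem_rot 2).
suff [x [y [z [u mem yz zx]]]] : exists x y z : vert G, [/\ uniq [:: x; y; z],
    forall t, t \in [:: x; y; z], mult y z = 2 & mult z x = 2].
  have := ge2 _ _ _ u mem => m2.
  apply: (base_extruded (base_C3 m2)).
  apply: (@mult_graph_isomorphic _ _ _ (fun i : 'I_3 => quad x y z z i)) => //.
  - exact: quad_inj u.
  - by move=> [[|[|[|//]]] i] [[|[|[|//]]] j].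
  - by move=> [[|[|[|//]]] i] [[|[|[|//]]] j] //=; rewrite ?yz ?zx.
  - move=> t; have := mem t; rewrite !inE => /or3P[]/eqP->.
    + by exists (ord3 0).
    + by exists (ord3 1).
    + by exists (ord3 2).
  - by move=> [[|[|[|//]]] i] [[|[|[|//]]] j] //= _;
      rewrite ?addn0 ?add0n ?yz ?zx // multC ?yz ?zx.
have rot1 (x y z : vert G) : uniq [:: x; y; z] /\ (forall t, t \in [:: x; y; z]) ->
    uniq [:: y; z; x] /\ (forall t, t \in [:: y; z; x]).
  by case=> u mem; split; [rewrite -(rot_uniq 2)|move=> t; have := mem t; rewrite -(mem_rot 1)].
have eq2 (x y z : vert G) : uniq [:: x; y; z] /\ (forall t, t \in [:: x; y; z]) ->
    2 < mult x y -> mult y z = 2 /\ mult z x = 2.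
  move=> p xy; have p1 := rot1 _ _ _ p; have p2 := rot1 _ _ _ p1.
  case: p p1 p2 => u mem [u1 mem1] [u2 mem2]; split; apply/eqP; rewrite eqn_leq leqNgt.
    rewrite (ge2 _ _ _ u1 mem1) andbT; apply/negP => yz; exact: (no33 _ _ _ u mem).
  rewrite (ge2 _ _ _ u2 mem2) andbT; apply/negP => zx; exact: (no33 _ _ _ u2 mem2).
have p0 : uniq [:: a; b; c] /\ (forall t, t \in [:: a; b; c]) by [].
have p1 := rot1 _ _ _ p0; have p2 := rot1 _ _ _ p1.
have [ab|ab] := ltnP 2 (mult a b).
  by have [bc ca] := eq2 _ _ _ p0 ab; exists a, b, c.
have [bc|bc] := ltnP 2 (mult b c).
  by have [ca ab'] := eq2 _ _ _ p1 bc; exists b, c, a; case: p1.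
case: p0 p1 p2 => u0 m0 [u1 m1] [u2 m2]; exists c, a, b; split=> //.
  by apply/eqP; rewrite eqn_leq ab (ge2 _ _ _ u0 m0).
by apply/eqP; rewrite eqn_leq bc (ge2 _ _ _ u1 m1).
Qed.
End Three.

Section Four.
Variable G : mgraph.
Hypotheses (bcG : biconnected G) (irG : irreducible G).

(** Two vertices are adjacent because the other two do not separate them. A multiple edge forces all
    pairs that share one vertex with it to be single, so at most the opposite pair is multiple as
    well. *)
Lemma four_vertices (G0 : mgraph) :
  #|vert G| = 4 -> minor_free G0 -> minor G0 G -> extruded_base G.
Proof.
move=> c4 [_ nC4 nK4 _] mG; have [nl _ _ c1] := bcG.
have [a0 [b0 [c0 [d0 [u0 mem0]]]]] : exists a b c d : vert G, uniq [:: a; b; c; d] /\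
    forall t, t \in [:: a; b; c; d].
  have := mem_enum (vert G); have := enum_uniq (vert G); have := cardE (vert G).
  rewrite c4; case: (enum _) => [|a [|b [|c [|d [|]]]]] // _ u mem; exists a, b, c, d.
  by split=> // t; rewrite mem.
pose lab (a b c d : vert G) := uniq [:: a; b; c; d].
have labT (a b c d : vert G) : lab a b c d -> forall t, t \in [:: a; b; c; d].
  move=> u t; have : [:: a; b; c; d] =i [:: a0; b0; c0; d0].
    by have [] := uniq_min_size u (s2 := [:: a0; b0; c0; d0]) (fun t _ => mem0 t).
  by move->; apply: mem0.
have neqs (a b c d : vert G) : lab a b c d ->
    [/\ a != b, a != c, a != d & [/\ b != c, b != d & c != d]].
  by rewrite /lab /= !inE !negb_or -!andbA => /and5P[? ? ? ? /and3P[]].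
have compl (x y : vert G) : x != y -> exists c d, lab x y c d.
  move=> xy; have : #|~: [set x; y]| == 2 by rewrite cardsCs setCK c4 cards2 xy.
  case/cards2P=> c [d [cd E]]; exists c, d; rewrite /lab /= !inE !negb_or xy cd !andbT /=.
  have : c \in ~: [set x; y] by rewrite E set21.
  have : d \in ~: [set x; y] by rewrite E set22.
  by rewrite !inE !negb_or ![c == _]eq_sym ![d == _]eq_sym => /andP[-> ->] /andP[-> ->].
have adjs (a b : vert G) : a != b -> 0 < mult a b.
  move=> nab; have [c [d l]] := compl _ _ nab.
  have T := labT _ _ _ _ l; have [ab ac ad [bc bd cd]] := neqs _ _ _ _ l.
  rewrite mult_gt0; apply: (@adj_of_conn_off G [set c; d] a b).
  - exact: (conn_off_pair bcG irG mG nC4).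
  - by rewrite !inE negb_or ac.
  - by rewrite !inE negb_or bc.
  - by [].
  - move=> t; have := T t; rewrite !inE.
    by case/or4P=> /eqP->; rewrite ?eqxx ?orbT //; [left|right].
have qinj (a b c d : vert G) : lab a b c d -> injective (fun i : 'I_4 => quad a b c d i).
  move=> l; have [ab ac ad [bc bd cd]] := neqs _ _ _ _ l.
  move=> [[|[|[|[|//]]]] i] [[|[|[|[|//]]]] j] //= E; try exact: val_inj;
    by move: ab ac ad bc bd cd; rewrite E ?eqxx.
have swap (a b c d : vert G) : lab a b c d ->
    [/\ lab b a c d, lab a c b d & lab a b d c].
  move=> l; have [ab ac ad [bc bd cd]] := neqs _ _ _ _ l.
  by split; rewrite /lab /= !inE !negb_or ?ab ?ac ?ad ?bc ?bd ?cd 1?eq_sym ?ab ?bc ?cd.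
have no_adjacent (a b c d : vert G) : lab a b c d -> 1 < mult a b -> mult a c = 1.
  move=> l ab2; have [ab ac ad [bc bd cd]] := neqs _ _ _ _ l.
  apply/eqP; rewrite eqn_leq (adjs _ _ ac) andbT leqNgt; apply/negP => ac2.
  apply: nK4; apply: minor_subgraph mG _.
  apply: (@mult_graph_subgraph _ _ _ (fun i : 'I_4 => quad a b c d i)).
  - exact: qinj l.
  - by move=> [[|[|[|[|//]]]] i] [[|[|[|[|//]]]] j].
  - by move=> [[|[|[|[|//]]]] i] [[|[|[|[|//]]]] j] //=; apply: adjs.
suff [a [b [c [d [l [ac ad bc bd]]]]]] : exists a b c d, lab a b c d /\
    [/\ mult a c = 1, mult a d = 1, mult b c = 1 & mult b d = 1].
  have [ab _ _ [_ _ cd]] := neqs _ _ _ _ l.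
  apply: (base_extruded (base_K4 (adjs _ _ ab) (adjs _ _ cd))).
  apply: (@mult_graph_isomorphic _ _ _ (fun i : 'I_4 => quad a b c d i)) => //.
  - exact: qinj l.
  - by move=> [[|[|[|[|//]]]] i] [[|[|[|[|//]]]] j].
  - by move=> [[|[|[|[|//]]]] i] [[|[|[|[|//]]]] j] //=; rewrite ?ac ?ad ?bc ?bd.
  - move=> t; have := labT _ _ _ _ l t; rewrite !inE => /or4P[]/eqP->.
    + by exists (ord4 0).
    + by exists (ord4 1).
    + by exists (ord4 2).
    + by exists (ord4 3).
  - by move=> [[|[|[|[|//]]]] i] [[|[|[|[|//]]]] j] //= _;
      rewrite ?addn0 ?add0n ?ac ?ad ?bc ?bd // multC ?ac ?ad ?bc ?bd.
have [[a [b [nab ab2]]]|no2] := classic (exists a b : vert G, a != b /\ 1 < mult a b).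
  have [c [d l]] := compl _ _ nab; exists a, b, c, d; split=> //.
  have [l1 _ l3] := swap _ _ _ _ l; have [l13 _ _] := swap _ _ _ _ l3.
  have ba2 : 1 < mult b a by rewrite multC.
  split; [exact: no_adjacent l ab2|exact: no_adjacent l3 ab2|
    exact: no_adjacent l1 ba2|exact: no_adjacent l13 ba2].
have one (x y : vert G) : x != y -> mult x y = 1.
  move=> xy; apply/eqP; rewrite eqn_leq (adjs _ _ xy) andbT leqNgt.
  by apply/negP => xy2; apply: no2; exists x, y.
exists a0, b0, c0, d0; split=> //; have [ab ac ad [bc bd cd]] := neqs _ _ _ _ u0.
by split; apply: one.
Qed.
End Four.

(** [G0] stays fixed while [G] shrinks by contraction, so the excluded minors carry over without
    further argument. *)
Lemma biconnected_extruded (G0 G : mgraph) :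
  minor_free G0 -> minor G0 G -> biconnected G -> extruded_base G.
Proof.
move=> free; have [n] := ubnP #|vert G|; elim: n G => // n IH G ltn mG bcG.
have [_ c2 _ _] := bcG; have [nC332 nC4 nK4 nW4] := free.
have [irG|] := classic (irreducible G); last first.
  move=> nirr; have [u [v [w [[nvu nwu nwv] nbr uw uv]]]] : exists u v w : vert G,
      [/\ [/\ v != u, w != u & w != v], forall x, adj predT u x -> x = v \/ x = w,
          0 < mult u w & mult u v = 1].
    apply: NNPP => H; apply: nirr => u v w vu wu wv nbr uw; apply/eqP => uv.
    by apply: H; exists u, v, w.
  have /card_gt0P[e] : 0 < #|between u v| by rewrite -/(mult u v) uv.
  rewrite inE setUC => /eqP Ee.
  have bcH := merge_biconnected nvu nwu nwv Ee nbr uv bcG.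
  have ltH : #|vert (merge e nvu)| < n.
    by rewrite card_merge -ltnS (leq_trans _ ltn) // prednK // (leq_trans _ c2).
  have [B [H [bB xH iH]]] := IH _ ltH (@merge_minor _ _ _ _ nvu Ee _ mG) bcH.
  have [H2 xH2 iH2] := extrusion_of_isomorphic (merge_proj_neq e nvu nwu nwv)
    (moved_edges_neq0 nvu nwv Ee uw) (moved_edges_ends (nvu := nvu))
    (merge_extrude nvu nwu nwv Ee nbr uv) xH iH.
  by exists B, H2.
have [c3|c3] := leqP #|vert G| 2.
  by apply: two_vertices => //; apply/eqP; rewrite eqn_leq c3.
have [c4|c4] := leqP #|vert G| 3.
  by apply: (three_vertices bcG irG _ free mG); apply/eqP; rewrite eqn_leq c4.
have [c5|c5] := leqP #|vert G| 4.
  by apply: (four_vertices bcG irG _ free mG); apply/eqP; rewrite eqn_leq c5.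
case: nW4; apply: (triconnected_wheel c5 _ mG) => X leX.
have [_ _ b0 b1] := bcG.
have [/cards2P[x [y [nxy ->]]]|X2] := boolP (#|X| == 2).
  exact: (conn_off_pair bcG irG mG nC4).
have [/cards1P[x ->]|X1] := boolP (#|X| == 1); first exact: b1.
suff -> : X = set0 by exact: b0.
apply/eqP; rewrite -cards_eq0; by case: #|X| X1 X2 leX => [|[|[|]]].
Qed.

Lemma base_graph_dual_valid (A : groupType) (B : mgraph) :
  base_graph B -> dual_valid A B.
Proof.
case=> [|m _|m _|m m' _ _].
- exact: dual_valid_K1loop.
- exact: dual_valid_mK2.
- exact: dual_valid_C3m22.
- exact: dual_valid_K4mm.
Qed.

Lemma block_extruded (G : mgraph) (F : {set edge G}) :
  minor_free G -> block F -> extruded_base (edge_subgraph F).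
Proof.
move=> free [/set0Pn[e eF] insF _].
have cover x : exists e' : edge (edge_subgraph F), x \in ends e'.
  have /bigcupP[e1 e1F xe1] := valP x.
  exists (Sub e1 e1F); move: xe1; rewrite !inE => /pred2P[] E; apply/orP.
    by left; apply/eqP/val_inj.
  by right; apply/eqP/val_inj.
have [iso|bc] := inseparable_cases insF cover (Sub e eF).
  exact: base_extruded base_K1loop iso.
apply: biconnected_extruded free _ bc.
exact: minor_subgraph (minor_refl G) (edge_subgraph_subgraph F).
Qed.

Theorem theorem6p1 (K : groupType -> Prop) (hKsub : subgroup_closed K)
    (hKZ3 : K Z3) (G : mgraph) :
  [<-> circle_test_valid_for K G;
       [/\ ~ minor G (Cmult [:: 3; 3; 2]),
           ~ minor G (Cmult [:: 2; 2; 2; 2]),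
           ~ minor G K4dd &
           ~ minor G (wheel 4)];
       forall F : {set edge G}, block F ->
         exists G0 H : mgraph,
           [/\ base_graph G0, extrusion_of G0 H &
               isomorphic (edge_subgraph F) H]].
Proof.
tfae=> [ct|free F bF|ext A _ g].
- have dv : dual_valid Z3 G by move=> g; apply/circle_test_dual/ct.
  split=> /dual_valid_minor /(_ dv).
  + exact: Cmult_332_dual_invalid.
  + exact: Cmult_2222_dual_invalid.
  + exact: K4dd_dual_invalid.
  + exact: wheel4_dual_invalid.
- exact: block_extruded.
- apply/circle_test_dual; apply: dual_valid_blocks => F bF.
  have [G0 [H [bG0 xH iH]]] := ext F bF.
  apply: dual_valid_subgraph (isomorphic_subgraph iH) _.
  by apply: (dual_valid_extrusion xH); apply: base_graph_dual_valid.
Qed.
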